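(* Let $d_0\ge2$ be an integer, $0<\delta<\frac12$, $0<\delta'<\frac{\delta}{8}$, $a>0$ and $\gamma>1$. With $\mathcal{G}_0=\mathcal{G}_0(d_0,\delta,\delta',\gamma,a)$ the class of finite connected graphs defined in the context, $$\lim_{|G|\to\infty,\ G\in\mathcal{G}_0}\ \sup_{x\in E}P_x\big[\mathcal{T}_G\le|G|^{2(1-\delta)}\big]=0,$$ where $E=G\times\mathbb{Z}$ and the limit is uniform over $G\in\mathcal{G}_0$ as $|G|\to\infty$.
   Context: Graphs are simple and undirected and identified with their vertex sets. $G$ is a finite connected graph with $|G|\ge2$ vertices; $\deg(g)$ is the number of neighbors of $g$, $\deg(G)=\max_g\deg(g)$, and $g\sim g'$ means $g,g'$ are neighbors. $[u]$ is the integer part of $u\geq 0$, $\wedge$ denotes minimum. The cylinder $E=G\times\mathbb{Z}$ has the product graph structure ($(g,u)\sim(g',u')$ iff $g=g'$, $|u-u'|=1$ or $u=u'$, $g\sim g'$). $P_x$, $x\in E$, is the law of the discrete-time simple random walk $(X_n)_{n\ge0}$ on $E$ from $x$ (uniform jumps to neighbors), and $P^G_g$ the law of the discrete-time simple random walk $(Y_n)_{n\ge0}$ on $G$ from $g$. For a set $U$, $H_U$ and $T_U$ denote the entrance time in $U$ and exit time from $U$: $H_U=\inf\{n\ge0:\text{walk at time }n\in U\}$, $T_U=\inf\{n\ge0:\text{walk at time }n\notin U\}$. Disconnection time: a finite $S\subseteq E$ disconnects $E$ if for large $M$, $G\times[M,\infty)$ and $G\times(-\infty,-M]$ lie in two distinct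 connected components of $E\setminus S$; $\mathcal{T}_G=\inf\{n\ge0:\{X_0,\dots,X_n\}\text{ disconnects }E\}$. Spectral gap: $\lambda_G=\inf_f \mathcal{D}_G(f,f)/\mathrm{var}(f)$ over nonconstant $f:G\to\mathbb{R}$, where $\mathcal{D}_G(f,f)=\frac{1}{2|G|}\sum_{g,g'\in G,\,g\sim g'}(f(g')-f(g))^2$ and $\mathrm{var}$ is the variance under the uniform distribution on $G$. Set $t_G=\lambda_G^{-1}\log(2|G|)$ and $h=2([\sqrt{t_G}(\log|G|)^2]+1)$. Class $\mathcal{G}_0(d_0,\delta,\delta',\gamma,a)$: finite connected graphs $G$ with $|G|\ge2$, $\deg(G)\le d_0$, such that either (1) $\lambda_G\le|G|^{-2(1-\delta)}(\log|G|)^{-1}$, or (1) does not hold and there exist subsets $G\supseteq A\supseteq V$ with $V$ connected such that: (2) $|A|\ge\lambda_G^{-1/2}|G|^{15\delta/16}$ and $|G|^{\delta/8}\ge|V|\ge\frac1{d_0}|G|^{\delta'}$; (3) $P^G_g[Y_n=g,\,n<T_A]\le a\,n^{-\gamma}$ for all $g\in A$, $n\ge1$; (4) $\dfrac{|G|^{1-\delta/8}}{h'}\ \sup_{x\in A^c\times\mathbb{Z}}P_x[H_C<T_{\widetilde B'}]\le1$, where $h'=[(\sqrt{|A|}\,|G|^{-\delta/8})^{1/\gamma}]\wedge h$ (condition (4) presupposes $h'\ge1$), $\widetilde B'=G\times[-2h'+1,2h'-1]$, and $C=V\times[-v,v]$ with $v=|V|\wedge[h'/2]$ (intervals are intervals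 of integers). *)

(* Defs.v *)
From HB Require Import structures.
From mathcomp Require Import all_boot all_order all_algebra.
From mathcomp Require Import all_classical all_reals all_analysis.

Set Implicit Arguments.
Unset Strict Implicit.
Unset Printing Implicit Defensive.

Import Order.TTheory GRing.Theory Num.Theory.
Import numFieldNormedType.Exports.

Local Open Scope classical_set_scope.
Local Open Scope ring_scope.

(* Defining the walk does not use symmetry of [lf_adj]; it holds for both
   instances below, [fin_graph] and [cylinder]. *)
Record lfgraph := LFGraph {
  lf_vertex :> countType;
  lf_origin : lf_vertex;
  lf_adj : rel lf_vertex;
  lf_nbrs : lf_vertex -> seq lf_vertex;
  lf_nbrs_uniq : forall x, uniq (lf_nbrs x);
  mem_lf_nbrs : forall x y, (y \in lf_nbrs x) = lf_adj x y;
  lf_nbrs_gt0 : forall x, (0 < size (lf_nbrs x))%N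
}.

Definition lf_deg (L : lfgraph) (x : L) : nat := size (lf_nbrs x).

Definition trajectory (L : lfgraph) : Type := nat -> L.

HB.instance Definition _ (L : lfgraph) := Choice.copy (trajectory L) (nat -> L).
(* [lf_origin] plays no other role: measurable types must be pointed. *)
HB.instance Definition _ (L : lfgraph) :=
  isPointed.Build (trajectory L) (fun=> lf_origin L).

(* These sets generate the product sigma-algebra since [L] is countable. *)
Definition coordinate_sets (L : lfgraph) : set (set (trajectory L)) :=
  [set A | exists n y, A = [set X : trajectory L | X n = y]].
Arguments coordinate_sets : clear implicits.

Definition path_space (L : lfgraph) := g_sigma_algebraType (coordinate_sets L).

Definition srw_step (R : realType) (L : lfgraph) (x y : L) : R :=
  if lf_adj x y then (lf_deg x)%:R^-1 else 0.

Definition prefix_set (L : lfgraph) (n : nat) (w : nat -> L) :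
    set (trajectory L) :=
  [set X : trajectory L | forall i, (i <= n)%N -> X i = w i].

Definition is_srw_law (R : realType) (L : lfgraph) (x : L)
    (P : probability (path_space L) R) : Prop :=
  forall (n : nat) (w : nat -> L),
    P (prefix_set n w) =
    ((w 0 == x)%:R * \prod_(i < n) srw_step R (w i) (w i.+1))%:E.

(* Existence: a uniform variable [u] in [0, 1[ drives the walk. From state
   [(y, u)], with [d = lf_deg y], the walk jumps to the neighbor of [y] of
   index [[d * u]] and carries on with the fractional part of [d * u]. *)
Section srw_existence.
Variables (R : realType) (L : lfgraph) (x : L).

Let next (p : L * R) : L * R :=
  let t := (lf_deg p.1)%:R * p.2 in
  (nth p.1 (lf_nbrs p.1) (Num.truncn t), t - (Num.truncn t)%:R).

Let st (u : R) (n : nat) : L * R :=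
  iter n next (x, if 0 <= u < 1 then u else 0).

Let drive (u : R) : path_space L := fun n => (st u n).1.

Let stS u n : st u n.+1 = next (st u n). Proof. by []. Qed.

Let deg_gt0 (y : L) : 0 < (lf_deg y)%:R :> R.
Proof. by rewrite ltr0n lf_nbrs_gt0. Qed.

Let trunc_lt (y : L) (u : R) : 0 <= u < 1 ->
  (Num.truncn ((lf_deg y)%:R * u) < lf_deg y)%N.
Proof.
move=> /andP[u0 u1]; rewrite truncn_lt_nat ?mulr_ge0//.
by rewrite gtr_pMr.
Qed.

Let st_itv u n : 0 <= (st u n).2 < 1.
Proof.
elim: n => [|n IH]; first by rewrite /st/=; case: ifP => //; rewrite lexx ltr01.
rewrite stS /=; have /andP[u0 u1] := IH.
have /truncn_itv/andP[h1 h2] : 0 <= (lf_deg (st u n).1)%:R * (st u n).2.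
  by rewrite mulr_ge0// ltW.
by rewrite subr_ge0 h1 ltrBlDl natr1.
Qed.

Let drive0 u : drive u 0%N = x. Proof. by []. Qed.

Let drive_adj u n : lf_adj (drive u n) (drive u n.+1).
Proof.
rewrite -mem_lf_nbrs /drive stS /= mem_nth//.
exact/trunc_lt/st_itv.
Qed.

Let len (w : nat -> L) n : R := \prod_(i < n) (lf_deg (w i))%:R^-1.

Let len_gt0 w n : 0 < len w n.
Proof. by apply: prodr_gt0 => i _; rewrite invr_gt0. Qed.

Let prefix_itv n w : w 0%N = x ->
  (forall i, (i < n)%N -> lf_adj (w i) (w i.+1)) ->
  exists s : R, [/\ 0 <= s, s + len w n <= 1 & forall u, 0 <= u < 1 ->
    (prefix_set n w (drive u) <-> s <= u < s + len w n) /\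
    (s <= u < s + len w n -> (st u n).2 = (u - s) / len w n)].
Proof.
move=> w0; elim: n => [|n IH] wadj.
  exists 0; rewrite /len big_ord0 add0r; split => // u u01; split.
    split=> // _ i; rewrite leqn0 => /eqP ->; by rewrite w0.
  by move=> _; rewrite subr0 divr1 /st/= u01.
have [|s [s0 s1 H]] := IH; first by move=> i ni; apply: wadj; exact: ltnW.
set l := len w n in s1 H; have l0 : 0 < l := len_gt0 w n.
set d : R := (lf_deg (w n))%:R; have d0 : 0 < d := deg_gt0 (w n).
have lS : len w n.+1 = l / d by rewrite /len big_ord_recr.
have wn : w n.+1 \in lf_nbrs (w n) by rewrite mem_lf_nbrs wadj.
set k := index (w n.+1) (lf_nbrs (w n)).
have kd : (k < lf_deg (w n))%N by rewrite /lf_deg index_mem.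
have kd' : k%:R + 1 <= d by rewrite natr1 ler_nat.
have ld0 : 0 < l / d by rewrite divr_gt0.
have dlk : d * (l / d) = l by rewrite mulrCA divff ?mulr1// gt_eqF.
have bnd : s + k%:R * (l / d) + l / d <= s + l.
  rewrite -addrA lerD2l -{3}dlk -[X in _ + X]mul1r -mulrDl.
  by rewrite ler_pM2r.
exists (s + k%:R * (l / d)); rewrite lS; split.
- by rewrite addr_ge0// mulr_ge0// ltW.
- exact: le_trans bnd s1.
move=> u u01; have [H1 H2] := H u u01.
have key : s <= u < s + l ->
    d * ((u - s) / l) = (u - s) / (l / d).
  by move=> _; rewrite invfM invrK mulrC mulrA.
have sub : s + k%:R * (l / d) <= u < s + k%:R * (l / d) + l / d ->
    s <= u < s + l.
  move=> /andP[a b]; apply/andP; split.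
    by apply: le_trans a; rewrite lerDl mulr_ge0// ltW.
  exact: lt_le_trans b bnd.
have trunc_eq : s <= u < s + l ->
  (Num.truncn (d * ((u - s) / l)) == k) =
  (s + k%:R * (l / d) <= u < s + k%:R * (l / d) + l / d).
  move=> su; rewrite key// truncn_eq; last first.
    by rewrite divr_ge0 ?(ltW ld0)// subr_ge0; case/andP: su.
  rewrite ler_pdivlMr// ltr_pdivrMr// lerBrDl ltrBlDl.
  by rewrite -natr1 mulrDl mul1r addrA.
have stn : prefix_set n w (drive u) -> (st u n).1 = w n by move=> /(_ n); exact.
split; last first.
  move=> su; have su' := sub su; rewrite stS /=.
  rewrite (stn (H1.2 su')) H2// -/d.
  have /eqP -> := etrans (trunc_eq su') su.
  by rewrite key// opprD addrA [RHS]mulrBl mulfK// gt_eqF.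
split => [pre|su].
  have pren : prefix_set n w (drive u) by move=> i /leqW; exact: pre.
  have su := H1.1 pren; rewrite -trunc_eq//.
  have e : (st u n.+1).1 = w n.+1 := pre n.+1 (leqnn _).
  rewrite stS /= (stn pren) (H2 su) -/d in e.
  have tl : (Num.truncn (d * ((u - s) / l)) < size (lf_nbrs (w n)))%N.
    by rewrite -(H2 su); apply: trunc_lt; exact: st_itv.
  by rewrite /k -e index_uniq// lf_nbrs_uniq.
have su' := sub su; have pren := H1.2 su'.
move=> i; rewrite leq_eqVlt => /predU1P[->|]; last by rewrite ltnS; exact: pren.
rewrite /drive stS /= (stn pren) H2// -/d.
have /eqP -> := etrans (trunc_eq su') su.
by rewrite nth_index.
Qed.

Let unit_itv : set R := `[0, 1[%classic.

Let prefix_cases n w :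
  (exists s : R, [/\ 0 <= s, s + len w n <= 1,
     unit_itv `&` drive @^-1` prefix_set n w = `[s, s + len w n[%classic &
     (w 0%N == x)%:R * \prod_(i < n) srw_step R (w i) (w i.+1) = len w n]) \/
  (drive @^-1` prefix_set n w = set0 /\
     (w 0%N == x)%:R * \prod_(i < n) srw_step R (w i) (w i.+1) = 0).
Proof.
have [w0|w0] := eqVneq (w 0%N) x; last first.
  right; rewrite mul0r; split => //; apply/seteqP; split => // u /= /(_ 0%N isT).
  by rewrite drive0 => /esym/eqP; rewrite (negbTE w0).
have [wadj|/existsNP[i /not_implyP[ni /negP wi]]] :=
    pselect (forall i, (i < n)%N -> lf_adj (w i) (w i.+1)); last first.
  right; split; last first.
    rewrite (bigD1 (Ordinal ni))//= /srw_step (negbTE wi).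
    by rewrite mul0r mulr0.
  apply/seteqP; split => // u /= pre.
  by have := drive_adj u i; rewrite !pre ?(ltnW ni)// (negbTE wi).
left; have [s [s0 s1 H]] := prefix_itv w0 wadj; exists s; split => //.
  apply/seteqP; split => u /=; rewrite /unit_itv /= !in_itv/=.
    by move=> [u01 pre]; exact: (H u u01).1.1.
  move=> su; have u01 : 0 <= u < 1.
    case/andP: su => a b.
    by rewrite (le_trans s0 a) (lt_le_trans b s1).
  by split => //; exact: (H u u01).1.2.
rewrite mul1r; apply: eq_bigr => i _; by rewrite /srw_step wadj.
Qed.

Let drive_out u : ~ unit_itv u -> drive u = drive 1.
Proof.
rewrite /unit_itv /= in_itv /= => /negP u01; apply/funext => n.
by rewrite /drive /st (negbTE u01) ltxx andbF.
Qed.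

Let measurable_unit_itv : measurable unit_itv.
Proof. exact: measurable_itv. Qed.

Let measurable_prefix n w : measurable (unit_itv `&` drive @^-1` prefix_set n w).
Proof.
have [[s [_ _ -> _]]|[-> _]] := prefix_cases n w; first exact: measurable_itv.
by rewrite setI0.
Qed.

Let measurable_drive :
  @measurable_fun _ _ (measurableTypeR R) (path_space L) setT drive.
Proof.
apply: (@measurability _ _ (measurableTypeR R) (path_space L) setT drive
  (coordinate_sets L) erefl).
move=> _ [_ [n [y ->]] <-]; rewrite setTI.
set A := [set X : trajectory L | X n = y].
rewrite -(setIT (drive @^-1` A)) -(setvU unit_itv) setIUr.
apply: measurableU.
  have [Ad|Ad] := pselect (A (drive 1)).
    rewrite setIidr; first exact: measurableC.
    by move=> u uI; rewrite /preimage /= drive_out.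
  rewrite (_ : _ `&` _ = set0)//; apply/seteqP; split => // u [+ uI].
  by rewrite /preimage /= drive_out.
rewrite setIC (_ : _ `&` _ = \bigcup_(t : seq L)
    (if nth y t n == y then unit_itv `&` drive @^-1` prefix_set n (nth y t)
     else set0)); last first.
  apply/seteqP; split => u.
    move=> [uI Au]; exists (mkseq (drive u) n.+1) => //.
    rewrite nth_mkseq// [drive u n]Au eqxx; split => //= i ni.
    by rewrite nth_mkseq.
  move=> [t _]; case: ifPn => // /eqP ty [uI pre]; split => //.
  by rewrite /A /preimage /= pre.
apply: countable_bigcupT_measurable => [|t]; first exact: countableP.
by case: ifP => // _; exact: measurable_prefix.
Qed.

Let law : set (path_space L) -> \bar R :=
  @pushforward _ _ (measurableTypeR R) (path_space L) R
    (mrestr (@lebesgue_measure R) measurable_unit_itv) drive.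

Let lawE A : law A = lebesgue_measure (unit_itv `&` drive @^-1` A).
Proof. by rewrite /law /pushforward /mrestr setIC. Qed.

Let law0 : law set0 = 0%E.
Proof. by rewrite lawE preimage_set0 setI0 measure0. Qed.

Let law_ge0 A : (0 <= law A)%E.
Proof. exact: measure_ge0. Qed.

Let law_sigma_additive : semi_sigma_additive law.
Proof.
exact: (@measure_semi_sigma_additive _ _ _ (@pushforward _ _ (measurableTypeR R)
  (path_space L) R (mrestr (@lebesgue_measure R) measurable_unit_itv) drive)).
Qed.

HB.instance Definition _ := isMeasure.Build _ _ _ law
  law0 law_ge0 law_sigma_additive.

Let law_setT : law [set: _] = 1%E.
Proof.
rewrite lawE preimage_setT setIT lebesgue_measure_itv/= lte_fin ltr01.
by rewrite sube0.
Qed.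

HB.instance Definition _ := Measure_isProbability.Build _ _ _ law law_setT.

Lemma srw_law_exists : exists P : probability (path_space L) R, is_srw_law x P.
Proof.
exists law => n w; rewrite /= lawE.
have [[s [_ _ -> ->]]|[-> ->]] := prefix_cases n w; last by rewrite setI0 measure0.
rewrite lebesgue_measure_itv/= lte_fin ltrDl len_gt0.
by rewrite -EFinB addrC addKr.
Qed.

End srw_existence.

Lemma srw_law_unique (R : realType) (L : lfgraph) (x : L)
    (P Q : probability (path_space L) R) :
  is_srw_law x P -> is_srw_law x Q ->
  forall A, measurable A -> P A = Q A.
Proof.
move=> HP HQ.
pose G : set (set (path_space L)) :=
  [set A | [\/ A = setT, A = set0 | exists n w, A = prefix_set n w]].
have mprefix n w : <<s coordinate_sets L >> (@prefix_set L n w).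
  have -> : prefix_set n w = \bigcap_(i in `I_n.+1) [set X | X i = w i].
    by apply/seteqP; split => X pre i ni; apply: pre; move: ni; rewrite /= ltnS.
  apply: (@bigcap_measurableType _ (path_space L)) => i _.
  by apply: sub_gen_smallest; exists i, (w i).
have GE : <<s coordinate_sets L >> = <<s G >>.
  apply/seteqP; split; apply: smallest_sub => //; try exact: smallest_sigma_algebra.
    move=> _ [n [y ->]].
    rewrite (_ : [set _ | _] = \bigcup_(t : seq L)
        (if nth y t n == y then prefix_set n (nth y t) else set0)); last first.
      apply/seteqP; split => X.
        move=> Xn; exists (mkseq X n.+1) => //.
        rewrite nth_mkseq// [X n]Xn eqxx => i ni.
        by rewrite nth_mkseq.
      by move=> [t _]; case: ifPn => // /eqP ty pre; rewrite /= pre.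
    apply: (@countable_bigcupT_measurable _ (g_sigma_algebraType G)) => [|t].
      exact: countableP.
    case: ifP => _; last exact: measurable0.
    by apply: sub_gen_smallest; apply: Or33; exists n, (nth y t).
  move=> _ [->|->|[n [w ->]]]; last exact: mprefix.
    exact: (@measurableT _ (path_space L)).
  exact: (@measurable0 _ (path_space L)).
apply: (measure_unique G (fun=> setT)) => //.
- move=> A B [->|->|[n [w ->]]]; rewrite ?setTI ?set0I//; first by move=> _; exact: Or32.
  move=> [->|->|[m [v ->]]]; rewrite ?setIT ?setI0.
  + by apply: Or33; exists n, w.
  + by exact: Or32.
  have [H|] := pselect (forall i, (i <= n)%N -> (i <= m)%N -> w i = v i).
    apply: Or33; exists (maxn n m), (fun i => if (i <= n)%N then w i else v i).
    apply/seteqP; split => X.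
      move=> [Xw Xv] i; rewrite leq_max; case: ifP => [/Xw//|/= _ /Xv//].
    move=> pre; split => i ni.
      by rewrite pre ?leq_max ?ni.
    rewrite pre ?leq_max ?ni ?orbT//; case: ifP => // /H; exact.
  move=> H; apply: Or32; apply/seteqP; split => // X [Xw Xv]; apply: H => i ni mi.
  by rewrite -Xw// Xv.
- by move=> k; exact: Or31.
- by rewrite bigcup_const.
- move=> A [->|->|[n [w ->]]]; last exact: etrans (HP n w) (esym (HQ n w)).
    exact: etrans (probability_setT P) (esym (probability_setT Q)).
  by rewrite !measure0.
- by move=> k; apply: (@le_lt_trans _ _ 1%E); [rewrite probability_le1 | rewrite ltry].
Qed.

Definition srw_law (R : realType) (L : lfgraph) (x : L) :
  probability (path_space L) R := sval (cid (srw_law_exists R x)).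

Lemma srw_lawP (R : realType) (L : lfgraph) (x : L) :
  is_srw_law x (srw_law R x).
Proof. exact: svalP (cid (srw_law_exists R x)). Qed.

Section walk_times.
Variables (R : realType) (T : Type).

Definition first_time (Q : set nat) : \bar R :=
  ereal_inf [set (n%:R)%:E | n in Q].

Definition entrance_time (U : set T) (X : nat -> T) : \bar R :=
  first_time [set n | U (X n)].

Definition exit_time (U : set T) (X : nat -> T) : \bar R :=
  first_time [set n | ~ U (X n)].

End walk_times.

Definition joined_in (L : lfgraph) (U : set L) (x y : L) : Prop :=
  exists2 p : seq L, path (@lf_adj L) x p /\ last x p = y &
    forall z, z \in x :: p -> U z.

Definition is_component (L : lfgraph) (U C : set L) : Prop :=
  exists2 x, U x & C = [set y | joined_in U x y].

Record fcgraph := FCGraph {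
  fc_vertex :> finType;
  fc_adj : rel fc_vertex;
  fc_adj_sym : symmetric fc_adj;
  fc_adj_irr : irreflexive fc_adj;
  fc_connected : forall g g', connect fc_adj g g';
  fc_card_gt1 : (1 < #|fc_vertex|)%N
}.

Section graph.
Variable G : fcgraph.
Implicit Types g : G.

Definition fc_nbrs g : seq G := enum (fc_adj g).

Definition fc_origin : G := enum_val (Ordinal (ltnW (fc_card_gt1 G))).

Lemma fc_nbrs_uniq g : uniq (fc_nbrs g).
Proof. exact: enum_uniq. Qed.

Lemma mem_fc_nbrs g g' : (g' \in fc_nbrs g) = fc_adj g g'.
Proof. by rewrite mem_enum. Qed.

Lemma fc_nbrs_gt0 g : (0 < size (fc_nbrs g))%N.
Proof.
rewrite -cardE; have /card_gt1P[a [b [_ _ ab]]] := fc_card_gt1 G.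
have [g' gg'] : exists g', g != g'.
  by have [->|ga] := eqVneq g a; [exists b | exists a].
have /connectP[[|z p] /= pth e] := fc_connected g g'.
  by rewrite e eqxx in gg'.
by apply/card_gt0P; exists z; case/andP: pth.
Qed.

Definition fin_graph : lfgraph :=
  LFGraph fc_origin fc_nbrs_uniq mem_fc_nbrs fc_nbrs_gt0.

Definition cyl_adj (x y : G * int) : bool :=
  (x.1 == y.1) && (`|x.2 - y.2| == 1) || (x.2 == y.2) && fc_adj x.1 y.1.

Definition cyl_nbrs (x : G * int) : seq (G * int) :=
  [:: (x.1, x.2 + 1); (x.1, x.2 - 1)] ++ [seq (g, x.2) | g <- fc_nbrs x.1].

Lemma cyl_nbrs_uniq x : uniq (cyl_nbrs x).
Proof.
case: x => g u; rewrite /cyl_nbrs cat_uniq map_inj_uniq ?fc_nbrs_uniq; last first.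
  by move=> a b [].
rewrite andbT /= inE xpair_eqE eqxx /= (inj_eq (addrI u)) /=.
apply/hasPn => -[a b] /mapP[g' gg' [-> ->]].
rewrite !inE !xpair_eqE negb_or; apply/andP; split; apply/negP => /andP[_];
  by rewrite -[eqbLHS]addr0 (inj_eq (addrI u)).
Qed.

Lemma mem_cyl_nbrs x y : (y \in cyl_nbrs x) = cyl_adj x y.
Proof.
case: x y => [g u] [g' u']; rewrite mem_cat !inE !xpair_eqE /cyl_adj/=.
rewrite -andb_orr [g' == g]eq_sym; congr (_ && _ || _); last first.
  apply/mapP/andP => [[z zg [-> ->]]|[/eqP <- gg']].
    by rewrite -mem_fc_nbrs.
  by exists g'; rewrite ?mem_fc_nbrs.
rewrite eqr_norml ler01 andbT orbC !subr_eq.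
rewrite [1 + _]addrC [-1 + _]addrC; congr orb; first by rewrite eq_sym subr_eq.
by rewrite [RHS]eq_sym subr_eq.
Qed.

Lemma cyl_nbrs_gt0 x : (0 < size (cyl_nbrs x))%N.
Proof. by []. Qed.

Definition cylinder : lfgraph :=
  LFGraph (fc_origin, 0 : int) cyl_nbrs_uniq mem_cyl_nbrs cyl_nbrs_gt0.

Definition disconnects (S : set cylinder) : Prop :=
  exists M0 : int, forall M : int, M0 <= M ->
    exists C C' : set cylinder,
      [/\ is_component (~` S) C, is_component (~` S) C', C <> C',
          [set x : cylinder | M <= x.2] `<=` C &
          [set x : cylinder | x.2 <= - M] `<=` C'].

Definition disconnection_time (R : realType) (X : nat -> cylinder) : \bar R :=
  first_time R [set n | disconnects [set X i | i in [set i | (i <= n)%N]]].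

Definition max_deg : nat := \max_(g : G) lf_deg (g : fin_graph).

Definition connected_subset (V : {set G}) : Prop :=
  forall g g', g \in V -> g' \in V ->
    connect [rel z z' | [&& fc_adj z z', z \in V & z' \in V]] g g'.

Section spectral_gap.
Variable R : realType.

Definition dirichlet (f : G -> R) : R :=
  (2 * #|G|%:R)^-1 * \sum_(g : G) \sum_(g' : G | fc_adj g g') (f g' - f g) ^+ 2.

Definition unif_mean (f : G -> R) : R := #|G|%:R^-1 * \sum_(g : G) f g.

Definition unif_var (f : G -> R) : R :=
  unif_mean (fun g => (f g - unif_mean f) ^+ 2).

Definition spectral_gap : R :=
  inf [set dirichlet f / unif_var f | f in [set f | exists g g', f g != f g']].

Definition relax_time : R := spectral_gap^-1 * ln (2 * #|G|%:R).

Definition height : nat :=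
  (2 * (Num.truncn (Num.sqrt relax_time * ln #|G|%:R ^+ 2) + 1))%N.

End spectral_gap.
End graph.

Section graph_class.
Variables (R : realType) (d0 : nat) (delta delta' gamma a : R) (G : fcgraph).

Local Notation N := (#|G|%:R : R).
Local Notation lambda := (spectral_gap G R).

Definition small_gap : Prop :=
  lambda <= N `^ (- (2 * (1 - delta))) * (ln N)^-1.

Definition size_cond (A V : {set G}) : Prop :=
  [/\ lambda `^ (- (1 / 2)) * N `^ (15 * delta / 16) <= #|A|%:R,
      #|V|%:R <= N `^ (delta / 8) &
      d0%:R^-1 * N `^ delta' <= #|V|%:R].

Definition return_cond (A : {set G}) : Prop :=
  forall (g : fin_graph G) (n : nat), g \in A -> (1 <= n)%N ->
    (srw_law R g [set Y | Y n = g /\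
        n%:R%:E < exit_time R [set z : G | z \in A] Y]
      <= (a * n%:R `^ (- gamma))%:E)%E.

Definition height' (A : {set G}) : nat :=
  minn (Num.truncn ((Num.sqrt #|A|%:R * N `^ (- (delta / 8))) `^ gamma^-1))
       (height G R).

Definition box' (A : {set G}) : set (cylinder G) :=
  let h' : int := Posz (height' A) in
  [set x : cylinder G | - (2 * h') + 1 <= x.2 <= 2 * h' - 1].

Definition core (A V : {set G}) : set (cylinder G) :=
  let v : int := Posz (minn #|V| (height' A)./2) in
  [set x : cylinder G | x.1 \in V /\ - v <= x.2 <= v].

(* If [A] is everything, the supremum is over the empty set, equals [-oo], and
   the inequality holds, as it does with the convention [sup set0 = 0]. *)
Definition hitting_cond (A V : {set G}) : Prop :=
  (1 <= height' A)%N /\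
  ((N `^ (1 - delta / 8) / (height' A)%:R)%:E *
     ereal_sup [set srw_law R x
                      [set X | entrance_time R (core A V) X < exit_time R (box' A) X]
               | x in [set x : cylinder G | x.1 \notin A]] <= 1)%E.

Definition class_G0 : Prop :=
  (max_deg G <= d0)%N /\
  (small_gap \/
   ~ small_gap /\
   exists A V : {set G},
     [/\ V \subset A, connected_subset V, size_cond A V, return_cond A &
         hitting_cond A V]).

End graph_class.

(* Main.v *)
(* When the spectral gap is tiny, an approximate eigenfunction for it varies so
   slowly along the walk that the fibres over its maximum and its minimum are not
   both visited in time, although a disconnecting trajectory covers every fibre.

   Otherwise let [W] be a connected subset of [V] with [m] elements, a small power
   of [|G|]. A set that disconnects the cylinder has at least [m / 4] points in
   some window [W x [u - m, u + m]]. Such an accumulation takes either many visits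
   of the walk to [W x Z] without leaving [A x Z], which has superpolynomially
   small probability by the heat kernel decay (3), or many returns from outside
   [A x Z]. Each return has probability at most a negative power of [|G|]:
   within height [2 h'] of the window this is (4), between [h'] and [2 h] it
   follows from the heat kernel decay and a gambler's ruin comparison, and from
   height [2 h] on the spectral gap has equidistributed the walk over [G]. All
   hitting probabilities are bounded by explicit supersolutions. *)
Require Import Defs.
From mathcomp Require Import all_boot all_order all_algebra.
From mathcomp Require Import all_classical all_reals all_analysis.
From mathcomp Require Import ring lra zify.

Set Implicit Arguments.
Unset Strict Implicit.
Unset Printing Implicit Defensive.

Import Order.TTheory GRing.Theory Num.Theory.
Import numFieldNormedType.Exports.

Local Open Scope classical_set_scope.
Local Open Scope ring_scope.

(** * Simple random walk and its law *)

(** Write N for |G|. The walk is used up to the time n, the integer part of N^(2(1-delta)), and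
    stopping at n is replaced by killing at a rate of order 1/n: the cylinder is recurrent, and
    killing gives it a Green function, of order sqrt n in the vertical direction. The strong Markov
    property becomes an induction on the horizon.

    The two coordinates of the walk are coupled, because its vertical speed depends on the degree. A
    holding probability that depends on the vertex only delays the walk but changes the generator.
    One choice gives all edges the same rate, so that the gap for the uniform distribution applies;
    another makes the projection to G a lazy simple random walk at every height, so that (3)
    applies.

    The exponents balance as follows. A return from outside A to a slice over V has probability at
    most N^(-delta/4). A window over W consists of 2|W|+1 slices, and |W| is small enough that a
    return to it still has probability at most N^(-delta/8). With q delta >= 32, q returns cost
    N^(-4), against order N^2 positions of the window. *)

Section walk_operator.
Variables (R : realType) (L : lfgraph).
Implicit Types (f g : L -> R) (x y : L).

Definition walk_mean f x : R := (lf_deg x)%:R^-1 * \sum_(y <- lf_nbrs x) f y.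

Lemma lf_deg_gt0 x : 0 < (lf_deg x)%:R :> R.
Proof. by rewrite ltr0n lf_nbrs_gt0. Qed.

Lemma walk_mean_le f g x :
  (forall y, lf_adj x y -> f y <= g y) -> walk_mean f x <= walk_mean g x.
Proof.
move=> fg; rewrite ler_pM2l ?invr_gt0 ?lf_deg_gt0// big_seq [leRHS]big_seq.
by apply: ler_sum => y; rewrite mem_lf_nbrs; exact: fg.
Qed.

Lemma walk_mean_cst (c : R) x : walk_mean (fun=> c) x = c.
Proof.
rewrite /walk_mean big_const_seq count_predT iter_addr addr0.
by rewrite -[c *+ _]mulr_natl mulrA mulVf ?mul1r// gt_eqF// lf_deg_gt0.
Qed.

Lemma eq_walk_mean f g x :
  (forall y, lf_adj x y -> f y = g y) -> walk_mean f x = walk_mean g x.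
Proof.
by move=> fg; apply/le_anti/andP; split; apply: walk_mean_le => y /fg ->.
Qed.

Lemma walk_meanD f g x :
  walk_mean (fun y => f y + g y) x = walk_mean f x + walk_mean g x.
Proof. by rewrite /walk_mean big_split mulrDr. Qed.

Lemma walk_meanZ (c : R) f x :
  walk_mean (fun y => c * f y) x = c * walk_mean f x.
Proof. by rewrite /walk_mean -mulr_sumr mulrCA. Qed.

Lemma walk_mean_sum (I : Type) (r : seq I) (F : I -> L -> R) x :
  walk_mean (fun y => \sum_(i <- r) F i y) x = \sum_(i <- r) walk_mean (F i) x.
Proof. by rewrite /walk_mean exchange_big mulr_sumr. Qed.

Lemma walk_mean_ge0 f x : (forall y, 0 <= f y) -> 0 <= walk_mean f x.
Proof. by move=> f0; rewrite -[leLHS](walk_mean_cst 0 x) walk_mean_le. Qed.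

Lemma walk_mean_le_cst f (c : R) x :
  (forall y, lf_adj x y -> f y <= c) -> walk_mean f x <= c.
Proof. by move=> fc; rewrite -[leRHS](walk_mean_cst c x) walk_mean_le. Qed.

(** The law of the positions at times 0, ..., n, by conditioning on the first step; the states
    already visited are stored in the predicate. Events of the walk are estimated in this form, free
    of measure theory. *)
Fixpoint walk_prob n (Q : pred (seq L)) x : R :=
  if n is n'.+1 then walk_mean (walk_prob n' (fun s => Q (x :: s))) x
  else (Q [:: x])%:R.

Lemma walk_prob_ge0 n Q x : 0 <= walk_prob n Q x.
Proof.
by elim: n Q x => [|n IH] Q x /=; [exact: ler0n | exact: walk_mean_ge0].
Qed.

Lemma walk_prob_le n (Q Q' : pred (seq L)) x :
  (forall s, size s = n -> path (@lf_adj L) x s -> Q (x :: s) -> Q' (x :: s)) ->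
  walk_prob n Q x <= walk_prob n Q' x.
Proof.
elim: n Q Q' x => [|n IH] Q Q' x QQ' /=.
  by have := QQ' [::] erefl isT; case: (Q _) => [->|]; rewrite ?ler0n.
apply: walk_mean_le => y xy; apply: IH => s sn pys.
by apply: QQ'; rewrite /= ?sn// xy.
Qed.

Lemma walk_prob_const n (b : bool) x : walk_prob n (fun=> b) x = b%:R.
Proof.
by elim: n x => //= n IH x; rewrite -[RHS](walk_mean_cst _ x); exact: eq_walk_mean.
Qed.

Lemma walk_prob_orb n (Q Q' : pred (seq L)) x :
  walk_prob n (fun s => Q s || Q' s) x <= walk_prob n Q x + walk_prob n Q' x.
Proof.
elim: n Q Q' x => [|n IH] Q Q' x /=.
  by rewrite -natrD ler_nat; case: (Q _); case: (Q' _).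
by rewrite -walk_meanD; apply: walk_mean_le => y _; exact: IH.
Qed.

Lemma walk_prob_has (I : Type) (r : seq I) n (Q : I -> pred (seq L)) x :
  walk_prob n (fun s => has (fun i => Q i s) r) x <=
  \sum_(i <- r) walk_prob n (Q i) x.
Proof.
elim: r => [|i r IH] /=.
  by rewrite big_nil walk_prob_const.
by rewrite big_cons; apply: le_trans (walk_prob_orb _ _ _ _) _; rewrite lerD2l.
Qed.

End walk_operator.

Section walk_law.
Variables (R : realType) (L : lfgraph).

Lemma measurable_path_event n (Q : pred (seq L)) :
  measurable ([set X | Q (mkseq X n)] : set (path_space L)).
Proof.
have mcoord i y : measurable ([set X | X i = y] : set (path_space L)).
  by apply: sub_gen_smallest; exists i, y.
rewrite (_ : [set _ | _] = \bigcup_(s : seq L)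
    (if Q s && (size s == n) then
       \bigcap_(i in `I_n) [set X : path_space L | X i = nth (lf_origin L) s i]
     else set0)); last first.
  apply/seteqP; split => X /=.
    move=> QX; exists (mkseq X n) => //; rewrite QX size_mkseq eqxx /= => i ni.
    by rewrite /= nth_mkseq.
  move=> [s _]; case: ifP => // /andP[Qs /eqP sn] H; suff -> : mkseq X n = s by [].
  apply: (@eq_from_nth _ (lf_origin L)); rewrite size_mkseq// => i ni.
  by rewrite nth_mkseq// (H i ni).
apply: countable_bigcupT_measurable => [|s]; first exact: countableP.
case: ifP => // _; apply: (@bigcap_measurableType _ (path_space L)
  (fun i => [set X | X i = nth (lf_origin L) s i]) `I_n) => i _.
exact: mcoord.
Qed.

Lemma prefix_setE n (w : nat -> L) :
  prefix_set n w = [set X | mkseq X n.+1 == mkseq w n.+1].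
Proof.
apply/seteqP; split => X /=; last first.
  move=> /eqP e i; rewrite -ltnS => ni.
  by rewrite -(nth_mkseq (X 0%N) X ni) e nth_mkseq.
move=> pre; apply/eqP/(@eq_from_nth _ (X 0%N)); rewrite !size_mkseq// => i ni.
by rewrite !nth_mkseq// pre.
Qed.

Lemma measurable_prefix n (w : nat -> L) :
  measurable (prefix_set n w : set (path_space L)).
Proof.
rewrite prefix_setE.
exact: (@measurable_path_event n.+1 (fun s => s == mkseq w n.+1)).
Qed.

Let upd (w : nat -> L) k y i := if (i <= k)%N then w i else y.

Let prefix_upd w k y (X : trajectory L) :
  prefix_set k.+1 (upd w k y) X <-> prefix_set k w X /\ X k.+1 = y.
Proof.
split=> [pre|[pre Xy] i].
  split; last by rewrite pre// /upd ltnn.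
  by move=> i ik; rewrite pre ?leqW// /upd ik.
by rewrite leq_eqVlt /upd => /predU1P[->|]; rewrite ?ltnn// ltnS => /[dup] /pre -> ->.
Qed.

Variable x : L.
Local Notation P := (srw_law R x).

Let prefix_updE k w y :
  P (prefix_set k.+1 (upd w k y)) = (P (prefix_set k w) * (srw_step R (w k) y)%:E)%E.
Proof.
rewrite !srw_lawP -EFinM big_ord_recr /= mulrA; congr ((_ * _ * _)%:E).
  by apply: eq_bigr => i _; rewrite /upd ltnW// ltn_ord.
by rewrite /upd leqnn ltnn.
Qed.

Let mnotin i (s : seq L) :
  measurable ([set X | X i \notin s] : set (path_space L)).
Proof.
rewrite (_ : [set X | _] = [set X | nth (lf_origin L) (mkseq X i.+1) i \notin s]).
  exact: (@measurable_path_event i.+1 (fun t => nth (lf_origin L) t i \notin s)).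
by apply/seteqP; split => X /=; rewrite nth_mkseq.
Qed.

Let split_le k w (E : set (path_space L)) : measurable E -> E `<=` prefix_set k w ->
  forall s : seq L, uniq s ->
  (P E = \sum_(y <- s) P (E `&` [set X | X k.+1 = y]) +
       P (E `&` [set X | X k.+1 \notin s]))%E.
Proof.
move=> mE Ek.
have mcoord i y : measurable ([set X | X i = y] : set (path_space L)).
  by apply: sub_gen_smallest; exists i, y.
elim=> [_|y s IH] /=.
  by rewrite big_nil add0e; congr (P _); apply/seteqP; split => // X [].
move=> /andP[ys us]; rewrite big_cons IH// -addeA addeCA; congr (_ + _)%E.
rewrite -measureU//.
- congr (P _); apply/seteqP; split => X /=.
    move=> [EX ns]; case: (eqVneq (X k.+1) y) => Xy; first by left.
    by right; split => //; rewrite inE negb_or Xy.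
  move=> [[EX Xy]|[EX ns]]; split => //; first by rewrite Xy.
  by move: ns; rewrite inE negb_or => /andP[].
- exact: measurableI.
- exact: measurableI.
- apply/seteqP; split => // X /= [[_ Xy] [_]].
  by rewrite inE Xy eqxx.
Qed.

Let fin_P (A : set (path_space L)) : measurable A -> (P A \is a fin_num)%E.
Proof. by move=> mA; rewrite fin_num_measure. Qed.

(** The path space contains trajectories that jump to non-neighbors. They have mass 0 because the
    extensions of a prefix to the neighbors already carry its whole mass. *)
Let null_step k w :
  P (prefix_set k w `&` [set X | X k.+1 \notin lf_nbrs (w k)]) = 0%E.
Proof.
have := split_le (@measurable_prefix k w) (@subset_refl _ _) (lf_nbrs_uniq (w k)).
rewrite (_ : \sum_(y <- _) _ = P (prefix_set k w))%E.
  rewrite -(fineK (fin_P (@measurable_prefix k w))).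
  rewrite -(fineK (fin_P (measurableI _ _ (@measurable_prefix k w)
    (mnotin k.+1 (lf_nbrs (w k)))))).
  by rewrite -EFinD => -[e]; congr (_%:E); lra.
transitivity (\sum_(y <- lf_nbrs (w k)) P (prefix_set k.+1 (upd w k y)))%E.
  apply: eq_bigr => y _; congr (P _).
  by apply/seteqP; split => X /=; rewrite prefix_upd.
under eq_bigr do rewrite prefix_updE srw_lawP -EFinM.
rewrite srw_lawP sumEFin -mulr_sumr; congr ((_)%:E); rewrite -[RHS]mulr1; congr (_ * _).
rewrite -[RHS](walk_mean_cst (1 : R) (w k)) /walk_mean mulr_sumr.
by apply: eq_big_seq => y; rewrite mem_lf_nbrs /srw_step mulr1 => ->.
Qed.

(** Markov property at a fixed time. The induction is on the length of the future, with the prefix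
    generalized: the first step of the future is moved into the prefix. *)
Let markov n : forall k w (Q : pred (seq L)),
  P (prefix_set k w `&` [set X | Q (mkseq (fun i => X (k + i)%N) n.+1)]) =
  (P (prefix_set k w) * (walk_prob R n Q (w k))%:E)%E.
Proof.
have mQ' k m (Q : pred (seq L)) :
    measurable ([set X | Q (mkseq (fun i => X (k + i)%N) m)] : set (path_space L)).
  rewrite (_ : [set _ | _] = [set X | Q (drop k (mkseq X (k + m)))]).
    exact: (@measurable_path_event (k + m) (fun s => Q (drop k s))).
  apply/seteqP; split => X /=; rewrite /mkseq -map_drop drop_iota add0n addKn;
    by rewrite -[in iota k m](addn0 k) iotaDl -map_comp.
have mQ k m w (Q : pred (seq L)) : measurable (prefix_set k w `&`
    [set X | Q (mkseq (fun i => X (k + i)%N) m)] : set (path_space L)).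
  by apply: measurableI; [exact: measurable_prefix | exact: mQ'].
elim: n => [|n IH] k w Q.
  case: (boolP (Q [:: w k])) => Qw /=; rewrite ?Qw ?(negbTE Qw) ?mule1 ?mule0.
    congr (P _); apply/seteqP; split => X /= => [[]//|pre]; split => //.
    by rewrite /mkseq /= addn0 pre.
  rewrite (_ : _ `&` _ = set0) ?measure0//; apply/seteqP; split => // X /= [pre].
  by rewrite /mkseq /= addn0 pre// (negbTE Qw).
rewrite (@split_le k w _ (mQ _ _ _ _) (@subIsetl _ _ _) _ (lf_nbrs_uniq (w k))).
rewrite [X in (_ + X)%E](_ : _ = 0%E) ?adde0; last first.
  apply/eqP; rewrite eq_le measure_ge0 andbT -(null_step k w).
  apply: le_measure; rewrite ?inE.
  - apply: measurableI; first exact: mQ.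
    exact: mnotin.
  - apply: measurableI; first exact: measurable_prefix.
    exact: mnotin.
  - by move=> X /= [[pre _] ns].
transitivity (\sum_(y <- lf_nbrs (w k)) P (prefix_set k.+1 (upd w k y) `&`
    [set X | Q (w k :: mkseq (fun i => X (k.+1 + i)%N) n.+1)]))%E.
  apply: eq_bigr => y _; congr (P _).
  have Emk (X : trajectory L) : mkseq (fun i => X (k + i)%N) n.+2 =
      X k :: mkseq (fun i => X (k.+1 + i)%N) n.+1.
    rewrite /mkseq /= !addn0 addn1; congr [:: _, _ & _].
    rewrite -[2%N]/(1 + 1)%N iotaDl -map_comp; apply: eq_map => i /=.
    by rewrite add1n addSnnS.
  apply/seteqP; split => X.
    move=> [[pre]]; rewrite [X in X -> _]/= Emk => QX Xy; split.
      by rewrite prefix_upd.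
    by rewrite /= -(pre k).
  move=> [/prefix_upd[pre Xy]] /= QX; split => //; split => //.
  by rewrite -[mkseq _ _.+2]/(mkseq _ n.+2) Emk pre.
under eq_bigr do rewrite (IH _ _ (fun s => Q (w k :: s))) prefix_updE.
rewrite /= srw_lawP -EFinM.
under eq_bigr do rewrite -!EFinM /upd ltnn.
rewrite sumEFin; congr (_%:E); rewrite /walk_mean !mulr_sumr.
apply: eq_big_seq => y; rewrite mem_lf_nbrs /srw_step => ->.
by rewrite -mulrA.
Qed.

Theorem srw_law_path_event n (Q : pred (seq L)) :
  P [set X | Q (mkseq X n.+1)] = (walk_prob R n Q x)%:E.
Proof.
have P0 : P (prefix_set 0 (fun=> x)) = 1%E.
  by rewrite srw_lawP eqxx big_ord0 mulr1.
have m0 := @measurable_prefix 0 (fun=> x).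
have := markov n 0 (fun=> x) Q; rewrite P0 mul1e => <-.
have mQ := @measurable_path_event n.+1 Q.
rewrite -[in LHS](setIT [set X | _]) -(setvU (prefix_set 0 (fun=> x))) setIUr.
rewrite measureU//.
- rewrite [X in (X + _)%E](_ : _ = 0%E) ?add0e.
    by rewrite setIC.
  apply/eqP; rewrite eq_le measure_ge0 andbT.
  apply: (@le_trans _ _ (P (~` prefix_set 0 (fun=> x)))).
    apply: le_measure; rewrite ?inE; last by move=> X [].
      by apply: measurableI => //; exact: measurableC.
    exact: measurableC.
  by rewrite probability_setC// P0 subee.
- by apply: measurableI => //; exact: measurableC.
- by apply: measurableI.
- by apply/seteqP; split => // X [[_ h] [_ h']]; apply: h h'.
Qed.

End walk_law.

(** * Hitting and visit probabilities *)

Section hitting.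
Variables (R : realType) (L : lfgraph).
Implicit Types (C D M W : pred L) (x y : L) (n i j l : nat) (s : seq L).

(** A state in both [C] and [D] counts as hit. The horizon matters: by recurrence, a nonempty set of
    the cylinder is hit almost surely if nothing kills the walk. *)
Fixpoint hit_prob n C D x : R :=
  if C x then 1 else if D x then 0 else
  if n is n'.+1 then walk_mean (hit_prob n' C D) x else 0.

Fixpoint hits_before C D s : bool :=
  if s is x :: s' then C x || ~~ D x && hits_before C D s' else false.

Lemma hit_probE n C D x : hit_prob n C D x = walk_prob R n (hits_before C D) x.
Proof.
elim: n x => [|n IH] x /=.
  by case: (C x); rewrite // andbF; case: (D x).
case Cx: (C x) => /=; first last.
  case: (D x) => /=; last by apply: eq_walk_mean => y _.
  rewrite -[LHS](walk_mean_cst 0 x); apply: eq_walk_mean => y _.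
  by rewrite (walk_prob_const _ _ false).
rewrite -[LHS](walk_mean_cst 1 x); apply: eq_walk_mean => y _.
by rewrite (walk_prob_const _ _ true).
Qed.

Lemma hit_prob_ge0 n C D x : 0 <= hit_prob n C D x.
Proof. by rewrite hit_probE walk_prob_ge0. Qed.

Lemma hit_prob_le1 n C D x : hit_prob n C D x <= 1.
Proof.
elim: n x => [|n IH] x /=; case: (C x); case: (D x) => //.
exact: walk_mean_le_cst.
Qed.

Lemma hit_probS n C D x : hit_prob n C D x <= hit_prob n.+1 C D x.
Proof.
elim: n x => [|n IH] x /=; case: (C x); case: (D x) => //.
  by apply: walk_mean_ge0 => y; exact: (hit_prob_ge0 0).
by apply: walk_mean_le => y _; exact: IH.
Qed.

Lemma hit_prob_sub n C C' D D' x : (forall y, C y -> C' y) ->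
  (forall y, D' y -> D y) -> hit_prob n C D x <= hit_prob n C' D' x.
Proof.
move=> CC' DD'; elim: n x => [|n IH] x /=; case Cx: (C x); rewrite ?(CC' _ Cx)//;
  case C'x: (C' x); rewrite ?ler01//.
- by case: (D x).
- by case: ifP => _; case: ifP.
- by case: ifP => // _; apply: walk_mean_le_cst => y _; exact: hit_prob_le1.
case: ifP => Dx; case: ifP => D'x //.
- by apply: walk_mean_ge0 => y; exact: hit_prob_ge0.
- by rewrite (DD' _ D'x) in Dx.
- exact: walk_mean_le.
Qed.

Lemma hit_prob_has (I : Type) (r : seq I) n (C : I -> pred L) D x :
  hit_prob n (fun y => has (C^~ y) r) D x <= \sum_(i <- r) hit_prob n (C i) D x.
Proof.
elim: n x => [|n IH] x; rewrite /=; case: ifP => [Cx|/negbT].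
- elim: r Cx => //= i r IH; rewrite big_cons; case: (C i x) => /= [_|/IH h].
    by rewrite lerDl sumr_ge0// => k _; exact: (hit_prob_ge0 0).
  by apply: le_trans h _; rewrite lerDr; case: ifP.
- move=> _; case: ifP => _; rewrite sumr_ge0// => k _; do ?case: ifP => //.
- elim: r Cx {IH} => //= i r IH; rewrite big_cons; case: (C i x) => /= [_|/IH h].
    by rewrite lerDl sumr_ge0// => k _; exact: (hit_prob_ge0 n.+1 (C k) D x).
  apply: le_trans h _; rewrite lerDr; case: ifP => // _.
  by apply: walk_mean_ge0 => y; exact: hit_prob_ge0.
- move=> nC; case: ifP => Dx.
    by rewrite sumr_ge0// => k _; case: ifP.
  rewrite [leRHS](_ : _ = \sum_(i <- r) walk_mean (hit_prob n (C i) D) x).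
    rewrite -walk_mean_sum; apply: walk_mean_le => y _; exact: IH.
  elim: r nC {IH} => [|i r IH]; first by rewrite !big_nil.
  by rewrite /= negb_or !big_cons => /andP[/negbTE -> /IH ->].
Qed.

(** Optional stopping: rho^k f(X_k) is a supermartingale until [C] or [D] is reached, and stopping
    no later than time [n] loses at most the factor rho^n. *)
Lemma hit_prob_supersolution (rho : R) n C D (f : L -> R) x :
  0 <= rho <= 1 -> (forall y, 0 <= f y) -> (forall y, C y -> 1 <= f y) ->
  (forall y, ~~ C y -> ~~ D y -> rho * walk_mean f y <= f y) ->
  rho ^+ n * hit_prob n C D x <= f x.
Proof.
move=> /andP[r0 r1] f0 f1 sf; elim: n x => [|n IH] x /=.
  case: ifP => [/f1|_]; first by rewrite expr0 mulr1.
  by case: ifP; rewrite mulr0.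
case: ifP => [/f1 h|/negbT nC].
  by apply: le_trans h; rewrite mulr1 exprn_ile1.
case: ifP => [_|/negbT nD]; first by rewrite mulr0.
apply: le_trans (sf _ nC nD); rewrite exprS -mulrA ler_wpM2l// -walk_meanZ.
exact: walk_mean_le.
Qed.

(** Strong Markov property at the entrance to [M]. The bound [B] at the full horizon suffices, since
    less time remains after the entrance and [hit_prob] is monotone in the horizon. *)
Lemma hit_prob_strong n C D M (B : R) x : 0 <= B ->
  (forall y, M y -> hit_prob n C D y <= B) ->
  hit_prob n C D x <=
  hit_prob n C (fun y => D y || M y) x + B * hit_prob n M D x.
Proof.
move=> B0; elim: n x => [|n IH] x HB /=.
  case: (C x); first by rewrite lerDl mulr_ge0//; do ?case: ifP.
  by case: (D x); case: (M x) => /=; rewrite ?addr_ge0 ?mulr_ge0.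
case Cx: (C x).
  by rewrite lerDl mulr_ge0//; do ?case: ifP => //; rewrite walk_mean_ge0// => *;
    exact: hit_prob_ge0.
case Dx: (D x) => /=; first by rewrite addr_ge0// mulr_ge0//; case: ifP.
case Mx: (M x) => /=; first by rewrite add0r mulr1; have := HB _ Mx; rewrite /= Cx Dx.
rewrite -walk_meanZ -walk_meanD; apply: walk_mean_le => y _; apply: IH => z Mz.
exact: le_trans (hit_probS _ _ _ _) (HB _ Mz).
Qed.

Lemma hit_prob_strong_le n C D M (B : R) x : 0 <= B ->
  (forall y, M y -> hit_prob n C D y <= B) ->
  hit_prob n C D x <= hit_prob n C (fun y => D y || M y) x + B.
Proof.
move=> B0 /hit_prob_strong => /(_ x B0) /le_trans; apply.
by rewrite lerD2l ler_piMr// hit_prob_le1.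
Qed.

Lemma hit_prob_eq0 n C D (S : L -> Prop) x : S x -> (forall y, S y -> ~~ C y) ->
  (forall y z, S y -> ~~ D y -> lf_adj y z -> S z) -> hit_prob n C D x = 0.
Proof.
move=> Sx SC SS; elim: n x Sx => [|n IH] x Sx /=; rewrite (negbTE (SC _ Sx)).
  by case: ifP.
case: ifP => // /negbT nD; rewrite -[RHS](walk_mean_cst 0 x).
by apply: eq_walk_mean => y xy; apply: IH; exact: SS xy.
Qed.

Lemma hit_prob_killed n C D x : ~~ C x -> D x -> hit_prob n C D x = 0.
Proof. by move=> /negbTE Cx Dx; case: n => [|n] /=; rewrite Cx Dx. Qed.

Lemma walk_prob_has2 n C C' (B B' : R) x : 0 <= B -> 0 <= B' ->
  (forall y, C y -> hit_prob n C' pred0 y <= B') ->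
  (forall y, C' y -> hit_prob n C pred0 y <= B) ->
  walk_prob R n (fun s => has C s && has C' s) x <= B + B'.
Proof.
have hasE (P : pred L) s : has P s = hits_before P pred0 s.
  by elim: s => //= y s ->.
have bnd (P Q : pred L) m y : walk_prob R m (fun s => has P s && has Q s) y <=
    hit_prob m Q pred0 y.
  by rewrite hit_probE walk_prob_le// => s _ _; rewrite -hasE => /andP[].
move=> B0 B'0; have bndC m y : C y -> (C y -> hit_prob m C' pred0 y <= B') ->
    walk_prob R m (fun s => has C s && has C' s) y <= B + B'.
  by move=> Cy h; apply: le_trans (bnd _ _ _ _) _; rewrite (le_trans (h Cy))// lerDr.
have bndC' m y : C' y -> (C' y -> hit_prob m C pred0 y <= B) ->
    walk_prob R m (fun s => has C s && has C' s) y <= B + B'.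
  move=> Cy h; apply: (@le_trans _ _ (walk_prob R m (fun s => has C' s && has C s) y)).
    by apply: walk_prob_le => s _ _; rewrite andbC.
  by apply: le_trans (bnd _ _ _ _) _; rewrite (le_trans (h Cy))// lerDl.
elim: n x => [|n IH] x HC HC'.
  case Cx: (C x); first exact: bndC (HC x).
  by rewrite /= Cx /= addr_ge0.
case Cx: (C x); first exact: bndC (HC x).
case C'x: (C' x); first exact: bndC' (HC' x).
rewrite /= Cx C'x; apply: walk_mean_le_cst => y _; apply: IH => z zC.
  exact: le_trans (hit_probS _ _ _ _) (HC _ zC).
exact: le_trans (hit_probS _ _ _ _) (HC' _ zC).
Qed.

(** Probability of at least [j] visits to [W] at times 0, ..., n, before [D]. The boolean [W x]
    counts as 0 or 1, and [j] is the number of visits still missing. *)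
Fixpoint visit_prob n j W D x : R :=
  if j == 0%N then 1 else if D x then 0 else
  if n is n'.+1 then walk_mean (visit_prob n' (j - W x) W D) x
  else (j <= W x)%N%:R.

Fixpoint visit_mean n W D x : R :=
  if D x then 0 else
  (W x)%:R + (if n is n'.+1 then walk_mean (visit_mean n' W D) x else 0).

Lemma visit_probE n j W x :
  visit_prob n j W pred0 x = walk_prob R n (fun s => (j <= count W s)%N) x.
Proof.
elim: n j x => [|n IH] [|j] x /=; rewrite ?addn0 ?leq0n//.
  rewrite -[LHS](walk_mean_cst 1 x); apply: eq_walk_mean => y _.
  by rewrite (walk_prob_const _ _ true).
apply: eq_walk_mean => y _; rewrite IH; congr walk_prob.
by apply/funext => s /=; rewrite leq_subLR.
Qed.

Lemma visit_prob0 n W D x : visit_prob n 0 W D x = 1.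
Proof. by case: n. Qed.

Lemma visit_prob_ge0 n j W D x : 0 <= visit_prob n j W D x.
Proof.
elim: n j x => [|n IH] j x /=; do ?case: ifP => //; rewrite ?ler0n// => *.
exact: walk_mean_ge0.
Qed.

Lemma visit_prob_le1 n j W D x : visit_prob n j W D x <= 1.
Proof.
elim: n j x => [|n IH] j x /=; do ?case: ifP => // *; last exact: walk_mean_le_cst.
by rewrite lern1 leq_b1.
Qed.

Lemma visit_probS n j W D x : visit_prob n j W D x <= visit_prob n.+1 j W D x.
Proof.
elim: n j x => [|n IH] j x; last first.
  rewrite [leLHS]/= [leRHS]/=; do 2 case: ifP => // _.
  by apply: walk_mean_le => y _; exact: IH.
rewrite /=; do 2 case: ifP => // _; case: (leqP j (W x)) => jW.
  have /eqP -> : (j - W x == 0)%N by [].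
  by rewrite (@eq_walk_mean _ _ _ (fun=> 1)) ?walk_mean_cst.
by apply: walk_mean_ge0 => y; exact: (visit_prob_ge0 0 (j - W x) W D y).
Qed.

Lemma visit_prob_anti n j j' W D x : (j <= j')%N ->
  visit_prob n j' W D x <= visit_prob n j W D x.
Proof.
elim: n j j' x => [|n IH] [|j] [|j'] x //=.
- by move=> _; case: ifP => //; rewrite lern1 leq_b1.
- move=> jj'; case: ifP => // _; rewrite ler_nat; case: (leqP j'.+1 (W x)) => // h.
  by rewrite (leq_trans _ h).
- by move=> _; case: ifP => // _; apply: walk_mean_le_cst => *; exact: visit_prob_le1.
move=> jj'; case: ifP => // _; apply: walk_mean_le => y _; apply: IH.
by rewrite leq_sub2r.
Qed.

Lemma visit_prob_markov n j W D x :
  j%:R * visit_prob n j W D x <= visit_mean n W D x.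
Proof.
elim: n j x => [|n IH] [|j] x.
- by rewrite mul0r /=; case: ifP => // _; rewrite addr0 ler0n.
- rewrite /=; case: ifP; rewrite ?mulr0// => _.
  by case: (W x); case: j => [|j]; rewrite ?mulr1 ?mulr0 ?addr0.
- rewrite mul0r /=; case: ifP => // _; rewrite addr_ge0 ?walk_mean_ge0// => y.
  by rewrite (le_trans _ (IH 0%N y))// mul0r.
rewrite /=; case: ifP; rewrite ?mulr0// => _; rewrite -walk_meanZ.
case: (W x) => /=; last first.
  by rewrite add0r; apply: walk_mean_le => y _; rewrite subn0; exact: IH.
rewrite -[1 in leRHS](walk_mean_cst 1 x) -walk_meanD; apply: walk_mean_le => y _.
by rewrite subSS subn0 -natr1 mulrDl mul1r addrC lerD// visit_prob_le1.
Qed.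

(** After the [j]-th visit the walk starts afresh and has to make [l] more visits. *)
Lemma visit_prob_submul n j l W D (B : R) x : (forall y, visit_prob n l W D y <= B) ->
  visit_prob n (j + l) W D x <= visit_prob n j W D x * B.
Proof.
elim: n j x => [|n IH] [|j] x HB.
- by rewrite add0n visit_prob0 mul1r.
- have B0 : 0 <= B := le_trans (visit_prob_ge0 0 l W D x) (HB x).
  rewrite /=; case: ifP; rewrite ?mul0r// => _.
  case: (W x) => /=; last by rewrite mul0r.
  case: j => [|j]; rewrite /= ?mul0r// mul1r; case: l HB => [|l] HB /=.
    by have := HB x.
  by [].
- by rewrite add0n visit_prob0 mul1r.
have HB' y : visit_prob n l W D y <= B := le_trans (visit_probS _ _ _ _ _) (HB y).
rewrite /=; case: ifP; rewrite ?mul0r// => _; rewrite mulrC -walk_meanZ.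
apply: walk_mean_le => y _; rewrite mulrC.
case: (W x) => /=; first by rewrite subSS subn0 addSn subSS subn0; exact: IH.
by rewrite !subn0; exact: IH.
Qed.

(** By Markov's inequality a number of visits that is twice the mean has probability at most 1/2,
    from every starting point; hence [k] successive rounds multiply. *)
Lemma visit_prob_exp n l k W D (M : R) x : 0 <= M -> 2 * M <= l%:R ->
  (forall y, visit_mean n W D y <= M) -> (0 < l)%N ->
  visit_prob n (k * l) W D x <= 2^-1 ^+ k.
Proof.
move=> M0 Ml HM l0.
have half y : visit_prob n l W D y <= 2^-1.
  have l0' : 0 < l%:R :> R by rewrite ltr0n.
  rewrite -(ler_pM2l l0'); apply: le_trans (visit_prob_markov _ _ _ _ _) _.
  by apply: le_trans (HM y) _; lra.
elim: k x => [|k IH] x; first by rewrite mul0n visit_prob0.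
rewrite mulSn addnC exprSr.
apply: le_trans (visit_prob_submul _ _ half) _.
by rewrite ler_wpM2r.
Qed.

(* The walk either makes [l] visits to [W] before reaching [D], or is left with
   at least [j] visits to make after reaching it. *)
Lemma visit_prob_split n j l W D (B : R) x : 0 <= B ->
  (forall y, D y -> visit_prob n j W pred0 y <= B) ->
  visit_prob n (l + j) W pred0 x <= visit_prob n l W D x + B.
Proof.
move=> B0; elim: n l x => [|n IH] l x HB.
  case: l => [|l]; first by rewrite visit_prob0 (le_trans (visit_prob_le1 _ _ _ _ _))// lerDl.
  case Dx: (D x).
    apply: le_trans (visit_prob_anti _ _ _ _ (leq_addl l.+1 j)) _.
    by apply: le_trans (HB _ Dx) _; rewrite lerDr visit_prob_ge0.
  rewrite /= Dx (@le_trans _ _ (l.+1 <= W x)%N%:R) ?lerDl// ler_nat.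
  by case: (leqP (l.+1 + j) (W x)) => // h; rewrite (leq_trans _ h)// leq_addr.
case: l => [|l]; first by rewrite visit_prob0 (le_trans (visit_prob_le1 _ _ _ _ _))// lerDl.
case Dx: (D x).
  apply: le_trans (visit_prob_anti _ _ _ _ (leq_addl l.+1 j)) _.
  by apply: le_trans (HB _ Dx) _; rewrite lerDr visit_prob_ge0.
rewrite /= Dx -[B](walk_mean_cst B x) -walk_meanD; apply: walk_mean_le => y _.
have HB' z : D z -> visit_prob n j W pred0 z <= B.
  by move=> Dz; apply: le_trans (visit_probS _ _ _ _ _) (HB _ Dz).
by case: (W x) => /=; rewrite ?subn0 ?addSn ?subSS ?subn0 -?addSn; exact: IH.
Qed.

Lemma visit_prob_hit n j W (B : R) x : 0 <= B -> (0 < j)%N ->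
  (forall y, visit_prob n j W pred0 y <= B) ->
  visit_prob n j W pred0 x <= B * hit_prob n W pred0 x.
Proof.
move=> B0 j0; elim: n x => [|n IH] x HB.
  case Wx: (W x); first by rewrite /= Wx mulr1; have := HB x; rewrite /= Wx.
  by rewrite /= Wx mulr0; case: j j0 {HB}.
case Wx: (W x); first by rewrite [hit_prob _ _ _ _]/= Wx mulr1.
rewrite /= Wx; case: j j0 HB IH => // j _ HB IH; rewrite /= -walk_meanZ.
apply: walk_mean_le => y _; rewrite subn0; apply: IH => z.
exact: le_trans (visit_probS _ _ _ _ _) (HB z).
Qed.

(** With b_k = 2 e + q^k, one more block of [l] visits is either completed before [D], at cost e, or
    requires a return from [D], at cost q b_k. Since q <= 1/2, e + q b_k <= b_(k+1). *)
Lemma visit_prob_ladder n l k W D (e q : R) x : 0 <= e -> 0 <= q <= 2^-1 ->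
  (0 < l)%N -> (forall y, visit_prob n l W D y <= e) ->
  (forall y, D y -> hit_prob n W pred0 y <= q) ->
  visit_prob n (k.+1 * l) W pred0 x <= 2 * e + q ^+ k.
Proof.
move=> e0 /andP[q0 q2] l0 He Hq; elim: k x => [|k IH] x.
  by rewrite expr0 (le_trans (visit_prob_le1 _ _ _ _ _))// lerDr mulr_ge0.
have B0 : 0 <= 2 * e + q ^+ k by rewrite addr_ge0 ?mulr_ge0 ?exprn_ge0.
rewrite mulSn; apply: le_trans (@visit_prob_split _ _ _ _ D _ _ (mulr_ge0 B0 q0) _) _.
  move=> y Dy; apply: le_trans (visit_prob_hit _ B0 _ IH) _.
    by rewrite muln_gt0.
  by rewrite ler_wpM2l// Hq.
apply: le_trans (lerD (He x) (lexx _)) _.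
by rewrite exprSr; have : e * q <= e * 2^-1 by [rewrite ler_wpM2l]; lra.
Qed.

End hitting.

(** * Entrance and exit times, and the killed walk *)

Section times.
Variable R : realType.

Lemma first_timeP (Q : set nat) :
  (Q = set0 /\ first_time R Q = +oo%E) \/
  exists n, [/\ Q n, forall m, (m < n)%N -> ~ Q m & first_time R Q = n%:R%:E].
Proof.
have [->|/set0P[n0 Qn0]] := eqVneq Q set0.
  by left; rewrite /first_time image_set0 ereal_inf0.
right; have exQ : exists n, `[< Q n >] by exists n0; apply/asboolP.
case: (ex_minnP exQ) => n /asboolP Qn nmin; exists n; split => //.
  move=> m mn Qm; have : (n <= m)%N by apply: nmin; apply/asboolP.
  by rewrite leqNgt mn.
apply/le_anti/andP; split; first by apply: ereal_inf_lbound; exists n.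
apply: le_ereal_inf_tmp => _ [m Qm <-]; rewrite lee_fin ler_nat; apply: nmin.
exact/asboolP.
Qed.

Lemma first_time_le (Q : set nat) (r : R) :
  (first_time R Q <= r%:E)%E <-> exists2 n, Q n & n%:R <= r.
Proof.
have [[-> ->]|[n [Qn nmin ->]]] := first_timeP Q.
  by rewrite leye_eq; split => // -[].
rewrite lee_fin; split => [nr|[m Qm mr]]; first by exists n.
apply: le_trans mr; rewrite ler_nat leqNgt; apply/negP => mn; exact: nmin mn Qm.
Qed.

Lemma lt_first_time (Q : set nat) (k : nat) :
  (k%:R%:E < first_time R Q)%E <-> forall j, (j <= k)%N -> ~ Q j.
Proof.
rewrite ltNge; split=> [/negP h j jk Qj|h].
  by apply: h; apply/first_time_le; exists j => //; rewrite ler_nat.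
apply/negP => /first_time_le[j Qj]; rewrite ler_nat => jk; exact: h Qj.
Qed.

End times.

Section law_of_times.
Variables (R : realType) (L : lfgraph).
Implicit Types (C D : pred L) (x y : L) (X : nat -> L).

Lemma hits_beforeP C D X n : hits_before C D (mkseq X n.+1) <->
  exists2 k, (k <= n)%N & C (X k) /\ forall j, (j < k)%N -> ~~ D (X j).
Proof.
elim: n X => [|n IH] X.
  rewrite /= andbF orbF; split=> [CX|[[|k] //= _ []//]].
  by exists 0%N.
have -> : mkseq X n.+2 = X 0%N :: mkseq (fun i => X i.+1) n.+1.
  by rewrite /mkseq /= -[2%N]/(1 + 1)%N iotaDl -map_comp.
rewrite -[hits_before _ _ (_ :: _)]/(C (X 0%N) || ~~ D (X 0%N) &&
  hits_before C D (mkseq (fun i => X i.+1) n.+1)).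
split=> [/orP[CX|/andP[nD /IH[k kn [Ck Dk]]]]|[[|k] kn [Ck Dk]]].
- by exists 0%N.
- by exists k.+1 => //; split => // -[|j] jk //; exact: Dk.
- by rewrite Ck.
- apply/orP; right; rewrite (Dk 0%N)//=; apply/IH; exists k => //; split => // j jk.
  exact: (Dk j.+1).
Qed.

(** The event on the right is the union over all horizons of the events counted by [hit_prob].
    Disjointness of [C] and [D] makes the inequality between the two times strict. *)
Lemma hit_prob_le_law n C D x : (forall y, C y -> ~~ D y) ->
  ((hit_prob R n C D x)%:E <=
   srw_law R x [set X | (entrance_time R [set y | C y] X <
                         exit_time R [set y | ~~ D y] X)%E])%E.
Proof.
move=> CD; rewrite hit_probE -srw_law_path_event.
rewrite [X in (_ <= srw_law R x X)%E](_ : _ =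
    \bigcup_k [set X | hits_before C D (mkseq X k.+1)]); last first.
  apply/seteqP; split => X /=.
    rewrite /entrance_time; case: (first_timeP R [set n | C (X n)]) => [[_ ->]|].
      by rewrite ltNge leey.
    move=> [k [Ck kmin ->]] /lt_first_time h; exists k => //; apply/hits_beforeP.
    by exists k => //; split => // j /ltnW /h /contrapT.
  move=> [m _ /hits_beforeP[k km [Ck Dk]]].
  apply: (@le_lt_trans _ _ k%:R%:E); first by apply/first_time_le; exists k.
  apply/lt_first_time => j; rewrite leq_eqVlt /= => /predU1P[->|/Dk ->//].
  by rewrite CD.
apply: le_measure; rewrite ?inE.
- exact: (@measurable_path_event L n.+1 (hits_before C D)).
- apply: (@bigcup_measurable _ (path_space L)) => k _.
  exact: (@measurable_path_event L k.+1 (hits_before C D)).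
- by move=> X /= h; exists n.
Qed.

(** Semigroup of the walk killed on [D]: the expectation of [f] at time [n] over the paths that
    avoid [D] at times 0, ..., n. For [f] a point mass it is the quantity in condition (3). *)
Fixpoint killed n D (f : L -> R) x : R :=
  if D x then 0 else if n is n'.+1 then walk_mean (killed n' D f) x else f x.

Lemma killed_law n D x y :
  srw_law R x [set X | X n = y /\ (n%:R%:E < exit_time R [set z | ~~ D z] X)%E] =
  (killed n D (fun z => (z == y)%:R) x)%:E.
Proof.
pose Q s := all (predC D) s && (last y s == y).
rewrite [X in srw_law R x X](_ : _ = [set X | Q (mkseq X n.+1)]); last first.
  have QE X : Q (mkseq X n.+1) = all (predC D) (mkseq X n.+1) && (X n == y).
    by rewrite /Q {2}mkseqS last_rcons.
  apply/seteqP; split => X.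
    move=> [Xy /lt_first_time h]; change (Q (mkseq X n.+1)).
    rewrite QE Xy eqxx andbT; apply/allP => z /mapP[i]; rewrite mem_iota => /= ni ->.
    exact: contrapT (h i ni).
  change (Q (mkseq X n.+1) -> X n = y /\ (n%:R%:E < exit_time R [set z | ~~ D z] X)%E).
  rewrite QE => /andP[/allP h /eqP ->]; split => //; apply/lt_first_time => j jn.
  by apply; apply: (h (X j)); apply/mapP; exists j => //; rewrite mem_iota.
rewrite srw_law_path_event; congr (_%:E); rewrite {}/Q.
elim: n x => [|n IH] x /=; first by rewrite andbT; case: (D x).
case: (D x) => /=.
  by rewrite -[RHS](walk_mean_cst 0 x); apply: eq_walk_mean => z _; rewrite walk_prob_const.
by apply: eq_walk_mean => z _; rewrite -IH; apply/le_anti/andP; split;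
  apply: walk_prob_le.
Qed.

Lemma killed_ge0 n D f x : (forall y, 0 <= f y) -> 0 <= killed n D f x.
Proof.
move=> f0; elim: n x => [|n IH] x /=; case: ifP => // _; exact: walk_mean_ge0.
Qed.

Lemma killed_le_cst n D f c x : 0 <= c -> (forall y, f y <= c) -> killed n D f x <= c.
Proof.
move=> c0 fc; elim: n x => [|n IH] x /=; case: ifP => // _; exact: walk_mean_le_cst.
Qed.

Lemma killed_sum (I : Type) (r : seq I) n D (f : I -> L -> R) x :
  killed n D (fun y => \sum_(i <- r) f i y) x = \sum_(i <- r) killed n D (f i) x.
Proof.
elim: n x => [|n IH] x /=; case: ifP => // _; rewrite ?big1_eq//.
by rewrite -walk_mean_sum; apply: eq_walk_mean.
Qed.

Lemma killed_add m n D f x : killed (m + n) D f x = killed m D (killed n D f) x.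
Proof.
elim: m x => [|m IH] x; last by rewrite addSn /=; case: ifP => // _; apply: eq_walk_mean.
by rewrite add0n /=; case: ifP => // Dx; case: n => [|n] /=; rewrite Dx.
Qed.

End law_of_times.

(** * Lazy chains and truncated Green functions *)

Section lazy_chain.
Variables (R : realType) (L : lfgraph) (w : L -> R) (D : pred L).
Implicit Types (f g : L -> R) (x y : L) (n T : nat).

(** Holding with probability [1 - w x] does not change the order in which states are visited; [w] is
    free to be chosen so that the generator becomes convenient. *)
Definition lazy_step f x : R :=
  if D x then 0 else (1 - w x) * f x + w x * walk_mean f x.

Definition lazy_iter n f : L -> R := iter n lazy_step f.

Hypothesis w01 : forall x, 0 <= w x <= 1.

Lemma lazy_step_le f g x : (forall y, f y <= g y) -> lazy_step f x <= lazy_step g x.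
Proof.
move=> fg; rewrite /lazy_step; case: ifP => // _; have /andP[w0 w1] := w01 x.
by apply: lerD; rewrite ler_wpM2l ?subr_ge0// walk_mean_le.
Qed.

Lemma eq_lazy_step f g x : (forall y, f y = g y) -> lazy_step f x = lazy_step g x.
Proof. by move=> /funext ->. Qed.

Lemma lazy_iter_le n f g x : (forall y, f y <= g y) -> lazy_iter n f x <= lazy_iter n g x.
Proof. by move=> fg; elim: n x => [|n IH] x //=; exact: lazy_step_le. Qed.

Lemma lazy_step_sum (I : Type) (r : seq I) (F : I -> L -> R) x :
  lazy_step (fun y => \sum_(i <- r) F i y) x = \sum_(i <- r) lazy_step (F i) x.
Proof.
rewrite /lazy_step; case: ifP => _; first by rewrite big1_eq.
by rewrite walk_mean_sum !mulr_sumr -big_split.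
Qed.

Lemma lazy_stepZ c f x : lazy_step (fun y => c * f y) x = c * lazy_step f x.
Proof. by rewrite /lazy_step; case: ifP; rewrite ?mulr0// walk_meanZ mulrDr !(mulrCA c). Qed.

Lemma lazy_iter_sum (I : Type) (r : seq I) (F : I -> L -> R) n x :
  lazy_iter n (fun y => \sum_(i <- r) F i y) x = \sum_(i <- r) lazy_iter n (F i) x.
Proof.
elim: n x => [//|n IH] x /=; rewrite -lazy_step_sum; exact: eq_lazy_step.
Qed.

Lemma lazy_iterZ c f n x : lazy_iter n (fun y => c * f y) x = c * lazy_iter n f x.
Proof. elim: n x => [//|n IH] x /=; rewrite -lazy_stepZ; exact: eq_lazy_step. Qed.

Lemma lazy_iterD f g n x :
  lazy_iter n (fun y => f y + g y) x = lazy_iter n f x + lazy_iter n g x.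
Proof.
have := lazy_iter_sum [:: true; false] (fun b y => if b then f y else g y) n x.
rewrite !big_cons !big_nil addr0 => <-; congr lazy_iter; apply/funext => y.
by rewrite !big_cons big_nil addr0.
Qed.

Lemma lazy_iter_ge0 n f x : (forall y, 0 <= f y) -> 0 <= lazy_iter n f x.
Proof.
move=> f0; elim: n x => [//|n IH] x /=; rewrite /lazy_step; case: ifP => // _.
have /andP[w0 w1] := w01 x; rewrite addr_ge0// mulr_ge0// ?subr_ge0//.
exact: walk_mean_ge0.
Qed.

Lemma lazy_iter_le1 n f x : (forall y, f y <= 1) -> lazy_iter n f x <= 1.
Proof.
move=> f1; elim: n x => [//|n IH] x /=; rewrite /lazy_step; case: ifP => // _.
have /andP[w0 w1] := w01 x.
rewrite -[leRHS](subrK (w x)) lerD//.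
  by rewrite ler_piMr// subr_ge0.
by rewrite ler_piMr//; exact: walk_mean_le_cst.
Qed.

Definition lazy_green (k : R) T f x : R :=
  \sum_(i < T) (1 - k) ^+ i * lazy_iter i f x.

Lemma lazy_greenS (k : R) T f x :
  lazy_green k T.+1 f x = f x + (1 - k) * lazy_step (lazy_green k T f) x.
Proof.
rewrite /lazy_green big_ord_recl expr0 mul1r; congr (_ + _).
rewrite [in RHS]lazy_step_sum mulr_sumr; apply: eq_bigr => i _.
by rewrite lazy_stepZ mulrA -exprS.
Qed.

Lemma lazy_green_ge0 (k : R) T f x : k <= 1 -> (forall y, 0 <= f y) -> 0 <= lazy_green k T f x.
Proof.
by move=> k1 f0; rewrite sumr_ge0// => i _; rewrite mulr_ge0 ?exprn_ge0 ?subr_ge0// lazy_iter_ge0.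
Qed.

Lemma lazy_green_le_sum (k : R) T f x : 0 <= k <= 1 -> (forall y, 0 <= f y) ->
  lazy_green k T f x <= \sum_(i < T) lazy_iter i f x.
Proof.
move=> /andP[k0 k1] f0; apply: ler_sum => i _; rewrite ler_piMl ?lazy_iter_ge0//.
by rewrite exprn_ile1 ?subr_ge0// gerBl.
Qed.

(* The truncated resolvent of the lazy chain is, up to the error [k] due to the
   truncation, superharmonic for the walk killed at rate [k / w0]. *)
Lemma hit_prob_le_green (w0 k : R) n T (C : pred L) x :
  (forall y, w0 <= w y) -> 0 < k -> 2 * n%:R * k <= w0 -> k < w0 -> k^-1 ^+ 3 <= T%:R ->
  hit_prob R n C D x <= 2 * (lazy_green k T (fun y => (C y)%:R) x + k).
Proof.
move=> w0w k0 nk kw0 kT.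
have w00 : 0 < w0 by exact: lt_trans kw0.
have k1 : k < 1.
  by apply: lt_le_trans kw0 _; apply: le_trans (w0w x) _; have /andP[] := w01 x.
(* Bernoulli: (1 + T k) (1 - k)^T <= (1 - k^2)^T <= 1, while T k >= k^(-2). *)
have trunc : (1 - k) ^+ T <= k ^+ 2.
  have Tk : T%:R * k * (1 - k) ^+ T <= 1.
    have : (1 + T%:R * k) * (1 - k) ^+ T <= 1.
      apply: (@le_trans _ _ ((1 + k) ^+ T * (1 - k) ^+ T)).
        rewrite ler_wpM2r ?exprn_ge0 ?subr_ge0 ?(ltW k1)//.
        elim: T {kT} => [|T IH]; first by rewrite mul0r addr0 expr0.
        rewrite exprSr -natr1; apply: (@le_trans _ _ ((1 + T%:R * k) * (1 + k))).
          have : 0 <= T%:R * k * k by rewrite !mulr_ge0// ltW.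
          nra.
        by rewrite ler_wpM2r// addr_ge0// ltW.
      by rewrite -exprMn exprn_ile1//; nra.
    rewrite mulrDl mul1r => h; apply: le_trans h; rewrite lerDr.
    by rewrite exprn_ge0// subr_ge0 ltW.
  have kTk : k ^- 2 <= T%:R * k.
    rewrite -ler_pdivrMr//; apply: le_trans kT.
    by rewrite [leRHS]exprSr exprVn.
  have e0 : 0 <= (1 - k) ^+ T by rewrite exprn_ge0// subr_ge0 ltW.
  have := le_trans (ler_wpM2r e0 kTk) Tk.
  by rewrite mulrC ler_pdivrMr ?exprn_gt0// mul1r.
(* The truncated resolvent misses its equation by at most (1 - k)^T <= k^2; the added constant [k]
   gains exactly k^2 when multiplied by 1 - k. *)
set S := lazy_green k T _; pose f y := S y + k.
have S0 y : 0 <= S y by apply: lazy_green_ge0 => [|z]; rewrite ?ler0n// ltW.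
have f0 y : 0 <= f y by rewrite addr_ge0// ltW.
have w0n : 0 < 1 - k / w0 by rewrite subr_gt0 ltr_pdivrMr// mul1r.
have half : 2^-1 <= (1 - k / w0) ^+ n.
  have bern m : 1 - m%:R * (k / w0) <= (1 - k / w0) ^+ m.
    elim: m => [|m IH]; first by rewrite mul0r subr0 expr0.
    rewrite exprSr; apply: le_trans (ler_wpM2r (ltW w0n) IH).
    rewrite -natr1; have : 0 <= m%:R * (k / w0) * (k / w0).
      by apply: mulr_ge0; [apply: mulr_ge0; rewrite ?ler0n|]; rewrite ?divr_ge0 ?(ltW k0) ?(ltW w00).
    nra.
  apply: le_trans (bern n); rewrite mulrA.
  have : n%:R * k / w0 <= 2^-1 by rewrite ler_pdivrMr//; lra.
  lra.
have main : (1 - k / w0) ^+ n * hit_prob R n C D x <= f x.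
  apply: hit_prob_supersolution => //.
  - by rewrite (ltW w0n) gerBl divr_ge0// ltW.
  - move=> y Cy; rewrite /f /S; case: (T) kT => [|T'] kT.
      by move: kT; rewrite leNgt exprn_gt0 ?invr_gt0.
    rewrite lazy_greenS Cy -addrA lerDl addr_ge0 ?(ltW k0)// mulr_ge0 ?subr_ge0 ?(ltW k1)//.
    rewrite -[0](_ : lazy_step (fun=> 0) y = 0); last first.
      by rewrite /lazy_step walk_mean_cst !mulr0 addr0 if_same.
    apply: lazy_step_le => z; apply: lazy_green_ge0 => [|t]; rewrite ?ler0n // ltW//.
  move=> y nC nD.
  have Sy : (1 - k) * lazy_step S y <= S y + k ^+ 2.
    have e : S y + (1 - k) ^+ T * lazy_iter T (fun z => (C z)%:R) y =
        (1 - k) * lazy_step S y.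
      have := lazy_greenS k T (fun z => (C z)%:R) y.
      by rewrite (negbTE nC) add0r => <-; rewrite [RHS]/lazy_green big_ord_recr.
    rewrite -e lerD2l; apply: le_trans trunc; rewrite ler_piMr ?exprn_ge0 ?subr_ge0 ?(ltW k1)//.
    by apply: lazy_iter_le1 => z; rewrite lern1 leq_b1.
  have : (1 - k) * lazy_step f y <= f y.
    have -> : lazy_step f y = lazy_step S y + k.
      rewrite /lazy_step (negbTE nD) /f walk_meanD walk_mean_cst; ring.
    rewrite /f; move: Sy; nra.
  rewrite /lazy_step (negbTE nD); have /andP[wy0 wy1] := w01 y.
  have m0 : 0 <= walk_mean f y by exact: walk_mean_ge0.
  move: (walk_mean f y) m0 (f0 y) => m m0 fy0 h.
  (* If the mean m exceeds [f y], the inequality for the lazy chain gives w y (m - f y) <= k m,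
     hence m - f y <= (k / w0) m: killing of the lazy chain at rate k is killing of the walk at rate
     at most k / w0. *)
  have [mf|fm] := leP m (f y).
    apply: le_trans mf; rewrite ler_piMl//.
    by rewrite gerBl divr_ge0// ltW.
  have wy : 0 < w y := lt_le_trans w00 (w0w y).
  have kw : k * m <= (k / w0) * m * w y.
    rewrite -!mulrA ler_wpM2l ?(ltW k0)// mulrCA ler_peMr// mulrC.
    by rewrite ler_pdivlMr// mul1r.
  have mf0 : 0 <= (m - f y) * (k * (1 - w y)).
    by rewrite mulr_ge0 ?subr_ge0 ?(ltW fm)// mulr_ge0 ?subr_ge0// ltW.
  rewrite -(ler_pM2r wy); move: h kw; lra.
rewrite -ler_pdivrMl//; apply: le_trans main.
by rewrite ler_wpM2r// hit_prob_ge0.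
Qed.

End lazy_chain.

(** * Laplacian and spectral gap *)

Section laplacian.
Variables (R : realType) (G : fcgraph).
Implicit Types (f h : G -> R) (g : G).

Local Notation lambda := (spectral_gap G R).
Local Notation d := ((max_deg G)%:R : R).

Lemma fc_degE g : lf_deg (g : fin_graph G) = #|fc_adj g|.
Proof. by rewrite /lf_deg /= cardE. Qed.

Lemma fc_deg_le g : (#|fc_adj g| <= max_deg G)%N.
Proof. by rewrite -fc_degE; apply: (@leq_bigmax G (fun g => lf_deg (g : fin_graph G))). Qed.

Lemma fc_deg_gt0 g : (0 < #|fc_adj g|)%N.
Proof. by rewrite -fc_degE /lf_deg; exact: fc_nbrs_gt0. Qed.

Lemma max_deg_gt0 : (0 < max_deg G)%N.
Proof. exact: leq_trans (fc_deg_gt0 (fc_origin G)) (fc_deg_le _). Qed.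

Lemma sum_fc_nbrs f g : \sum_(g' <- fc_nbrs g) f g' = \sum_(g' | fc_adj g g') f g'.
Proof. by rewrite /fc_nbrs big_enum. Qed.

Lemma sum_fc_cst (c : R) g : \sum_(g' | fc_adj g g') c = #|fc_adj g|%:R * c.
Proof. by rewrite sumr_const mulr_natl. Qed.

Lemma sum_adj_sym (F : G -> G -> R) :
  \sum_g \sum_(g' | fc_adj g g') F g g' = \sum_g \sum_(g' | fc_adj g g') F g' g.
Proof.
rewrite [LHS](exchange_big_dep predT)//=; apply: eq_bigr => g _.
by apply: eq_bigl => g'; rewrite fc_adj_sym.
Qed.

Definition lap f g : R := \sum_(g' | fc_adj g g') (f g' - f g).

Definition energy f : R := 2^-1 * \sum_g \sum_(g' | fc_adj g g') (f g' - f g) ^+ 2.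

Definition sqnorm f : R := \sum_g f g ^+ 2.

Lemma lapE f g : lap f g = \sum_(g' | fc_adj g g') f g' - #|fc_adj g|%:R * f g.
Proof. by rewrite /lap sumrB sum_fc_cst. Qed.

Lemma sum_lap f : \sum_g lap f g = 0.
Proof.
rewrite /lap; apply/eqP; rewrite -[_ == 0](mulrn_eq0 _ 2) mulr2n.
rewrite {1}sum_adj_sym -big_split big1//= => g _.
by rewrite -big_split big1// => g' _ /=; rewrite addrC subrKA subrr.
Qed.

Lemma sum_mul_lap f h : \sum_g f g * lap h g =
  - (2^-1 * \sum_g \sum_(g' | fc_adj g g') (f g' - f g) * (h g' - h g)).
Proof.
have e : \sum_g f g * lap h g = \sum_g \sum_(g' | fc_adj g g') f g * (h g' - h g).
  by apply: eq_bigr => g _; rewrite mulr_sumr.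
have e2 : \sum_g f g * lap h g = \sum_g \sum_(g' | fc_adj g g') f g' * (h g - h g').
  by rewrite e sum_adj_sym.
have : (\sum_g f g * lap h g) *+ 2 =
    - \sum_g \sum_(g' | fc_adj g g') (f g' - f g) * (h g' - h g).
  rewrite mulr2n {1}e e2 -big_split -sumrN; apply: eq_bigr => g _ /=.
  by rewrite -big_split -sumrN; apply: eq_bigr => g' _ /=; ring.
lra.
Qed.

Lemma sum_mul_lapC f h : \sum_g f g * lap h g = \sum_g h g * lap f g.
Proof.
rewrite !sum_mul_lap; congr (- (_ * _)); apply: eq_bigr => g _.
by apply: eq_bigr => g' _; rewrite mulrC.
Qed.

Lemma sum_lap_energy f : \sum_g f g * lap f g = - energy f.
Proof. by rewrite sum_mul_lap. Qed.

Lemma energy_ge0 f : 0 <= energy f.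
Proof. by rewrite mulr_ge0// sumr_ge0// => g _; rewrite sumr_ge0// => g' _; exact: sqr_ge0. Qed.

Lemma sqnorm_ge0 f : 0 <= sqnorm f.
Proof. by apply: sumr_ge0 => g _; exact: sqr_ge0. Qed.

Lemma sqnorm_gt0 f g : f g != 0 -> 0 < sqnorm f.
Proof.
move=> fg; rewrite /sqnorm (bigD1 g)//= ltr_pwDl//.
  by rewrite lt_neqAle sqr_ge0 andbT eq_sym sqrf_eq0.
by apply: sumr_ge0 => *; exact: sqr_ge0.
Qed.

Lemma energy_le f : energy f <= 2 * d * sqnorm f.
Proof.
apply: (@le_trans _ _ (2^-1 * \sum_g \sum_(g' | fc_adj g g') (2 * f g ^+ 2 + 2 * f g' ^+ 2))).
  rewrite ler_wpM2l//; apply: ler_sum => g _; apply: ler_sum => g' _.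
  have := sqr_ge0 (f g' + f g); nra.
under eq_bigr do rewrite big_split.
rewrite big_split /= [X in _ + X](sum_adj_sym (fun _ g' => 2 * f g' ^+ 2)).
have -> : \sum_g \sum_(g' | fc_adj g g') 2 * f g ^+ 2 =
    2 * \sum_g #|fc_adj g|%:R * f g ^+ 2.
  by rewrite mulr_sumr; apply: eq_bigr => g _; rewrite sum_fc_cst; ring.
have : \sum_g #|fc_adj g|%:R * f g ^+ 2 <= d * sqnorm f.
  rewrite mulr_sumr; apply: ler_sum => g _; rewrite ler_wpM2r ?sqr_ge0//.
  by rewrite ler_nat fc_deg_le.
nra.
Qed.

Lemma sqr_sum_le (I : finType) (P : pred I) (a : I -> R) :
  (\sum_(i | P i) a i) ^+ 2 <= #|P|%:R * \sum_(i | P i) a i ^+ 2.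
Proof.
have [P0|P0] := posnP #|P|.
  by rewrite !big_pred0 ?expr0n ?mulr0// => i; exact: card0_eq P0 i.
set s := \sum_(i | P i) a i; have n0 : 0 < #|P|%:R :> R by rewrite ltr0n.
have : 0 <= \sum_(i | P i) (a i - s / #|P|%:R) ^+ 2 by apply: sumr_ge0 => *; exact: sqr_ge0.
under eq_bigr do rewrite sqrrB.
rewrite big_split sumrB /= sumrMnl -mulr_suml -/s sumr_const.
rewrite -[X in _ + X]mulr_natl -(pmulr_rge0 _ n0).
have e : #|P|%:R * (s / #|P|%:R) = s by rewrite mulrC divfK// gt_eqF.
move: (s / _) e => m e; move: (\sum_(i | P i) _) => q; rewrite -e; lra.
Qed.

Lemma sqnorm_lap_le f : sqnorm (lap f) <= 2 * d * energy f.
Proof.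
rewrite /energy mulrACA mulfV// mul1r mulr_sumr; apply: ler_sum => g _.
apply: le_trans (sqr_sum_le _ _) _; apply: ler_wpM2r; last by rewrite ler_nat fc_deg_le.
by apply: sumr_ge0 => *; exact: sqr_ge0.
Qed.

Lemma card_fc_gt0 : 0 < #|G|%:R :> R.
Proof. by rewrite ltr0n ltnW// fc_card_gt1. Qed.

Lemma dirichletE f : dirichlet f = energy f / #|G|%:R.
Proof. by rewrite /dirichlet /energy invfM; ring. Qed.

Lemma unif_varE f : unif_var f = sqnorm (fun g => f g - unif_mean f) / #|G|%:R.
Proof. by rewrite /unif_var /unif_mean mulrC. Qed.

Lemma energy_shift f c : energy (fun g => f g - c) = energy f.
Proof.
congr (_ * _); apply: eq_bigr => g _; apply: eq_bigr => g' _.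
by congr (_ ^+ 2); ring.
Qed.

Lemma sum_center f : \sum_g (f g - unif_mean f) = 0.
Proof.
rewrite sumrB sumr_const /unif_mean -[_ *+ _]mulr_natl mulrA mulfV ?mul1r ?subrr//.
by rewrite gt_eqF// card_fc_gt0.
Qed.

Lemma rayleighE f : dirichlet f / unif_var f =
  energy f / sqnorm (fun g => f g - unif_mean f).
Proof.
rewrite dirichletE unif_varE invfM invrK mulrACA.
by rewrite mulVf ?mulr1 // gt_eqF// card_fc_gt0.
Qed.

Let quotients :=
  [set dirichlet f / unif_var f | f in [set f : G -> R | exists g g', f g != f g']].

Let quotients_lb : lbound quotients 0.
Proof.
by move=> _ [f _ <-]; rewrite rayleighE divr_ge0 ?energy_ge0 ?sqnorm_ge0.
Qed.

Lemma exists_adj : exists g g' : G, g != g'.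
Proof. by have /card_gt1P[g [g' [_ _ h]]] := fc_card_gt1 G; exists g, g'. Qed.

Let quotients_neq0 : quotients !=set0.
Proof.
have [g [g' gg']] := exists_adj; pose f z : R := (z == g)%:R.
exists (dirichlet f / unif_var f), f => //; exists g, g'.
by rewrite /f eqxx [g' == g]eq_sym (negbTE gg') oner_eq0.
Qed.

Lemma spectral_gap_ge0 : 0 <= lambda.
Proof. exact: lb_le_inf quotients_neq0 quotients_lb. Qed.

Lemma spectral_gap_le f : \sum_g f g = 0 -> lambda * sqnorm f <= energy f.
Proof.
move=> f0; have [/existsP[g fg]|] := boolP [exists g, f g != 0]; last first.
  rewrite negb_exists => /forallP fz; rewrite [sqnorm f]big1 ?mulr0 ?energy_ge0// => g _.
  by have := fz g; rewrite negbK => /eqP ->; rewrite expr0n.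
rewrite -ler_pdivlMr ?(sqnorm_gt0 fg)//.
have m0 : unif_mean f = 0 by rewrite /unif_mean f0 mulr0.
have -> : sqnorm f = sqnorm (fun z => f z - unif_mean f).
  by rewrite m0; apply: eq_bigr => z _; rewrite subr0.
rewrite -rayleighE; apply: ge_inf; first by exists 0.
exists f => //; have [/existsP[g' gg']|] := boolP [exists g', f g != f g'].
  by exists g, g'.
rewrite negb_exists => /forallP fz; exfalso; move: f0.
rewrite (eq_bigr (fun=> f g)); last by move=> z _; have := fz z; rewrite negbK => /eqP.
rewrite sumr_const => /eqP; rewrite mulrn_eq0 (negbTE fg) orbF.
by rewrite -(@eqr_nat R) gt_eqF// card_fc_gt0.
Qed.

Lemma spectral_gap_ub : lambda <= 2 * d.
Proof.
have [g [g' gg']] := exists_adj; pose f0 z : R := (z == g)%:R.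
pose f z := f0 z - unif_mean f0; have fz : \sum_z f z = 0 := sum_center f0.
have : f g != f g' \/ f g == f g' by case: eqP; [right|left].
case=> [h|]; last first.
  by rewrite /f (inj_eq (addIr _)) /f0 eqxx [g' == g]eq_sym (negbTE gg') oner_eq0.
have n0 : 0 < sqnorm f.
  have [fg|fg] := eqVneq (f g) 0; last exact: sqnorm_gt0 fg.
  by apply: (@sqnorm_gt0 _ g'); rewrite eq_sym -fg.
by rewrite -(ler_pM2r n0) (le_trans (spectral_gap_le fz))// energy_le.
Qed.

(* Approximate minimizers of the Rayleigh quotient suffice: the form
   [energy f - lambda * sqnorm f] is nonnegative on centered functions, so by
   Cauchy-Schwarz the residual [lap f + lambda f] is controlled by the form. *)
Lemma approx_eigenfunction (e : R) : 0 < e -> exists f gM gm,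
  [/\ f gm < f gM, f gm <= 0 <= f gM, forall g, f gm <= f g <= f gM &
      forall g, `|lap f g + lambda * f g| <= e * (f gM - f gm)].
Proof.
(* The residual at a vertex is bounded by its l^2 norm, and [sqnorm f] by |G| times the squared
   oscillation; this [eps] makes the product equal to the square of [e] times the oscillation. *)
move=> e0; pose eps := e ^+ 2 / (2 * d * #|G|%:R).
have d0 : 0 < d by rewrite ltr0n max_deg_gt0.
have d20 : 0 < 2 * d by rewrite mulr_gt0.
have N0 := card_fc_gt0; have C0 : 0 < 2 * d * #|G|%:R by rewrite !mulr_gt0.
have eps0 : 0 < eps by rewrite divr_gt0// exprn_gt0.
have [|_ [f1 [a [b ab]] <-] flt] := @inf_adherent R quotients eps eps0.
  by split; [exact: quotients_neq0 | exists 0; exact: quotients_lb].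
pose f z := f1 z - unif_mean f1; have f0 : \sum_z f z = 0 := sum_center f1.
have fab : f a != f b by rewrite (inj_eq (addIr _)).
have n0 : 0 < sqnorm f.
  have [fg|fg] := eqVneq (f a) 0; last exact: sqnorm_gt0 fg.
  by apply: (@sqnorm_gt0 _ b); rewrite eq_sym -fg.
move: flt; rewrite rayleighE -(energy_shift f1 (unif_mean f1)) -/f ltr_pdivrMr// => flt.
have {flt} Qf : energy f - lambda * sqnorm f <= eps * sqnorm f.
  by move: flt; rewrite mulrDl -[inf _]/lambda; lra.
pose r z := lap f z + lambda * f z.
have r0 : \sum_z r z = 0 by rewrite big_split /= sum_lap add0r -mulr_sumr f0 mulr0.
have rn : sqnorm r <= 2 * d * (eps * sqnorm f).
  (* The form at f + t r has cross term -2 t [sqnorm r], and for this t its quadratic term is at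
     most t [sqnorm r]. Nonnegativity then gives t [sqnorm r] <= [energy f - lambda * sqnorm f]. *)
  pose t := (2 * d)^-1; pose h z := f z + t * r z.
  have h0 : \sum_z h z = 0 by rewrite big_split /= -mulr_sumr r0 f0 mulr0 addr0.
  have := spectral_gap_le h0.
  have -> : sqnorm h = sqnorm f + 2 * t * (\sum_z f z * r z) + t ^+ 2 * sqnorm r.
    rewrite /sqnorm !mulr_sumr -!big_split; apply: eq_bigr => z _ /=; rewrite /h; ring.
  have lapD z : lap h z = lap f z + t * lap r z.
    by rewrite /lap mulr_sumr -big_split; apply: eq_bigr => z' _ /=; rewrite /h; ring.
  have -> : energy h = energy f - 2 * t * (\sum_z r z * lap f z) + t ^+ 2 * energy r.
    have enE u : energy u = - \sum_z u z * lap u z by rewrite sum_lap_energy opprK.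
    have -> : energy h = - (\sum_z f z * lap f z + t * (\sum_z r z * lap f z) +
        t * (\sum_z f z * lap r z) + t ^+ 2 * \sum_z r z * lap r z).
      rewrite enE !mulr_sumr -!big_split; congr (- _); apply: eq_bigr => z _ /=.
      by rewrite lapD /h; ring.
    by rewrite (sum_mul_lapC f r) !enE; ring.
  have rr : sqnorm r = \sum_z r z * lap f z + lambda * \sum_z f z * r z.
    rewrite mulr_sumr -big_split; apply: eq_bigr => z _ /=.
    by rewrite /r; ring.
  have er := energy_le r.
  have lr : 0 <= lambda * sqnorm r by rewrite mulr_ge0 ?spectral_gap_ge0 ?sqnorm_ge0.
  have t0 : 0 < t by rewrite invr_gt0 mulr_gt0.
  have td : t * (2 * d) = 1 by rewrite mulVf// gt_eqF// mulr_gt0.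
  have ter : t ^+ 2 * energy r <= t * sqnorm r.
    rewrite expr2 -mulrA ler_pM2l//; apply: le_trans (ler_wpM2l (ltW t0) er) _.
    by rewrite mulrA td mul1r.
  have tlr : 0 <= t ^+ 2 * (lambda * sqnorm r) by rewrite mulr_ge0// sqr_ge0.
  move=> H; have key : t * sqnorm r <= energy f - lambda * sqnorm f.
    have e3 : 2 * t * sqnorm r = 2 * t * (\sum_z r z * lap f z) +
        lambda * (2 * t * \sum_z f z * r z) by rewrite rr; ring.
    lra.
  have := le_trans key Qf; rewrite -(ler_pM2l d20).
by rewrite [X in X <= _](_ : _ = sqnorm r)// mulrCA mulrA td mul1r.

have [gM _ hM] := @arg_maxP _ R G a predT f isT.
have [gm _ hm] := @arg_minP _ R G a predT f isT.
have fM z : f z <= f gM := hM z isT.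
have fm z : f gm <= f z := hm z isT.
have M0 : 0 <= f gM.
  rewrite -(pmulr_rge0 _ N0) -f0 mulr_natl -sumr_const.
  by apply: ler_sum => z _; exact: fM.
have m0 : f gm <= 0.
  rewrite -(pmulr_rle0 _ N0) -f0 mulr_natl -sumr_const.
  by apply: ler_sum => z _; exact: fm.
have lt : f gm < f gM.
  rewrite lt_neqAle (fm gM) andbT; apply: contra fab => /eqP e1; apply/eqP.
  have cst z : f z = f gM by apply/le_anti; rewrite fM -e1 fm.
  by rewrite !cst.
exists f, gM, gm; split => //; first by rewrite m0 M0.
  by move=> g; rewrite fm fM.
move=> g; rewrite -/(r g).
have K0 : 0 <= f gM - f gm by rewrite subr_ge0 ltW.
rewrite -(@ler_pXn2r _ 2)// ?nnegrE ?mulr_ge0 ?(ltW e0)//.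
rewrite real_normK ?num_real//.
have rg : r g ^+ 2 <= sqnorm r.
  by rewrite /sqnorm (bigD1 g)//= lerDl sumr_ge0// => *; exact: sqr_ge0.
apply: le_trans rg (le_trans rn _).
have nf : sqnorm f <= #|G|%:R * (f gM - f gm) ^+ 2.
  rewrite mulr_natl -sumr_const; apply: ler_sum => z _.
  have := fM z; have := fm z; nra.
have -> : (e * (f gM - f gm)) ^+ 2 = 2 * d * (eps * (#|G|%:R * (f gM - f gm) ^+ 2)).
  rewrite /eps exprMn; field; rewrite !gt_eqF//.
by rewrite !ler_pM2l// mulr_gt0.
Qed.

End laplacian.

(** * Translations of the cylinder and its fibres *)

Section automorphism.
Variables (R : realType) (L : lfgraph) (phi : L -> L).
Hypothesis phi_mean : forall (F : L -> R) x, walk_mean (F \o phi) x = walk_mean F (phi x).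

Lemma hit_prob_comp n (C D : pred L) x :
  hit_prob R n (fun y => C (phi y)) (fun y => D (phi y)) x = hit_prob R n C D (phi x).
Proof.
elim: n x => [//|n IH] x /=; do 2 case: ifP => // _.
by rewrite -phi_mean; apply: eq_walk_mean.
Qed.

End automorphism.

Section cylinder_walk.
Variables (R : realType) (G : fcgraph).
Implicit Types (F : cylinder G -> R) (f : G -> R) (g : G) (z u : int).

Lemma cyl_meanE F g z : walk_mean F ((g, z) : cylinder G) =
  (#|fc_adj g|%:R + 2)^-1 *
  (F (g, z + 1) + F (g, z - 1) + \sum_(g' | fc_adj g g') F (g', z)).
Proof.
rewrite /walk_mean /lf_deg /= size_map /fc_nbrs -cardE -addn2 natrD.
by rewrite /cyl_nbrs 2!big_cons big_map /= sum_fc_nbrs (addrA (F _)).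
Qed.

Lemma cyl_mean_shift u F (x : cylinder G) :
  walk_mean (fun y : cylinder G => F (y.1, y.2 + u)) x = walk_mean F (x.1, x.2 + u).
Proof. by case: x => g z; rewrite !cyl_meanE /= (addrAC z 1) (addrAC z (- 1)). Qed.

Lemma cyl_mean_fst f g z :
  walk_mean (fun y : cylinder G => f y.1) (g, z) =
  f g + (#|fc_adj g|%:R + 2)^-1 * lap f g.
Proof.
have d0 : #|fc_adj g|%:R + 2 != 0 :> R by rewrite gt_eqF// ltr_wpDl.
by apply: (mulfI d0); rewrite cyl_meanE /= lapE; field.
Qed.

Definition fibre g : pred (cylinder G) := fun y => y.1 == g.

(** As [lap f] is nearly [- l * f], one step lowers the mean of [f] by at most [l * f gM + e]. So
    [f gM - f], increased by this drift for each remaining step, is a supersolution, and on the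
    fibre over [gm] it is at least the oscillation. *)
Lemma hit_fibre_le f (l e : R) gM gm n (x : cylinder G) : 0 <= l -> 0 <= e ->
  0 <= f gM -> (forall g, f gm <= f g <= f gM) ->
  (forall g, `|lap f g + l * f g| <= e) ->
  (f gM - f gm) * hit_prob R n (fibre gm) pred0 x <=
  f gM - f x.1 + n%:R * (l * f gM + e).
Proof.
move=> l0 e0 M0 fMm res; have c0 : 0 <= l * f gM + e by rewrite addr_ge0 ?mulr_ge0.
elim: n x => [|n IH] [g z]; rewrite /= /fibre /=.
  case: eqP => [->|_]; first by rewrite mulr1 mul0r addr0.
  by rewrite mulr0 mul0r addr0 subr_ge0; case/andP: (fMm g).
case: eqP => [->|_]; first by rewrite mulr1 lerDl mulr_ge0.
rewrite -walk_meanZ; apply: le_trans (walk_mean_le (fun y _ => IH y)) _.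
rewrite walk_meanD walk_mean_cst.
have -> : walk_mean (fun y : cylinder G => f gM - f y.1) (g, z) =
    f gM - walk_mean (fun y : cylinder G => f y.1) (g, z).
  rewrite -mulN1r -walk_meanZ -[f gM in RHS](walk_mean_cst _ ((g, z) : cylinder G)) -walk_meanD.
  by apply: eq_walk_mean => y _; rewrite mulN1r.
rewrite cyl_mean_fst -natr1.
have d1 : 1 <= #|fc_adj g|%:R + 2 :> R by rewrite ler_wpDl ?ler1n.
have lapb : - lap f g <= l * f gM + e.
  have := res g; rewrite ler_norml => /andP[h _]; case/andP: (fMm g) => _ fM.
  have := ler_wpM2l l0 fM; lra.
have : - ((#|fc_adj g|%:R + 2)^-1 * lap f g) <= l * f gM + e.
  rewrite -mulrN ler_pdivrMl ?(lt_le_trans ltr01)//.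
  by apply: le_trans lapb _; rewrite ler_peMl.
lra.
Qed.

(** The drift bound is applied to [f] and to [- f]. As [f gm <= 0 <= f gM], both [f gM] and [- f gm]
    are at most the oscillation, which therefore cancels. *)
Lemma cover_two_fibres (e : R) : 0 < e -> exists g g' : G, forall n x,
  walk_prob R n (fun s => has (fibre g) s && has (fibre g') s) x <=
  2 * (n%:R * (spectral_gap G R + e)).
Proof.
move=> e0; have [f [gM [gm [lt /andP[m0 M0] fMm res]]]] := approx_eigenfunction G e0.
exists gM, gm => n x; set l := spectral_gap G R in res *.
have l0 : 0 <= l := spectral_gap_ge0 R G.
have K0 : 0 < f gM - f gm by rewrite subr_gt0.
have c0 : 0 <= n%:R * (l + e) by rewrite mulr_ge0 ?addr_ge0// ltW.
have bnd a b : 0 <= a -> 0 <= b -> a + b = f gM - f gm ->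
    n%:R * (l * a + e * (f gM - f gm)) <= n%:R * (l + e) * (f gM - f gm).
  move=> a0 b0 ab; rewrite -mulrA ler_wpM2l// mulrDl lerD2r ler_wpM2l// -ab lerDl//.
rewrite mulrDl !mul1r; apply: walk_prob_has2 => // y /eqP yg.
  have := @hit_fibre_le f l _ gM gm n y l0 (mulr_ge0 (ltW e0) (ltW K0)) M0 fMm res.
  rewrite yg subrr add0r mulrC => h; rewrite -(ler_pM2r K0); apply: le_trans h _.
  by apply: (bnd _ (- f gm)); rewrite ?oppr_ge0.
have fMm' g : - f gM <= - f g <= - f gm by rewrite !lerN2 andbC.
have res' g : `|lap (fun a : G => - f a) g + l * - f g| <= e * (f gM - f gm).
  rewrite /lap (eq_bigr (fun g' => - (f g' - f g))); last by move=> *; ring.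
  rewrite sumrN mulrN -opprD normrN; exact: res.
have m0' : 0 <= - f gm by rewrite oppr_ge0.
have := @hit_fibre_le (fun g => - f g) l _ gm gM n y l0
  (mulr_ge0 (ltW e0) (ltW K0)) m0' fMm' res'.
rewrite yg subrr add0r opprK [- f gm + _]addrC mulrC => h.
rewrite -(ler_pM2r K0); apply: le_trans h _.
by apply: (bnd _ (f gM)); rewrite // addrC.
Qed.

End cylinder_walk.

(** * Disconnection of the cylinder *)

Section disconnection.
Variable G : fcgraph.
Implicit Types (S : set (cylinder G)) (g : G) (z u : int) (V : {set G}).

Lemma cyl_adj_sym (x y : cylinder G) : cyl_adj x y = cyl_adj y x.
Proof.
rewrite /cyl_adj [y.1 == _]eq_sym [y.2 == _]eq_sym -normrN opprB.
by rewrite [fc_adj _ _]fc_adj_sym.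
Qed.

Lemma joined_in_trans (U : set (cylinder G)) x y t :
  joined_in U x y -> joined_in U y t -> joined_in U x t.
Proof.
move=> [p [pth <-] pU] [q [qth <-] qU]; exists (p ++ q).
  by rewrite cat_path pth qth last_cat.
move=> a; rewrite -cat_cons mem_cat => /orP[/pU//|aq]; apply: qU.
by rewrite inE aq orbT.
Qed.

Lemma joined_in_adj (U : set (cylinder G)) x y :
  U x -> U y -> lf_adj x y -> joined_in U x y.
Proof.
move=> Ux Uy xy; exists [:: y]; first by split=> //=; rewrite andbT.
by move=> a; rewrite !inE => /orP[/eqP ->|/eqP ->].
Qed.

Lemma joined_in_mem (U : set (cylinder G)) x y : joined_in U x y -> U x /\ U y.
Proof.
move=> [p [_ <-] pU]; split; first by apply: pU; rewrite inE eqxx.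
by apply: pU; rewrite mem_last.
Qed.

Lemma joined_in_sym (U : set (cylinder G)) x y : joined_in U x y -> joined_in U y x.
Proof.
move=> [p [pth <-] pU]; elim: p x pth pU => [|a p IH] x /=.
  by move=> _ pU; exists [::].
move=> /andP[xa pth] pU.
have Ua : U a by apply: pU; rewrite !inE eqxx orbT.
have Ux : U x by apply: pU; rewrite !inE eqxx.
apply: (@joined_in_trans _ _ a); last first.
  by apply: joined_in_adj => //=; rewrite cyl_adj_sym.
by apply: IH => // b bp; apply: pU; rewrite inE bp orbT.
Qed.

Lemma disconnects_top S : disconnects S -> exists (top : pred (cylinder G)) (M : int),
  [/\ forall x, M <= x.2 -> top x, forall x, x.2 <= - M -> ~~ top x &
      forall x y, lf_adj x y -> top x -> ~~ top y -> S y].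
Proof.
move=> [M /(_ M (lexx _)) [C [C' [[x0 Ux0 ->] [x1 Ux1 ->] CC' up dn]]]].
exists (fun x => `[< joined_in (~` S) x0 x >]), M; split.
- by move=> x Mx; apply/asboolP; exact: up.
- move=> x xM; apply/asboolP => jx; apply: CC'; have jx' := dn _ xM.
  have j01 := joined_in_trans jx (joined_in_sym jx').
  apply/seteqP; split => y /=; first exact: joined_in_trans (joined_in_sym j01).
  exact: joined_in_trans j01.
move=> x y xy /asboolP jx /asboolP njy; apply: contrapT => nS; apply: njy.
apply: joined_in_trans (jx) _; apply: joined_in_adj => //.
by have [] := joined_in_mem jx.
Qed.

End disconnection.

Lemma sumn_shift (b : int -> nat) n (u : int) :
  (\sum_(i < n.+1) b (u + 1 + i%:Z)%R <=
   \sum_(i < n.+1) b (u + i%:Z)%R + b (u + 1 + n%:Z)%R)%N.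
Proof.
rewrite big_ord_recr /= [X in (_ <= X + _)%N]big_ord_recl leq_add2r.
apply: leq_trans (leq_addl _ _); apply: leq_sum => i _ /=.
by rewrite -addrA -PoszD.
Qed.

Lemma int_crossing (P : pred int) (a b : int) : ~~ P a -> P b -> a <= b ->
  exists u : int, [/\ a <= u, u < b, ~~ P u & P (u + 1)].
Proof.
move=> Pa Pb ab; have [k bk] : exists k : nat, b = a + k%:Z.
  by exists `|b - a|%N; lia.
rewrite {ab}bk in Pb *; elim: k Pb => [|k IH]; first by rewrite addr0 (negbTE Pa).
case: (boolP (P (a + k%:Z))) => [/IH[u [au uk nPu Pu]] _|nP Pk].
  by exists u; split => //; lia.
exists (a + k%:Z); split => //; try lia.
by rewrite -addrA -PoszD addn1.
Qed.

Section cut.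
Variable G : fcgraph.
Implicit Types (S : set (cylinder G)) (g : G) (z u : int) (V : {set G}).

Lemma disconnects_fibre S g : disconnects S -> exists z, S (g, z).
Proof.
move=> /disconnects_top[top [M [up dn cut]]].
have [|||u [_ _ nt tu]] := @int_crossing (fun u => top (g, u)) (- `|M|) `|M|.
- by apply: dn; rewrite /= lerN2 ler_norm.
- by apply: up; rewrite /= ler_norm.
- by rewrite -subr_ge0 opprK addr_ge0.
exists u; apply: cut tu nt.
by rewrite /= /cyl_adj /= eqxx addrC addKr normr1 eqxx.
Qed.

Lemma connect_boundary V (P : pred G) g g' : Defs.connected_subset V ->
  g \in V -> g' \in V -> P g -> ~~ P g' ->
  exists a b, [/\ a \in V, b \in V, fc_adj a b, P a & ~~ P b].
Proof.
move=> cV gV g'V Pg Pg'; have /connectP[p pth e] := cV _ _ gV g'V.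
elim: p g gV Pg pth e => [|a p IH] g gV Pg /=.
  by move=> _ e; rewrite e Pg in Pg'.
move=> /andP[/and3P[ga _ aV] pth] e; have [Pa|nPa] := boolP (P a).
  exact: IH Pa pth e.
by exists g, a.
Qed.

(** Grow the subset from one vertex, adding each time a vertex of [V] adjacent to it. *)
Lemma connected_subset_sub V m : Defs.connected_subset V -> (0 < m <= #|V|)%N ->
  exists V', [/\ V' \subset V, Defs.connected_subset V' & #|V'| = m].
Proof.
move=> cV /andP[]; elim: m => // m IH _ mV.
have [m0|m0] := posnP m.
  have /card_gt0P[g gV] : (0 < #|V|)%N by apply: leq_ltn_trans mV.
  exists [set g]%SET; rewrite m0 cards1 finset.sub1set gV; split => // a b.
  by rewrite !inE => /eqP -> /eqP ->; exact: connect0.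
have [V' [V'V cV' cardV']] := IH m0 (ltnW mV).
have /card_gt0P[g gV'] : (0 < #|V'|)%N by rewrite cardV'.
have [g' g'V g'V'] : exists2 g', g' \in V & g' \notin V'.
  apply/subsetPn; apply: contraTN mV => VV'; rewrite -leqNgt -cardV'.
  exact: subset_leq_card.
have [a [b [aV bV ab aV' bV']]] :=
  @connect_boundary V (fun x => x \in V') g g' cV (fintype.subsetP V'V _ gV') g'V gV' g'V'.
exists (b |: V')%SET; split.
- by rewrite finset.subUset finset.sub1set bV.
- have sub c e : c \in V' -> e \in V' -> connect [rel z z' | [&& fc_adj z z',
      z \in (b |: V')%SET & z' \in (b |: V')%SET]] c e.
    move=> cin ein; apply: connect_sub (cV' c e cin ein) => x y /and3P[xy xV yV].
    by apply: connect1; rewrite /= xy !inE xV yV !orbT.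
  have ba : connect [rel z z' | [&& fc_adj z z', z \in (b |: V')%SET & z' \in (b |: V')%SET]] b a.
    by apply: connect1; rewrite /= fc_adj_sym ab !inE eqxx aV' orbT.
  have ab' : connect [rel z z' | [&& fc_adj z z', z \in (b |: V')%SET & z' \in (b |: V')%SET]] a b.
    by apply: connect1; rewrite /= ab !inE eqxx aV' orbT.
  move=> c e; rewrite !inE => /predU1P[->|cV''] /predU1P[->|eV''].
  + exact: connect0.
  + exact: connect_trans ba (sub _ _ aV' eV'').
  + exact: connect_trans (sub _ _ cV'' aV') ab'.
  + exact: sub.
- by rewrite cardsU1 bV' cardV'.
Qed.

Definition window V (m : nat) u : pred (cylinder G) :=
  fun x => (x.1 \in V) && (u - m%:Z <= x.2 <= u + m%:Z).

(* If [S] separates the two ends, choose a window half of whose vertices lie in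
   the top component. Either many vertical fibres of the window are mixed, and
   each contains a point of [S], or one fibre is entirely top and another is
   disjoint from it, and then each horizontal slice meets [S]. *)
Lemma disconnects_window S V m : disconnects S -> Defs.connected_subset V -> #|V| = m ->
  (0 < m)%N -> exists u, exists T : {set G * 'I_(m.*2.+1)},
    (m <= 4 * #|T|)%N /\
    forall x, x \in T -> x.1 \in V /\ S (x.1, u - m%:Z + (x.2 : nat)%:Z).
Proof.
move=> dS cV cardV m0; have [top [M [up dn cut]]] := disconnects_top dS.
pose n := m.*2.
pose b u g := (\sum_(i < n.+1) (top (g, (u + (i : nat)%:Z)%R) : nat))%N.
pose a u := (\sum_(g in V) b u g)%N.
(* The number [a u] of top points in the window that starts at height u is 0 far below and m (n + 1)
   far above. At its crossing of one half, u has less than half and u + 1 at least half, with a gain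
   of at most m. *)
have [|||u [_ _ au1 au]] := @int_crossing (fun u => (m * n.+1 <= 2 * a u)%N)
  (- `|M| - n%:Z - 1) `|M|.
  - rewrite -ltnNge /a big1 ?muln0 ?muln_gt0 ?m0// => g _; apply: big1 => i _.
    apply/eqP; rewrite eqb0; apply: dn => /=.
    have := ltn_ord i; have := ler_norm M; lia.
  - rewrite /a (eq_bigr (fun=> n.+1)) ?sum_nat_const ?cardV ?mul2n -?addnn ?leq_addr// => g _.
    rewrite /b (eq_bigr (fun=> 1%N)) ?sum1_card ?card_ord// => i _.
    by rewrite up//=; have := ler_norm M; lia.
  - lia.
set v := u + 1 in au.
have av : (a v <= a u + m)%N.
  rewrite /a -cardV -sum1_card -big_split /=; apply: leq_sum => g _.
  apply: leq_trans (sumn_shift (fun z => top (g, z)) n u) _.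
  by rewrite leq_add2l leq_b1.
have bn g : (b v g <= n.+1)%N.
  rewrite /b -[leqRHS]card_ord -sum1_card; apply: leq_sum => i _; exact: leq_b1.
pose T := [set x : G * 'I_n.+1 | (x.1 \in V) && `[< S (x.1, v + (x.2 : nat)%:Z) >]]%SET.
exists (v + m%:Z), T; split; last first.
  by move=> x; rewrite inE => /andP[xV /asboolP Sx]; rewrite addrK.
(* Mixed fibres, full fibres, and fibres without top points. *)
pose X := [set g in V | (0 < b v g < n.+1)%N]%SET.
pose Fu := [set g in V | b v g == n.+1]%SET.
pose Z := [set g in V | b v g == 0%N]%SET.
have XT : (#|X| <= #|T|)%N.
  apply: leq_trans (leq_imset_card fst (mem T)); apply: subset_leq_card.
  apply/fintype.subsetP => g; rewrite inE => /andP[gV /andP[b0 bn']].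
  have [i ti] : exists i : 'I_n.+1, top (g, v + (i : nat)%:Z).
    apply/existsP; apply: contraTT b0; rewrite negb_exists => /forallP nt.
    by rewrite -eqn0Ngt /b big1// => i _; apply/eqP; rewrite eqb0 nt.
  have [k nk] : exists k : 'I_n.+1, ~~ top (g, v + (k : nat)%:Z).
    apply/existsP; apply: contraTT bn'; rewrite negb_exists => /forallP nt.
    rewrite -leqNgt /b -[leqLHS]card_ord -sum1_card; apply: leq_sum => k _.
    by have := nt k; rewrite negbK => ->.
  suff [l Sl] : exists l : 'I_n.+1, S (g, v + (l : nat)%:Z).
    by apply/imsetP; exists (g, l) => //; rewrite inE gV; apply/asboolP.
  have vert w : (v <= w <= v + n%:Z) -> (v <= w + 1 <= v + n%:Z) ->
      top (g, w) != top (g, w + 1) -> exists l : 'I_n.+1, S (g, v + (l : nat)%:Z).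
    move=> w1 w2 tw; have adj : lf_adj ((g, w) : cylinder G) (g, w + 1).
      by rewrite /= /cyl_adj /= eqxx opprD addNKr normrN1 eqxx.
    have adj' : lf_adj ((g, w + 1) : cylinder G) (g, w).
      by rewrite /= cyl_adj_sym.
    have ordE z : v <= z <= v + n%:Z -> S (g, z) ->
        exists l : 'I_n.+1, S (g, v + (l : nat)%:Z).
      move=> vz Sz; have zn : (`|z - v| < n.+1)%N by lia.
      by exists (Ordinal zn); rewrite /= (_ : v + _ = z)//; lia.
    case t1: (top (g, w)) tw; case t2: (top (g, w + 1)) => // _.
      by apply: (ordE (w + 1)) => //; apply: cut adj _ _; rewrite ?t1 ?t2.
    by apply: (ordE w) => //; apply: cut adj' _ _; rewrite ?t1 ?t2.
  have ni := ltn_ord i; have nk' := ltn_ord k.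
  have [ik|ki] := leqP i k.
    have [|||w [w1 w2 /negPn tw nw]] := @int_crossing
      (fun w => ~~ top (g, w)) (v + (i : nat)%:Z) (v + (k : nat)%:Z) => //.
    - by rewrite ti.
    - by rewrite lerD2l lez_nat.
    by apply: (vert w); rewrite ?tw ?(negbTE nw)//; lia.
  have [|||w [w1 w2 tw nw]] := @int_crossing
    (fun w => top (g, w)) (v + (k : nat)%:Z) (v + (i : nat)%:Z) => //.
  - by rewrite lerD2l lez_nat ltnW.
  by apply: (vert w); rewrite ?nw ?(negbTE tw)//; lia.
have cFu : #|Fu| = (\sum_(g in V | b v g == n.+1) 1)%N.
  by rewrite -sum1_card; apply: eq_bigl => g; rewrite !inE.
have cX : #|X| = (\sum_(g in V | (b v g != n.+1) && (b v g != 0%N)) 1)%N.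
  rewrite -sum1_card; apply: eq_bigl => g; rewrite !inE.
  by rewrite lt0n ltn_neqAle bn andbT; congr andb; rewrite andbC.
have cZ : #|Z| = (\sum_(g in V | (b v g != n.+1) && ~~ (b v g != 0%N)) 1)%N.
  rewrite -sum1_card; apply: eq_bigl => g; rewrite !inE negbK; congr andb.
  by case: eqP => [->|]; rewrite ?andbF.
have split3 : (#|Fu| + #|X| + #|Z| = m)%N.
  rewrite -cardV -[in RHS]sum1_card [RHS](bigID (fun g => b v g == n.+1)) -cFu.
  rewrite -[LHS]addnA; congr (_ + _)%N; rewrite [RHS](bigID (fun g => b v g != 0%N)) cX cZ.
  by congr (_ + _)%N; apply: eq_bigl => g; rewrite andbA.
have avU : (a v <= (#|Fu| + #|X|) * n.+1)%N.
  rewrite mulnDl cFu cX !big_distrl /a (bigID (fun g => b v g == n.+1)) /=; apply: leq_add.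
    by apply: leq_sum => g _; rewrite mul1n.
  rewrite (bigID (fun g => b v g != 0%N)) /= addnC big1 ?add0n; last first.
    by move=> g /andP[_ /negPn/eqP].
  rewrite (eq_bigl (fun g => (g \in V) && ((b v g != n.+1) && (b v g != 0%N)))).
    by apply: leq_sum => g _; rewrite mul1n.
  by move=> g; rewrite andbA.
have avL : (#|Fu| * n.+1 <= a v)%N.
  rewrite cFu big_distrl /a [leqRHS](bigID (fun g => b v g == n.+1)) /=.
  apply: leq_trans (leq_addr _ _).
  by apply: leq_sum => g /andP[_ /eqP ->]; rewrite mul1n.
(* With fewer than m / 4 mixed fibres, a count close to one half forces both a full fibre and one
   without top points. By connectedness of [V], each of the 2 m + 1 slices then contains a point of
   [S]. *)
have [mX|Xm] := leqP m (4 * #|X|); first by apply: leq_trans mX _; rewrite leq_mul2l.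
have /card_gt0P[g1 g1F] : (0 < #|Fu|)%N.
  by rewrite lt0n; apply/eqP => F0; move: au avU; rewrite F0; nia.
have /card_gt0P[g2 g2Z] : (0 < #|Z|)%N.
  rewrite lt0n; apply/eqP => Z0; move: split3; rewrite Z0 addn0 => split2.
  move: au1 av avL; rewrite -ltnNge => au1 av avL.
  have : (2 * (#|Fu| * n.+1) <= 2 * (a u) + 2 * m)%N by rewrite -mulnDr leq_mul2l (leq_trans avL).
  move: au1 Xm split2; rewrite /n -mul2n; move: (#|Fu|) (#|X|) (a u) => f x c; nia.
move: g1F g2Z; rewrite !inE => /andP[g1V /eqP b1] /andP[g2V /eqP b2].
have t1 (i : 'I_n.+1) : top (g1, v + (i : nat)%:Z).
  apply: contraTT (leqnn n.+1) => nt; rewrite -ltnNge -{1}b1 /b (bigD1 i)//= (negbTE nt) add0n.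
  apply: leq_ltn_trans (_ : \sum_(j < n.+1 | j != i) 1 < n.+1)%N.
    by apply: leq_sum => j _; exact: leq_b1.
  by rewrite sum1_card cardC1 card_ord.
have t2 (i : 'I_n.+1) : ~~ top (g2, v + (i : nat)%:Z).
  move: b2 => /eqP; rewrite sum_nat_eq0 => /forallP/(_ i)/=.
  by rewrite eqb0.
have : (#|'I_n.+1| <= #|T|)%N.
  apply: leq_trans (leq_imset_card snd (mem T)); apply: subset_leq_card.
  apply/fintype.subsetP => i _.
  have [c [e [cV' eV ce tc te]]] := connect_boundary
    (P := fun g => top (g, v + (i : nat)%:Z)) cV g1V g2V (t1 i) (t2 i).
  apply/imsetP; exists (e, i) => //; rewrite inE eV; apply/asboolP.
  by apply: cut tc te; rewrite /= /cyl_adj /= eqxx ce orbT.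
rewrite card_ord => nT; apply: leq_trans (_ : n.+1 <= _)%N.
  by rewrite /n -addnn leqW// leq_addr.
by apply: leq_trans nT _; rewrite leq_pmull.
Qed.

End cut.

(** * Hitting slabs of the cylinder *)

Section slices.
Variables (R : realType) (G : fcgraph).
Implicit Types (g : G) (z : int) (V : {set G}).

Definition slice V : pred (cylinder G) := fun x => (x.1 \in V) && (x.2 == 0).

Definition slab V (v : nat) : pred (cylinder G) :=
  fun x => (x.1 \in V) && (- v%:Z <= x.2 <= v%:Z).

(** Union bound over the slices, each moved to height 0 by a vertical translation; the killing set
    is invariant because it depends on the base vertex only. *)
Lemma hit_slab_le n V v (D : pred G) (c : R) g z :
  (forall w : int, `|w| <= v%:Z ->
     hit_prob R n (slice V) (fun x : cylinder G => D x.1) (g, z + w) <= c) ->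
  hit_prob R n (slab V v) (fun x : cylinder G => D x.1) (g, z) <= v.*2.+1%:R * c.
Proof.
move=> H.
pose C (i : nat) : pred (cylinder G) := fun x => slice V (x.1, x.2 + (v%:Z - i%:Z)).
apply: (@le_trans _ _ (hit_prob R n (fun y => has (C^~ y) (iota 0 v.*2.+1))
    (fun x : cylinder G => D x.1) (g, z))).
  have sub (g' : G) (z' : int) : slab V v (g', z') ->
      has (C^~ (g', z')) (iota 0 v.*2.+1).
    move=> /andP[gV /andP[z1 z2]]; rewrite /= in gV z1 z2; apply/hasP.
    exists (absz (z' + v%:Z)); first by rewrite mem_iota; lia.
    by rewrite /C /slice /= gV /=; apply/eqP; lia.
  by apply: hit_prob_sub => // -[g' z']; exact: sub.
apply: le_trans (hit_prob_has R (iota 0 v.*2.+1) n C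
  (fun x : cylinder G => D x.1) (g, z)) _.
rewrite -[v.*2.+1 in leRHS](size_iota 0) -count_predT mulr_natl.
have -> : c *+ count predT (iota 0 v.*2.+1) = \sum_(i <- iota 0 v.*2.+1) c.
  by rewrite big_const_seq iter_addr addr0.
rewrite big_seq [leRHS]big_seq; apply: ler_sum => i; rewrite mem_iota => /andP[_ iv].
rewrite (hit_prob_comp (cyl_mean_shift (v%:Z - i%:Z)) n (slice V)
  (fun x : cylinder G => D x.1) (g, z)) /=.
by apply: H; lia.
Qed.

End slices.

Lemma sqr_convex3 (R : realType) (b p q s : R) : 0 <= b <= 4^-1 ->
  ((1 - 2 * b) * p + b * q + b * s) ^+ 2 <=
  (1 - 2 * b) * p ^+ 2 + b * q ^+ 2 + b * s ^+ 2.
Proof.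
move=> /andP[b0 b4]; have b2 : 0 <= 1 - 2 * b by lra.
have h1 : 0 <= (1 - 2 * b) * b * (p - q) ^+ 2 by apply: mulr_ge0; [exact: mulr_ge0 | exact: sqr_ge0].
have h2 : 0 <= (1 - 2 * b) * b * (p - s) ^+ 2 by apply: mulr_ge0; [exact: mulr_ge0 | exact: sqr_ge0].
have h3 : 0 <= b * b * (q - s) ^+ 2 by apply: mulr_ge0; [exact: mulr_ge0 | exact: sqr_ge0].
lra.
Qed.

Lemma absz_step (m : nat) : [/\ absz (Posz m.+1 + 1) = m.+2, absz (Posz m.+1 - 1) = m,
  absz (Negz m + 1) = m & absz (Negz m - 1) = m.+2].
Proof. by split; lia. Qed.

(** * Hitting from far away by means of the spectral gap *)

Section far_hitting.
Variables (R : realType) (G : fcgraph).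
Implicit Types (g : G) (z : int) (F : cylinder G -> R) (f : G -> R) (V : {set G}).

Local Notation lambda := (spectral_gap G R).
Local Notation d := ((max_deg G)%:R : R).
(** With this holding each edge is crossed at the same rate [beta], so the lazy generator is [beta]
    times the unweighted Laplacian, the one that the gap controls. *)
Let beta : R := (2 * d + 2)^-1.
Let w (x : cylinder G) : R := (#|fc_adj x.1|%:R + 2) * beta.

Let d1 : 1 <= d. Proof. by rewrite ler1n max_deg_gt0. Qed.

Let beta0 : 0 < beta. Proof. by rewrite invr_gt0; have := d1; lra. Qed.

Let beta4 : beta <= 4^-1.
Proof. by rewrite lef_pV2 ?posrE//; have := d1; lra. Qed.

Let betaE : beta * (2 * d + 2) = 1.
Proof. by rewrite mulVf// gt_eqF//; have := d1; lra. Qed.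

Let w01 x : 0 <= w x <= 1.
Proof.
have dx : #|fc_adj x.1|%:R <= d by rewrite ler_nat fc_deg_le.
rewrite /w mulr_ge0 ?addr_ge0 ?(ltW beta0)//= -[leRHS]betaE mulrC ler_pM2l//.
have := d1; lra.
Qed.

Let beta_w x : beta <= w x.
Proof. by rewrite ler_peMl ?(ltW beta0)// ler_wpDl ?ler0n// ler1n. Qed.

Let stepE F g z : lazy_step w pred0 F (g, z) =
  (1 - 2 * beta) * F (g, z) + beta * (F (g, z + 1) + F (g, z - 1)) +
  beta * lap (fun g' => F (g', z)) g.
Proof.
rewrite /lazy_step /= cyl_meanE /w /= lapE.
have d0 : #|fc_adj g|%:R + 2 != 0 :> R by rewrite gt_eqF// ltr_wpDl.
by field.
Qed.

(** An explicit supersolution for the Green function at 0 of the vertical walk killed at rate [k]: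
    decay at a rate of order sqrt k, and a prefactor fixed by the jump of the slope at 0. *)
Let geom (k : R) z : R := (beta * Num.sqrt k)^-1 * (1 - Num.sqrt k) ^+ `|z|%N.

Lemma lazy_green_line (k : R) T x : 0 < k -> k <= 4^-1 ->
  lazy_green w pred0 k T (fun y : cylinder G => (y.2 == 0)%:R) x <=
  (beta * Num.sqrt k)^-1.
Proof.
move=> k0 k4; set t := Num.sqrt k.
have t0 : 0 < t by rewrite sqrtr_gt0.
have t2 : t ^+ 2 = k by rewrite sqr_sqrtr// ltW.
have th : t <= 2^-1 by rewrite -(ler_pXn2r (ltn0Sn 1)) ?nnegrE ?(ltW t0)// t2; lra.
have B0 : 0 < (beta * t)^-1 by rewrite invr_gt0 mulr_gt0.
have Bbt : (beta * t)^-1 * (beta * t) = 1 by rewrite mulVf// gt_eqF// mulr_gt0.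
have k1 : 0 <= 1 - k by lra.
apply: (@le_trans _ _ (geom k x.2)); last first.
  by rewrite /geom -/t ler_piMr ?(ltW B0)// exprn_ile1//; lra.
elim: T x => [|T IH] [g z].
  by rewrite /lazy_green /geom -/t big_ord0 mulr_ge0 ?(ltW B0)// exprn_ge0//; lra.
rewrite lazy_greenS /=; apply: (@le_trans _ _ ((z == 0)%:R +
    (1 - k) * lazy_step w pred0 (fun y : cylinder G => geom k y.2) (g, z))).
  by rewrite lerD2l ler_wpM2l//; apply: lazy_step_le => // y; exact: IH.
rewrite stepE /= /lap big1 ?mulr0 ?addr0; last by move=> *; rewrite subrr.
rewrite /geom -/t; set B := (beta * t)^-1 in B0 Bbt *; set r := 1 - t.
have r0 : 0 <= r by rewrite /r; lra.
have pos m : 0 <= B * r ^+ m by rewrite mulr_ge0 ?(ltW B0)// exprn_ge0.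
have step m : (1 - k) * ((1 - 2 * beta) * (B * r ^+ m.+1) +
    beta * (B * r ^+ m.+2 + B * r ^+ m)) <= B * r ^+ m.+1.
  have -> : (1 - k) * ((1 - 2 * beta) * (B * r ^+ m.+1) +
      beta * (B * r ^+ m.+2 + B * r ^+ m)) = (B * r ^+ m) * ((1 - k) * (r + beta * k)).
    by rewrite -t2 /r !exprS; ring.
  rewrite [X in _ <= X](_ : _ = (B * r ^+ m) * r); last by rewrite exprSr mulrA.
  apply: ler_wpM2l => //; have : beta <= r by rewrite /r; have := beta4; lra.
  have := beta0; move: (beta) => bt b0 br; nra.
case: z => [[|m]|m].
- rewrite (_ : absz (Posz 0%N + 1) = 1%N)// (_ : absz (Posz 0%N - 1) = 1%N)//.
  rewrite (_ : (_ == 0) = true)// expr0 expr1 mulr1.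
  have : (1 - k) * ((1 - 2 * beta) * B + beta * (B * r + B * r)) =
      (1 - k) * B - 2 * (1 - k) * (B * (beta * t)) by rewrite /r; ring.
  rewrite Bbt => ->; have -> : (true : nat)%:R = 1 :> R by [].
  have : 0 <= k * B by rewrite mulr_ge0// ltW.
  lra.
- have [e1 e2 _ _] := absz_step m.
  by rewrite (_ : (_ == 0) = false)// (add0r (_ * _)) e1 e2 step.
- have [_ _ e1 e2] := absz_step m.
  by rewrite (_ : (_ == 0) = false)// (add0r (_ * _)) e1 e2 [B * r ^+ m + _]addrC step.
Qed.

(** For the coefficient e = 1 / (2 d), the second-order term e^2 [sqnorm (lap f)] takes back at most
    half of the first-order gain 2 e [energy f]. *)
Let sqnorm_step f : \sum_g f g = 0 ->
  sqnorm (fun g => f g + (2 * d)^-1 * lap f g) <= (1 - (2 * d)^-1 * lambda) * sqnorm f.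
Proof.
move=> f0; set e := (2 * d)^-1.
have e0 : 0 < e by rewrite invr_gt0; have := d1; lra.
have ed : e * (2 * d) = 1 by rewrite mulVf// gt_eqF//; have := d1; lra.
have -> : sqnorm (fun g => f g + e * lap f g) =
    sqnorm f + 2 * e * (\sum_g f g * lap f g) + e ^+ 2 * sqnorm (lap f).
  rewrite /sqnorm !mulr_sumr -!big_split; apply: eq_bigr => g _ /=; ring.
rewrite sum_lap_energy.
have h1 : e ^+ 2 * sqnorm (lap f) <= e * energy f.
  rewrite expr2 -mulrA ler_pM2l//; apply: le_trans (ler_wpM2l (ltW e0) (sqnorm_lap_le f)) _.
  by rewrite mulrA ed mul1r.
have := ler_wpM2l (ltW e0) (spectral_gap_le f0); lra.
Qed.

(* Exponential weights in the vertical direction: [b ^ z] is nearly harmonic for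
   the vertical moves, and the gap beats the loss on centered functions. *)
Lemma lazy_iter_centered (b : R) f n : 0 < b -> b + b^-1 <= 2 + lambda ->
  \sum_g f g = 0 -> forall z,
  let F := lazy_iter w pred0 n (fun x : cylinder G => f x.1 * (x.2 == 0)%:R) in
  \sum_g F (g, z) = 0 /\ sqnorm (fun g => F (g, z)) <= sqnorm f * b ^ z.
Proof.
move=> b0 bl f0; elim: n => [|n IH] z F.
  rewrite /F /= -mulr_suml f0 mul0r; split => //.
  case: eqP => [->|_]; rewrite ?expr0z ?mulr1.
    by rewrite le_eqVlt (_ : sqnorm _ = sqnorm f) ?eqxx//; apply: eq_bigr => g _; rewrite mulr1.
  rewrite [sqnorm _]big1 ?mulr_ge0 ?sqnorm_ge0 ?exprz_ge0 ?(ltW b0)// => g _.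
  by rewrite mulr0 expr0n.
pose F' := lazy_iter w pred0 n (fun x : cylinder G => f x.1 * (x.2 == 0)%:R).
(* As (1 - 2 beta) / (2 d) = beta, the whole holding mass can be attached to the horizontal step.
   This is a convex combination of three functions, to which convexity of the square applies. *)
have FE g : F (g, z) = (1 - 2 * beta) *
      (F' (g, z) + (2 * d)^-1 * lap (fun g' => F' (g', z)) g) +
    beta * F' (g, z + 1) + beta * F' (g, z - 1).
  rewrite /F /= stepE -/F'.
  have : (1 - 2 * beta) * (2 * d)^-1 = beta.
    have d20 : 2 * d != 0 by rewrite gt_eqF//; have := d1; lra.
    by apply: (mulIf d20); rewrite -mulrA mulVf// mulr1; have := betaE; lra.
  by move=> e; rewrite [X in _ = X + _ + _]mulrDr mulrA e; ring.
have [m0 s0] := IH z; have [m1 s1] := IH (z + 1); have [m2 s2] := IH (z - 1).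
rewrite -/F' in m0 s0 m1 s1 m2 s2; split.
  under eq_bigr do rewrite FE.
  rewrite !big_split /= -!mulr_sumr m1 m2 big_split /= m0 -mulr_sumr sum_lap.
  by rewrite !mulr0 !addr0 mulr0.
have bz0 : 0 < b ^ z by rewrite exprz_gt0.
apply: (@le_trans _ _ ((1 - 2 * beta) * sqnorm (fun g =>
      F' (g, z) + (2 * d)^-1 * lap (fun g' => F' (g', z)) g) +
    beta * sqnorm (fun g => F' (g, z + 1)) + beta * sqnorm (fun g => F' (g, z - 1)))).
  rewrite /sqnorm !mulr_sumr -!big_split; apply: ler_sum => g _ /=; rewrite FE.
  move: (_ + _ * lap _ g) (F' (g, z + 1)) (F' (g, z - 1)) => p q s.
  by apply: sqr_convex3; rewrite (ltW beta0) beta4.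
have b20 : 0 <= 1 - 2 * beta by have := beta4; lra.
have h0 := ler_wpM2l b20 (sqnorm_step m0).
have h1 := ler_wpM2l (ltW beta0) s1; have h2 := ler_wpM2l (ltW beta0) s2.
have e1 : b ^ (z + 1) = b ^ z * b by rewrite expfzDr ?gt_eqF// expr1z.
have e2 : b ^ (z - 1) = b ^ z * b^-1 by rewrite expfzDr ?gt_eqF.
rewrite e1 in h1; rewrite e2 in h2.
have e3 : (1 - 2 * beta) * (1 - (2 * d)^-1 * lambda) = 1 - 2 * beta - beta * lambda.
  have : (1 - 2 * beta) * (2 * d)^-1 = beta.
    have d20 : 2 * d != 0 by rewrite gt_eqF//; have := d1; lra.
    by apply: (mulIf d20); rewrite -mulrA mulVf// mulr1; have := betaE; lra.
  by rewrite mulrBr mulrA => ->; ring.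
rewrite mulrA e3 in h0.
have l0 : 0 <= lambda := spectral_gap_ge0 R G.
have dl : beta * lambda <= 1 - 2 * beta.
  have := spectral_gap_ub R G; rewrite -(ler_pM2l beta0) => h; apply: le_trans h _.
  by have := betaE; lra.
have h3 : (1 - 2 * beta - beta * lambda) * sqnorm (fun g => F' (g, z)) <=
    (1 - 2 * beta - beta * lambda) * (sqnorm f * b ^ z) by rewrite ler_wpM2l//; lra.
have Sb : 0 <= beta * (sqnorm f * b ^ z).
  by rewrite mulr_ge0 ?(ltW beta0)// mulr_ge0 ?sqnorm_ge0// ltW.
have h4 := ler_wpM2l Sb bl.
apply: le_trans (lerD (lerD (le_trans h0 h3) h1) h2) _.
move: h4; move: (b^-1) => bi; lra.
Qed.

(** The indicator of [V] is its mean plus a centered function. The mean meets the Green function of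
    the vertical walk, of order sqrt n; the centered part has decayed by the time the walk comes
    down, and is at most [e] at each of the [T] times. *)
Lemma hit_slice_far n T V (e : R) x (k := beta / (2 * n.+1%:R)) : 0 <= e ->
  #|G|%:R * (1 + Num.sqrt lambda) ^- `|x.2|%N <= e ^+ 2 -> k^-1 ^+ 3 <= T%:R ->
  hit_prob R n (slice V) pred0 x <=
  2 * (#|V|%:R / #|G|%:R * (beta * Num.sqrt k)^-1 + T%:R * e + k).
Proof.
move=> e0 He kT; set N : R := #|G|%:R.
have N0 : 0 < N := card_fc_gt0 R G.
have k0 : 0 < k by rewrite divr_gt0// mulr_gt0.
have n1 : 1 <= n.+1%:R :> R by rewrite ler1n.
have kE : k * (2 * n.+1%:R) = beta by rewrite divfK// gt_eqF// mulr_gt0.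
have kb : k < beta by rewrite -kE ltr_pMr//; lra.
have k4 : k <= 4^-1 by have := beta4; lra.
apply: le_trans (@hit_prob_le_green R _ w pred0 w01 beta k n T (slice V) x beta_w k0 _ kb kT) _.
  by rewrite -kE -natr1; nra.
rewrite ler_pM2l// lerD2r.
pose f g : R := (g \in V)%:R - #|V|%:R / N.
have f0 : \sum_g f g = 0.
  rewrite sumrB sumr_const -[_ *+ _]mulr_natl mulrCA mulfV ?gt_eqF// mulr1.
  by rewrite -natr_sum -big_mkcond sum1_card subrr.
have VN0 : 0 <= #|V|%:R / N by rewrite divr_ge0.
have VN1 : #|V|%:R / N <= 1 by rewrite ler_pdivrMr// mul1r ler_nat max_card.
have fn : sqnorm f <= N.
  rewrite -[N]mulr1 mulr_natl -sumr_const; apply: ler_sum => g _.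
  by rewrite /f; case: (g \in V) => /=; nra.
have split i : lazy_iter w pred0 i (fun y => (slice V y)%:R) x =
    #|V|%:R / N * lazy_iter w pred0 i (fun y : cylinder G => (y.2 == 0)%:R) x +
    lazy_iter w pred0 i (fun y : cylinder G => f y.1 * (y.2 == 0)%:R) x.
  rewrite -lazy_iterZ -lazy_iterD; congr lazy_iter; apply/funext => y.
  by rewrite /slice /f; case: (y.1 \in V); case: (y.2 == 0); rewrite /=; ring.
rewrite /lazy_green; under eq_bigr do rewrite split mulrDr mulrCA.
rewrite big_split /= -mulr_sumr; apply: lerD.
  by rewrite ler_wpM2l//; exact: lazy_green_line.
rewrite mulr_natl -[in leRHS](card_ord T) -sumr_const; apply: ler_sum => i _.
have k1 : 0 <= 1 - k by lra.
set F := lazy_iter w pred0 i _.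
have s1 : 1 <= 1 + Num.sqrt lambda by rewrite lerDl sqrtr_ge0.
have s0 : 0 < 1 + Num.sqrt lambda by exact: lt_le_trans s1.
(* With s = sqrt lambda the left side is 2 + s^2 / (1 + s). The weight is symmetric in b and its
   inverse; the sign of the height decides which one gives decay. *)
have sl : (1 + Num.sqrt lambda) + (1 + Num.sqrt lambda)^-1 <= 2 + lambda.
  rewrite -[X in 2 + X]sqr_sqrtr ?spectral_gap_ge0//.
  have : 0 <= Num.sqrt lambda := sqrtr_ge0 _.
  move: (Num.sqrt lambda) s0 => s s0 ss.
  rewrite -(ler_pM2r s0) mulrDl mulVf ?gt_eqF//.
  have : 0 <= s ^+ 3 by rewrite exprn_ge0.
  nra.
have Fe : F x ^+ 2 <= e ^+ 2.
  apply: le_trans He; case: x @F {split} => g z F.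
  have Fle (b : R) : 0 < b -> b + b^-1 <= 2 + lambda -> F (g, z) ^+ 2 <= N * b ^ z.
    move=> b0 bl; have [_ h] := lazy_iter_centered i b0 bl f0 z.
    apply: (@le_trans _ _ (sqnorm (fun g => F (g, z)))).
      by rewrite /sqnorm (bigD1 g)//= lerDl sumr_ge0// => *; exact: sqr_ge0.
    by apply: le_trans h _; rewrite ler_wpM2r// exprz_ge0// ltW.
  case: z @F Fle => [m|m] F Fle /=.
    have := Fle (1 + Num.sqrt lambda)^-1; rewrite invr_gt0 invrK (addrC _^-1) => /(_ s0 sl).
    by rewrite -exprVn.
  by have := Fle _ s0 sl; rewrite NegzE.
have Fe' : `|F x| <= e by rewrite -(@ler_pXn2r _ 2)// ?nnegrE// real_normK ?num_real.
apply: (@le_trans _ _ ((1 - k) ^+ i * `|F x|)); first by rewrite ler_wpM2l ?exprn_ge0// ler_norm.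
by apply: le_trans Fe'; rewrite ler_piMl// exprn_ile1//; lra.
Qed.

End far_hitting.

(** * Heat kernel of the walk killed outside a set, and mean numbers of visits *)

Section heat_kernel.
Variables (R : realType) (G : fcgraph) (D : pred G).
Implicit Types (f h : G -> R) (x y : G) (n : nat).

Local Notation L := (fin_graph G).
Local Notation d := ((max_deg G)%:R : R).
Local Notation kill n := (@killed R L n D).
Let deg x : R := #|fc_adj x|%:R.

Let fin_meanE f x : walk_mean (f : L -> R) x = (deg x)^-1 * \sum_(y | fc_adj x y) f y.
Proof. by rewrite /walk_mean fc_degE sum_fc_nbrs. Qed.

Let deg_ge1 x : 1 <= deg x. Proof. by rewrite ler1n fc_deg_gt0. Qed.

Let dot h f : R := \sum_x deg x * (h x * f x).

Let killedC n h f : dot (kill n h) f = dot h (kill n f).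
Proof.
have k0 h' f' : dot (kill 0%N h') f' = dot h' (kill 0%N f').
  by apply: eq_bigr => x _ /=; case: (D x); rewrite ?mul0r ?mulr0.
have k1 h' f' : dot (kill 1%N h') f' = dot h' (kill 1%N f').
  have e u v : dot u (kill 1%N v) = \sum_x \sum_(y | fc_adj x y)
      (if D x || D y then 0 else u x * v y).
    apply: eq_bigr => x _ /=; case: (D x) => /=; first by rewrite !mulr0 big1.
    rewrite fin_meanE mulrCA !mulrA mulfK ?gt_eqF ?(lt_le_trans ltr01)//.
    by rewrite mulr_sumr; apply: eq_bigr => y _; case: (D y); rewrite ?mulr0.
  rewrite e sum_adj_sym -[dot (kill _ _) _]/(dot _ _) (_ : dot _ _ = dot f' (kill 1%N h')).
    rewrite e; apply: eq_bigr => x _; apply: eq_bigr => y _.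
    by rewrite orbC; case: ifP => // _; rewrite mulrC.
  by apply: eq_bigr => x _; congr (_ * _); exact: mulrC.
elim: n h f => [//|n IH] h f.
have -> : dot (kill n.+1 h) f = dot (kill n (kill 1%N h)) f.
  by apply: eq_bigr => x _; rewrite -killed_add addn1.
by rewrite IH k1; apply: eq_bigr => x _; rewrite -killed_add add1n.
Qed.

Let delta y : G -> R := fun z => (z == y)%:R.

Let dot_delta x f : dot (delta x) f = deg x * f x.
Proof.
rewrite /dot (bigD1 x)//= /delta eqxx mul1r big1 ?addr0// => y /negbTE yx.
by rewrite yx mul0r mulr0.
Qed.

Let dot_le h f : dot h f <= 2^-1 * (dot h h + dot f f).
Proof.
rewrite -big_split mulr_sumr; apply: ler_sum => x _ /=.
have : 0 <= deg x * (h x - f x) ^+ 2.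
  by rewrite mulr_ge0 ?sqr_ge0// (le_trans ler01).
lra.
Qed.

(* Cauchy-Schwarz and reversibility bound the heat kernel at even times by its
   diagonal. *)
Lemma killed_offdiag n x y (c : R) : 0 <= c ->
  (forall z, kill (n + n) (delta z) z <= c) -> kill (n + n) (delta y) x <= d * c.
Proof.
move=> c0 Hc.
have e z t : deg z * kill (n + n) (delta t) z = dot (kill n (delta z)) (kill n (delta t)).
  by rewrite killedC -dot_delta; apply: eq_bigr => u _; rewrite killed_add.
have dx0 : 0 < deg x := lt_le_trans ltr01 (deg_ge1 x).
have dle z : deg z <= d by rewrite ler_nat fc_deg_le.
rewrite -(ler_pM2l dx0) e; apply: le_trans (dot_le _ _) _; rewrite -!e.
have hx := ler_wpM2l (le_trans ler01 (deg_ge1 x)) (Hc x).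
have hy := ler_wpM2l (le_trans ler01 (deg_ge1 y)) (Hc y).
have h1 : deg y * c <= d * c by rewrite ler_wpM2r.
have h2 : 1 * (d * c) <= deg x * (d * c) by rewrite ler_wpM2r// mulr_ge0.
have h3 : deg x * c <= deg x * (d * c).
  by rewrite ler_wpM2l ?(ltW dx0)// ler_peMl// ler1n max_deg_gt0.
lra.
Qed.

Lemma powR_halve (gamma : R) (m n : nat) : 0 < gamma -> (0 < m)%N -> (n.+1 <= m.*2)%N ->
  m%:R `^ (- gamma) <= 2 `^ gamma * n.+1%:R `^ (- gamma).
Proof.
move=> g0 m0 nm.
have m0' : 0 < m%:R :> R by rewrite ltr0n.
rewrite !powRN -ler_pdivrMr ?invr_gt0 ?powR_gt0// invrK.
rewrite ler_pdivrMl ?powR_gt0// mulrC -powRM ?ler0n// ge0_ler_powR ?nnegrE//; last first.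
  by rewrite -natrM ler_nat mul2n.
exact: ltW.
Qed.

(** Even times reduce to the diagonal, and one step reduces an odd time to an even one. With n + 1
    in place of n the bound makes sense at time 0, and for n <= 1 its right side is at least 1. *)
Lemma killed_heat_kernel (a gamma : R) n x y : 0 < a -> 0 < gamma ->
  (forall m z, ~~ D z -> (1 <= m)%N -> kill m (delta z) z <= a * m%:R `^ (- gamma)) ->
  kill n (delta y) x <= (d * a + 1) * 2 `^ gamma * n.+1%:R `^ (- gamma).
Proof.
move=> a0 g0 Ha; have d0 : 0 <= d by [].
have p2 : 0 < 2 `^ gamma by rewrite powR_gt0.
have pn : 0 < n.+1%:R `^ (- gamma) by rewrite powR_gt0.
have delta1 t z : delta t z <= 1 by rewrite lern1 leq_b1.
have even m t u : (1 <= m)%N -> kill (m + m) (delta u) t <= d * (a * m.*2%:R `^ (- gamma)).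
  move=> m1; apply: killed_offdiag => [|z]; first by rewrite mulr_ge0 ?powR_ge0// ltW.
  have [Dz|Dz] := boolP (D z); last by rewrite addnn; apply: Ha => //; rewrite double_gt0.
  by case: m m1 => //= m _; rewrite Dz mulr_ge0 ?powR_ge0// ltW.
have fin m t u : (1 <= m)%N -> (n.+1 <= m.*2.*2)%N -> kill (m + m) (delta u) t <=
    (d * a + 1) * 2 `^ gamma * n.+1%:R `^ (- gamma).
  move=> m1 nm; apply: le_trans (even _ _ _ m1) _.
  have m2 : (0 < m.*2)%N by rewrite double_gt0.
  have h := powR_halve g0 m2 nm; have da0 : 0 <= d * a by rewrite mulr_ge0 ?(ltW a0).
  have := ler_wpM2l da0 h; rewrite !mulrDl !mul1r mulrA -!(mulrA (d * a)).
  by move=> h'; apply: le_trans h' _; rewrite lerDl mulr_ge0// ltW.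
have [n1|n1] := leqP n 1.
  apply: (@le_trans _ _ 1); first exact: killed_le_cst.
  have h1 : (1 : R) <= 2 `^ gamma * n.+1%:R `^ (- gamma).
    have := @powR_halve gamma 1 n g0 isT; rewrite powR1; apply.
    by rewrite ltnS.
  rewrite -mulrA; apply: le_trans h1 _; rewrite ler_peMl ?(ltW (mulr_gt0 p2 pn))//.
  by rewrite lerDr mulr_ge0// ltW.
have m1 : (1 <= n./2)%N by rewrite -divn2 divn_gt0.
have nE := odd_double_half n; rewrite -addnn in nE.
have nm : (n.+1 <= n./2.*2.*2)%N.
  move: nE m1; rewrite -!addnn; case: (odd n) => /=; lia.
rewrite -[n in kill n]nE; case: (odd n); rewrite ?add0n ?add1n; last exact: fin.
rewrite /=; case: ifP => _; last by apply: walk_mean_le_cst => t _; exact: fin.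
by rewrite !mulr_ge0 ?powR_ge0// addr_ge0// mulr_ge0// ltW.
Qed.

Lemma killed_set_le (V : {set G}) n x (c : R) : (forall y, kill n (delta y) x <= c) ->
  kill n (fun z => (z \in V)%:R) x <= #|V|%:R * c.
Proof.
move=> H; have -> : kill n (fun z => (z \in V)%:R) x =
    kill n (fun z => \sum_(y <- enum V) delta y z) x.
  congr killed; apply/funext => z; rewrite big_enum /=.
  case: (boolP (z \in V)) => zV.
    rewrite (bigD1 z)//= /delta eqxx big1 ?addr0// => y /andP[_ /negbTE].
    by rewrite eq_sym => ->.
  by rewrite big1// => y yV; rewrite /delta; case: eqP => // e; rewrite e yV in zV.
rewrite killed_sum big_enum /= mulr_natl -sumr_const.
by apply: ler_sum => y _; exact: H.
Qed.

End heat_kernel.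

Section visits.
Variables (R : realType) (G : fcgraph) (D : pred G).
Implicit Types (g : G) (n : nat) (V : {set G}).
Local Notation L := (fin_graph G).
Local Notation kill n := (@killed R L n D).

(* At each visit of the projection to [g], the walk on the cylinder stays over
   [g] for a geometric time of mean [(deg g + 2) / deg g <= 3]. *)
Lemma visit_mean_le V n (x : cylinder G) :
  visit_mean R n (fun y : cylinder G => y.1 \in V) (fun y : cylinder G => D y.1) x <=
  3 * \sum_(k < n.+1) kill k (fun z => (z \in V)%:R) x.1.
Proof.
pose f k : G -> R := kill k (fun z => (z \in V)%:R).
have f0 k g : 0 <= f k g by apply: killed_ge0 => z; rewrite ler0n.
elim: n x => [|n IH] [g z]; rewrite [visit_mean _ _ _ _ _]/=.
  case: ifP => Dg; first by rewrite mulr_ge0// sumr_ge0// => k _; exact: f0.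
  by rewrite addr0 big_ord1 /= Dg ler_peMl ?ler0n//; lra.
case: ifP => Dg; first by rewrite mulr_ge0// sumr_ge0// => k _; exact: f0.
pose S m g' := \sum_(k < m) f k g'.
apply: (@le_trans _ _ ((g \in V)%:R + walk_mean (fun y : cylinder G => 3 * S n.+1 y.1) (g, z))).
  by rewrite lerD2l; apply: walk_mean_le => y _; exact: IH.
rewrite -[\sum_(k < n.+2) _]/(S n.+2 g).
have S1 : S n.+2 g = (g \in V)%:R + walk_mean (S n.+1 : L -> R) g.
  by rewrite /S big_ord_recl /f /= Dg walk_mean_sum; congr (_ + _); apply: eq_bigr => k _; rewrite /= Dg.
have S2 : S n.+1 g <= S n.+2 g by rewrite {2}/S big_ord_recr lerDl /=.
have dg : 1 <= #|fc_adj g|%:R :> R by rewrite ler1n fc_deg_gt0.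
have d0 : 0 < #|fc_adj g|%:R + 2 :> R by lra.
rewrite walk_meanZ cyl_mean_fst.
have e : #|fc_adj g|%:R * walk_mean (S n.+1 : L -> R) g =
    lap (S n.+1) g + #|fc_adj g|%:R * S n.+1 g.
  rewrite lapE subrK /walk_mean fc_degE sum_fc_nbrs mulrA mulfV ?mul1r// gt_eqF//; lra.
set m := walk_mean _ _ in S1 e; set l := lap _ _ in e *; set s := S n.+1 g in S2 e *.
have V01 : 0 <= (g \in V)%:R :> R by [].
rewrite -(ler_pM2r d0); set dd := #|fc_adj g|%:R in dg d0 e *.
have -> : ((g \in V)%:R + 3 * (s + (dd + 2)^-1 * l)) * (dd + 2) =
    (g \in V)%:R * (dd + 2) + 3 * (s * (dd + 2) + l).
  by field; rewrite gt_eqF.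
move: V01 S2; rewrite S1; move: (g \in V)%:R => b b0 S2.
have : b * (dd + 2) <= 3 * (b * dd).
  have : 0 <= b * (dd - 1) by rewrite mulr_ge0// subr_ge0.
  lra.
lra.
Qed.

End visits.

Section power_sums.
Variables (R : realType).

(** Comparison of the sum with the integral, in difference form. With x = k and y = k + 1 it follows
    from ln (x / y) <= x / y - 1 = - 1 / y and exp t >= 1 + t. *)
Lemma powR_telescope (gamma : R) (k : nat) : 1 < gamma -> (0 < k)%N ->
  k.+1%:R `^ (- gamma) <=
  (gamma - 1)^-1 * (k%:R `^ (1 - gamma) - k.+1%:R `^ (1 - gamma)).
Proof.
move=> g1 k0; set q := gamma - 1; have q0 : 0 < q by rewrite subr_gt0.
have x0 : 0 < k%:R :> R by rewrite ltr0n.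
have y0 : 0 < k.+1%:R :> R by rewrite ltr0n.
have yx : k.+1%:R = k%:R + 1 :> R by rewrite -natr1.
move: (k%:R) (k.+1%:R) x0 y0 yx => x y x0 y0 yx.
have -> : 1 - gamma = - q by rewrite /q opprB.
have -> : - gamma = - q + - 1 by rewrite /q; ring.
have ratio : 1 + q / y <= (x / y) `^ (- q).
  have xy0 : 0 < x / y by rewrite divr_gt0.
  rewrite /powR gt_eqF//; apply: le_trans (expR_ge1Dx _).
  rewrite lerD2l mulNr -mulrN ler_pM2l//.
  have h : -1 < x / y - 1 by rewrite ltrBrDr addNr.
  have := le_ln1Dx h; rewrite addrC subrK => h2; rewrite lerNr; apply: le_trans h2 _.
  have -> : x / y = 1 - y^-1 by rewrite yx; field; rewrite -yx gt_eqF.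
  by lra.
have xE : x = y * (x / y) by rewrite mulrC divfK// gt_eqF.
rewrite powRD ?(gt_eqF y0) ?implybT// powR_inv1 ?(ltW y0)//.
rewrite ler_pdivlMl// {1}xE powRM ?(ltW y0) ?divr_ge0 ?(ltW x0) ?(ltW y0)//.
have yq : 0 < y `^ (- q) by rewrite powR_gt0.
have := ler_wpM2l (ltW yq) ratio; rewrite mulrDr mulr1; lra.
Qed.

Lemma sum_powR_tail (gamma : R) (J T : nat) : 1 < gamma -> (0 < J)%N ->
  \sum_(J <= k < T) k.+1%:R `^ (- gamma) <= (gamma - 1)^-1 * J%:R `^ (1 - gamma).
Proof.
move=> g1 J0; have q0 : 0 < (gamma - 1)^-1 by rewrite invr_gt0 subr_gt0.
have [TJ|JT] := leqP T J.
  by rewrite big_geq// mulr_ge0 ?powR_ge0// ltW.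
apply: (@le_trans _ _ ((gamma - 1)^-1 * (J%:R `^ (1 - gamma) - T%:R `^ (1 - gamma)))).
  elim: T JT => // T IH; rewrite ltnS => JT.
  rewrite big_nat_recr//=; have [->|TJ] := eqVneq T J.
    by rewrite big_geq// add0r powR_telescope.
  have := IH _; rewrite ltn_neqAle eq_sym TJ JT => /(_ isT) h.
  apply: le_trans (lerD h (powR_telescope g1 (leq_trans J0 JT))) _.
  by rewrite -mulrDr; apply: ler_wpM2l; [rewrite ltW|lra].
by rewrite ler_pM2l// gerBl powR_ge0.
Qed.

Lemma sum_min_powR (gamma c : R) (F : nat -> R) (k1 T : nat) : 1 < gamma -> 0 <= c ->
  (0 < k1)%N -> (forall k, F k <= 1) -> (forall k, 0 <= F k) ->
  (forall k, F k <= c * k.+1%:R `^ (- gamma)) ->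
  \sum_(k < T) F k <= k1%:R + c * ((gamma - 1)^-1 * k1%:R `^ (1 - gamma)).
Proof.
move=> g1 c0 k10 F1 F0 Fc.
have first n : \sum_(0 <= k < n) F k <= n%:R.
  rewrite -[n%:R]mulr1 mulr_natl -[n in leRHS]subn0 -sumr_const_nat.
  by apply: ler_sum_nat.
have tail0 : 0 <= c * ((gamma - 1)^-1 * k1%:R `^ (1 - gamma)).
  by rewrite !mulr_ge0 ?powR_ge0// invr_ge0 subr_ge0 ltW.
rewrite -(big_mkord predT F); have [Tk|kT] := leqP T k1.
  apply: le_trans (first T) _; rewrite -[leLHS]addr0 lerD// ler_nat//.
rewrite (big_cat_nat (leq0n k1) (ltnW kT))/=; apply: lerD => //.
apply: (@le_trans _ _ (\sum_(k1 <= k < T) c * k.+1%:R `^ (- gamma))).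
  by apply: ler_sum_nat.
by rewrite -mulr_sumr ler_wpM2l// sum_powR_tail.
Qed.

Lemma sum_blocks (F g : nat -> R) (b J T : nat) : (0 < b)%N ->
  (forall k, F k <= g (k %/ b)%N) -> (J <= T)%N ->
  \sum_(J * b <= k < T * b) F k <= b%:R * \sum_(J <= j < T) g j.
Proof.
move=> b0 Fg; elim: T => [|T IH] JT.
  by move: JT; rewrite leqn0 => /eqP ->; rewrite !big_geq ?mulr0.
move: JT; rewrite leq_eqVlt => /predU1P[->|]; first by rewrite !big_geq ?mulr0.
rewrite ltnS => JT; rewrite big_nat_recr//= mulrDr.
have JTb : (J * b <= T * b)%N by rewrite leq_mul2r JT orbT.
have TTb : (T * b <= T.+1 * b)%N by rewrite leq_mul2r leqnSn orbT.
rewrite (big_cat_nat JTb TTb)/=.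
apply: lerD; first exact: IH.
rewrite mulr_natl; have -> : g T *+ b = \sum_(T * b <= k < T.+1 * b) g T.
  by rewrite sumr_const_nat mulSn addnK.
apply: ler_sum_nat => k /andP[Tk kT]; apply: le_trans (Fg k) _.
suff -> : (k %/ b = T)%N by [].
apply/eqP; rewrite eqn_leq -ltnS ltn_divLR// kT.
by rewrite leq_divRL// Tk.
Qed.

Lemma sum_geom_tail (r : R) (J T : nat) : 0 <= r < 1 ->
  \sum_(J <= j < T) r ^+ j <= r ^+ J / (1 - r).
Proof.
move=> /andP[r0 r1]; have r1' : 0 < 1 - r by rewrite subr_gt0.
rewrite ler_pdivlMr//; have [TJ|/ltnW JT] := leqP T J.
  by rewrite big_geq// mul0r exprn_ge0.
suff -> : (\sum_(J <= j < T) r ^+ j) * (1 - r) = r ^+ J - r ^+ T.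
  by rewrite gerBl exprn_ge0.
elim: T JT => [|T IH]; first by rewrite leqn0 => /eqP ->; rewrite big_geq// mul0r subrr.
rewrite leq_eqVlt => /predU1P[->|]; first by rewrite big_geq// mul0r subrr.
rewrite ltnS => JT; rewrite big_nat_recr//= mulrDl IH// exprS; ring.
Qed.

End power_sums.

Section lazy_killed.
Variables (R : realType) (L : lfgraph) (D : pred L).
Local Notation lz k := (@lazy_iter R L (fun=> 4^-1) D k).

(* [lz k] averages [killed j] over [j] binomial [(k, 1/4)]; the generating
   function [E 2^-j = (7/8)^k] controls the event [j < J]. *)
Lemma lazy_iter_killed_le (f : L -> R) (J k : nat) (a1 : R) x :
  (forall y, D y -> f y = 0) -> 0 <= a1 ->
  (forall j y, killed j D f y <= 1) ->
  (forall j y, (J <= j)%N -> killed j D f y <= a1) ->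
  lz k f x <= a1 + 2 ^+ J * (7 / 8) ^+ k.
Proof.
move=> f0 a10 H1 HJ.
have fE : f = killed 0 D f.
  by apply/funext => y /=; case: ifP => // /f0.
suff main : forall j y, lz k (killed j D f) y <= a1 + 2 ^+ J * 2^-1 ^+ j * (7 / 8) ^+ k.
  by rewrite fE; have := main 0%N x; rewrite expr0 mulr1.
elim: k => [|k IH] j y.
  rewrite expr0 mulr1 /=; have [Jj|jJ] := leqP J j.
    by apply: le_trans (HJ _ _ Jj) _; rewrite lerDl mulr_ge0 ?exprn_ge0//.
  apply: le_trans (H1 _ _) _; rewrite -[leLHS]add0r lerD//.
  rewrite -(subnK (ltnW jJ)) exprD -mulrA -exprMn mulfV ?pnatr_eq0// expr1n mulr1.
  by rewrite exprn_ege1// ler1n.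
have step z : lazy_step (fun=> 4^-1) D (killed j D f) z =
    (1 - 4^-1) * killed j D f z + 4^-1 * killed j.+1 D f z.
  rewrite /lazy_step [killed j.+1 _ _ _]/=; case: ifP => // Dz.
  by case: j => [|j]; rewrite /= Dz !mulr0 addr0.
rewrite /lazy_iter iterSr -/(lz k _) (_ : lazy_step _ D (killed j D f) = fun z =>
    (1 - 4^-1) * killed j D f z + 4^-1 * killed j.+1 D f z); last exact/funext.
rewrite lazy_iterD !lazy_iterZ.
have h1 := IH j y; have h2 := IH j.+1 y.
have -> : a1 + 2 ^+ J * 2^-1 ^+ j * (7 / 8) ^+ k.+1 =
    (1 - 4^-1) * (a1 + 2 ^+ J * 2^-1 ^+ j * (7 / 8) ^+ k) +
    4^-1 * (a1 + 2 ^+ J * 2^-1 ^+ j.+1 * (7 / 8) ^+ k).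
  by rewrite !exprS; field.
by apply: lerD; rewrite ler_wpM2l//; lra.
Qed.

(** With J = k / 10 in [lazy_iter_killed_le] the error decays geometrically in J, since 2 (7/8)^10 <
    3/5. *)
Lemma pow2_78 (k : nat) : 2 ^+ (k %/ 10) * (7 / 8) ^+ k <= (3 / 5 : R) ^+ (k %/ 10).
Proof.
rewrite {2}(divn_eq k 10) exprD mulnC exprM mulrA -exprMn.
apply: (@le_trans _ _ ((2 * (7 / 8) ^+ 10) ^+ (k %/ 10))).
  by rewrite ler_piMr ?exprn_ge0 ?mulr_ge0 ?exprn_ge0 ?exprn_ile1//; lra.
by rewrite lerXn2r ?nnegrE ?mulr_ge0 ?exprn_ge0//; lra.
Qed.

End lazy_killed.

Section lazy_automorphism.
Variables (R : realType) (L : lfgraph) (w : L -> R) (D : pred L) (phi : L -> L).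
Hypothesis phi_mean : forall (F : L -> R) x, walk_mean (F \o phi) x = walk_mean F (phi x).
Hypothesis phi_w : forall x, w (phi x) = w x.
Hypothesis phi_D : forall x, D (phi x) = D x.

Lemma lazy_iter_comp n (F : L -> R) x :
  lazy_iter w D n (fun y => F (phi y)) x = lazy_iter w D n F (phi x).
Proof.
elim: n x => [//|n IH] x /=; rewrite /lazy_step phi_D phi_w -/(lazy_iter w D n _).
case: ifP => // _; rewrite IH -phi_mean; congr (_ + _ * _).
by apply: eq_walk_mean => y _ /=; rewrite IH.
Qed.

End lazy_automorphism.

(** * Hitting from moderate heights by means of the heat kernel *)

Section near_hitting.
Variables (R : realType) (G : fcgraph) (D : pred G).
Implicit Types (g : G) (z : int) (F : cylinder G -> R) (f : G -> R) (V : {set G}).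

(** Chosen so that every vertex moves horizontally with probability exactly 1/4: the projection to
    [G] is a lazy simple random walk, whatever the height. The vertical rate [p g] then varies with
    the vertex. *)
Let w (x : cylinder G) : R := (#|fc_adj x.1|%:R + 2) / (4 * #|fc_adj x.1|%:R).
Let DE : pred (cylinder G) := fun x => D x.1.
Let p g : R := (4 * #|fc_adj g|%:R)^-1.
Local Notation lz k := (@lazy_iter R (fin_graph G) (fun=> 4^-1) D k).

Let dg1 g : 1 <= #|fc_adj g|%:R :> R. Proof. by rewrite ler1n fc_deg_gt0. Qed.

Let p0 g : 0 <= p g. Proof. by rewrite invr_ge0 mulr_ge0. Qed.

Let p4 g : p g <= 4^-1.
Proof. by rewrite lef_pV2 ?posrE ?mulr_gt0//; have := dg1 g; lra. Qed.

Let wE x : w x = 4^-1 + 2 * p x.1.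
Proof. by rewrite /w /p; have := dg1 x.1 => h; field; rewrite gt_eqF//; lra. Qed.

Let w01 x : 0 <= w x <= 1.
Proof. by rewrite wE; have := p0 x.1; have := p4 x.1 => a b; apply/andP; split; lra. Qed.

Let w4 x : 4^-1 <= w x.
Proof. by rewrite wE lerDl mulr_ge0. Qed.

Let stepE F g z : lazy_step w DE F (g, z) = if D g then 0 else
  (1 - 4^-1 - 2 * p g) * F (g, z) + p g * (F (g, z + 1) + F (g, z - 1)) +
  4^-1 * walk_mean (fun g' : fin_graph G => F (g', z)) g.
Proof.
rewrite /lazy_step /DE /=; case: ifP => // _.
rewrite cyl_meanE /walk_mean fc_degE sum_fc_nbrs /w /p /=; have := dg1 g => h.
by field; rewrite !gt_eqF//; lra.
Qed.

Let lazy_iter_fst n f g z :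
  lazy_iter w DE n (fun y : cylinder G => f y.1) (g, z) = lz n f g.
Proof.
elim: n g z => [//|n IH] g z; rewrite [LHS]/= -/(lazy_iter w DE n _) stepE /= /lazy_step.
case: ifP => // _; rewrite !IH; congr (_ + _ * _); first by ring.
by apply: eq_walk_mean => g' _; exact: IH.
Qed.

Let unimodal F := (forall g z, F (g, - z) = F (g, z)) /\
  (forall g z, 0 <= z -> F (g, z + 1) <= F (g, z)).

(** The critical place is height 0, where the difference F (g, 0) - F (g, 1) gets the coefficient 1
    - 1/4 - 3 p, nonnegative exactly when p <= 1/4. *)
Let unimodal_step F : unimodal F -> unimodal (lazy_step w DE F).
Proof.
move=> [Fs Fd]; split => g z.
  rewrite !stepE; case: ifP => // _.
  have -> : F (g, - z + 1) = F (g, z - 1) by rewrite -Fs opprD opprK.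
  have -> : F (g, - z - 1) = F (g, z + 1) by rewrite -Fs opprD !opprK.
  rewrite Fs [F (g, z - 1) + _]addrC; congr (_ + _ * _).
  by apply: eq_walk_mean => g' _; exact: Fs.
move=> z0; rewrite !stepE; case: ifP => // _; apply: lerD; last first.
  by rewrite ler_pM2l//; apply: walk_mean_le => g' _; exact: Fd.
rewrite addrK; have h0 := Fd g z z0; have h1 := Fd g (z + 1) (addr_ge0 z0 ler01).
have := p0 g; have := p4 g; move: (p g) => pg b4 b0.
move: z0; rewrite le_eqVlt => /predU1P[z0|z0].
  have e : F (g, z - 1) = F (g, z + 1) by rewrite -z0 !add0r Fs.
  rewrite e; move: (F (g, z)) (F (g, z + 1)) (F (g, z + 1 + 1)) h0 h1 => x y t h0 h1.
  have a1 : 0 <= (1 - 4^-1 - 3 * pg) * (x - y) by rewrite mulr_ge0//; lra.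
  have a2 : 0 <= pg * (y - t) by rewrite mulr_ge0//; lra.
  lra.
have := Fd g (z - 1); rewrite subrK subr_ge0 => /(_ z0).
move: (F (g, z)) (F (g, z + 1)) (F (g, z + 1 + 1)) (F (g, z - 1)) h0 h1 => x y t s h0 h1 h2.
have a1 : 0 <= (1 - 4^-1 - 2 * pg) * (x - y) by rewrite mulr_ge0//; lra.
have a2 : 0 <= pg * (y - t) by rewrite mulr_ge0//; lra.
have a3 : 0 <= pg * (s - x) by rewrite mulr_ge0//; lra.
lra.
Qed.

Let sl V (y : cylinder G) : R := (slice V y)%:R.

Let unimodal_iter V n : unimodal (lazy_iter w DE n (sl V)).
Proof.
elim: n => [|n IH]; last exact: unimodal_step.
split => g z; rewrite /= /sl /slice /= ?oppr_eq0// => z0.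
by rewrite (_ : (z + 1 == 0) = false) ?andbF//; apply/eqP; lia.
Qed.

(* A function that is even and nonincreasing in the height is at most its
   average over lower heights, and the sum over all heights is a quantity for
   the projection to [G]. *)
Lemma lazy_iter_slice_le V n g (z : int) : 0 < `|z| ->
  `|z|%:~R * lazy_iter w DE n (sl V) (g, z) <= lz n (fun g' => (g' \in V)%:R) g.
Proof.
have [sym dec] := unimodal_iter V n.
wlog z0 : z / 0 < z => [H|_].
  have [z0|z0|->] := ltgtP z 0; last by rewrite normr0 ltxx.
    by move=> h; rewrite -normrN -sym; apply: H; rewrite ?normrN// oppr_gt0.
  exact: H.
rewrite gtr0_norm//; case: z z0 => // m _; rewrite -[_%:~R]/(m%:R).
have mono (i : nat) : (i < m)%N -> lazy_iter w DE n (sl V) (g, m%:Z) <=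
    lazy_iter w DE n (sl V) (g, i.+1%:Z).
  elim: m => // m IH; rewrite ltnS leq_eqVlt => /predU1P[->//|/IH].
  by apply: le_trans; rewrite -[m.+1]addn1 PoszD; exact: dec.
apply: (@le_trans _ _ (\sum_(i < m) lazy_iter w DE n (sl V) (g, i.+1%:Z))).
  rewrite [leLHS](_ : _ = \sum_(i < m) lazy_iter w DE n (sl V) (g, m%:Z)).
    by apply: ler_sum => i _; exact: mono.
  by rewrite sumr_const card_ord mulr_natl.
(* Starting at height u amounts to translating the slice. The translates are disjoint, so their sum
   is at most the indicator of [V] on the base. *)
have sh (u : int) : lazy_iter w DE n (sl V) (g, u) =
    lazy_iter w DE n (fun y : cylinder G => sl V (y.1, y.2 + u)) (g, 0 : int).
  rewrite (@lazy_iter_comp R (cylinder G) w DE (fun y => (y.1, y.2 + u))) /= ?add0r//.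
  by move=> F x; exact: cyl_mean_shift.
under eq_bigr do rewrite sh.
rewrite -lazy_iter_sum -(@lazy_iter_fst n _ g 0); apply: lazy_iter_le => // -[g' z'] /=.
rewrite /sl /slice /=; case: (g' \in V) => /=; last by rewrite big1.
have [i zi|nz] := pickP (fun i : 'I_m => z' + i.+1%:Z == 0); last by rewrite big1// => i _; rewrite nz.
rewrite (bigD1 i)//= zi big1 ?addr0// => j ji.
case: eqP => // zj; case/eqP: ji; apply/val_inj; move/eqP: zi => /=; lia.
Qed.

(** Chernoff bound for early times: one step multiplies the exponential weight by at most 1 +
    s^2. *)
Lemma lazy_iter_slice_exp V n g z (b s : R) : 0 < b -> b + b^-1 <= 2 + s ^+ 2 ->
  lazy_iter w DE n (sl V) (g, z) <= (1 + s ^+ 2) ^+ n * b ^ z.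
Proof.
move=> b0 bs; have s0 : 0 <= s ^+ 2 := sqr_ge0 s.
elim: n g z => [|n IH] g z.
  rewrite expr0 mul1r /= /sl /slice /=; case: eqP => [->|_]; last by rewrite andbF exprz_ge0// ltW.
  by rewrite expr0z lern1 leq_b1.
rewrite [lazy_iter _ _ _ _]/= -/(lazy_iter w DE n _) stepE.
have bz : 0 < b ^ z by rewrite exprz_gt0.
have E0 : 0 < (1 + s ^+ 2) ^+ n by rewrite exprn_gt0// ltr_pwDl.
case: ifP => _; first by rewrite mulr_ge0 ?(ltW bz)// exprn_ge0// addr_ge0.
have c0 : 0 <= 1 - 4^-1 - 2 * p g by have := p4 g; lra.
have h0 := ler_wpM2l c0 (IH g z).
have h1 := ler_wpM2l (p0 g) (IH g (z + 1)); have h2 := ler_wpM2l (p0 g) (IH g (z - 1)).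
have h3 : walk_mean (fun g' : fin_graph G => lazy_iter w DE n (sl V) (g', z)) g <=
    (1 + s ^+ 2) ^+ n * b ^ z by apply: walk_mean_le_cst => g' _; exact: IH.
have e1 : b ^ (z + 1) = b ^ z * b by rewrite expfzDr ?gt_eqF// expr1z.
have e2 : b ^ (z - 1) = b ^ z * b^-1 by rewrite expfzDr ?gt_eqF.
rewrite e1 in h1; rewrite e2 in h2; rewrite exprSr.
move: ((1 + s ^+ 2) ^+ n) E0 h0 h1 h2 h3 => E E0 h0 h1 h2 h3.
have Eb : 0 < E * b ^ z by rewrite mulr_gt0.
have h4 := ler_wpM2l (mulr_ge0 (p0 g) (ltW Eb)) bs.
have h5 : p g * (E * b ^ z) * s ^+ 2 <= 1 * (E * b ^ z * s ^+ 2).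
  rewrite -mulrA ler_wpM2r//; first by rewrite mulr_ge0// ltW.
  by have := p4 g; lra.
move: h4 h5 h0 h1 h2 h3; move: (b^-1) (b ^ z) (p g) => bi c q; lra.
Qed.

(** The Green function is split at the lazy time 10 J. Earlier, the descent from height |z| is
    unlikely, with bound [e]; later, the mass is spread over |z| heights, which yields 1 / |z| times
    the tail of the killed heat kernel. *)
Lemma hit_slice_near V n (C gamma s e : R) (J : nat) g z : 1 < gamma -> 0 <= C ->
  (forall x, D x -> x \notin V) ->
  (forall k x, @killed R (fin_graph G) k D (fun y => (y \in V)%:R) x <=
     C * k.+1%:R `^ (- gamma)) ->
  (0 < J)%N -> 0 < `|z| -> 0 <= s ->
  (1 + s ^+ 2) ^+ (J * 10) * (1 + s) ^- `|z|%N <= e ->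
  hit_prob R n (slice V) DE (g, z) <=
  2 * (J%:R * 10 * e + `|z|%:~R^-1 * (10 * (C * ((gamma - 1)^-1 * J%:R `^ (1 - gamma)) +
    5 / 2 * (3 / 5) ^+ J)) + (8 * n.+1%:R)^-1).
Proof.
move=> g1 C0 DV HC J0 z0 s0 He; set k : R := (8 * n.+1%:R)^-1.
have n1 : 1 <= n.+1%:R :> R by rewrite ler1n.
have k0 : 0 < k by rewrite invr_gt0 mulr_gt0.
have kE : k * (8 * n.+1%:R) = 1 by rewrite mulVf// gt_eqF// mulr_gt0.
have k1 : k < 4^-1 by rewrite -(@ltr_pM2r _ (8 * n.+1%:R)) ?mulr_gt0// kE; lra.
have nk : 2 * n%:R * k <= 4^-1.
  by move: kE; rewrite -natr1; lra.
have [T0 T0k] : exists T0 : nat, k^-1 ^+ 3 <= T0%:R.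
  exists (Num.truncn (k^-1 ^+ 3)).+1; apply: ltW; apply: truncnS_gt.
(* A multiple of ten, so that the times from 10 J to T form whole blocks on which i / 10 is
   constant. *)
pose T := (maxn T0 J * 10)%N.
have Tk : k^-1 ^+ 3 <= T%:R.
  by apply: le_trans T0k _; rewrite ler_nat /T; apply: leq_trans (leq_maxl T0 J) (leq_pmulr _ _).
apply: le_trans (@hit_prob_le_green R (cylinder G) w DE w01 4^-1 k n T
  (slice V) (g, z) w4 k0 nk k1 Tk) _.
rewrite ler_pM2l// lerD2r.
have k01 : 0 <= k <= 1 by apply/andP; split; lra.
apply: le_trans (@lazy_green_le_sum R (cylinder G) w DE w01 k T (sl V) (g, z) k01 _) _.
  by move=> y; rewrite ler0n.
rewrite -(big_mkord predT (fun i => lazy_iter w DE i (sl V) (g, z))).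
have JT : (J * 10 <= T)%N by rewrite leq_mul2r leq_maxr orbT.
rewrite (big_cat_nat (leq0n _) JT)/=; apply: lerD.
  have -> : J%:R * 10 * e = \sum_(0 <= i < (J * 10)%N) e.
    by rewrite sumr_const_nat subn0 -[e *+ _]mulr_natl natrM.
  apply: ler_sum_nat => i /andP[_ iJ]; apply: le_trans He.
  have s1 : 0 < 1 + s by rewrite ltr_pwDl.
  have base (b : R) : 0 < b -> b + b^-1 <= 2 + s ^+ 2 ->
      lazy_iter w DE i (sl V) (g, z) <= (1 + s ^+ 2) ^+ (J * 10) * b ^ z.
    move=> b0 bs; apply: le_trans (lazy_iter_slice_exp V i g z b0 bs) _.
    rewrite ler_wpM2r ?exprz_ge0 ?(ltW b0)// ler_weXn2l ?(ltnW iJ)//.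
    by rewrite lerDl sqr_ge0.
  have bs : (1 + s) + (1 + s)^-1 <= 2 + s ^+ 2.
    rewrite -(ler_pM2r s1) mulrDl mulVf ?gt_eqF//.
    have : 0 <= s ^+ 3 by rewrite exprn_ge0.
    nra.
  case: z z0 base => m _ base.
    have := base (1 + s)^-1; rewrite invr_gt0 invrK (addrC _^-1) => /(_ s1 bs).
    by rewrite -exprVn.
  by have := base _ s1 bs; rewrite NegzE.
have zR : 0 < `|z|%:~R :> R by rewrite ltr0z.
pose gg j : R := `|z|%:~R^-1 * (C * j.+1%:R `^ (- gamma) + (3 / 5) ^+ j).
apply: (@le_trans _ _ (10 * \sum_(J <= j < maxn T0 J) gg j)).
  apply: (@sum_blocks _ _ gg 10) => //; last exact: leq_maxr.
  move=> i; rewrite /gg ler_pdivlMl//.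
  apply: le_trans (lazy_iter_slice_le V i g z0) _.
  apply: le_trans (@lazy_iter_killed_le R (fin_graph G) D (fun y => (y \in V)%:R)
    (i %/ 10)%N i (C * (i %/ 10).+1%:R `^ (- gamma)) g _ _ _ _) _.
  - by move=> y /DV /negbTE ->.
  - by rewrite mulr_ge0 ?powR_ge0.
  - by move=> j y; apply: killed_le_cst => // u; rewrite lern1 leq_b1.
  - move=> j y ij; apply: le_trans (HC j y) _; rewrite ler_wpM2l//.
    by rewrite !powRN lef_pV2 ?posrE ?powR_gt0// ge0_ler_powR ?nnegrE ?ler_nat ?ltnS// ltW// (lt_trans _ g1).
  by rewrite lerD2l pow2_78.
rewrite -mulr_sumr mulrCA ler_wpM2l ?invr_ge0 ?(ltW zR)// ler_pM2l//.
rewrite big_split /= -mulr_sumr; apply: lerD.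
  by rewrite ler_wpM2l// sum_powR_tail.
apply: le_trans (sum_geom_tail _ _ _) _; first by apply/andP; split; lra.
rewrite (_ : 1 - 3 / 5 = (5 / 2)^-1 :> R) ?invrK; last by field.
by rewrite mulrC.
Qed.

End near_hitting.

(** * Combination of the three scales of height *)

Section three_scales.
Variables (R : realType) (G : fcgraph) (A V : {set G}) (v hp h n : nat).
Implicit Types (g : G) (z : int).

Definition beyond (m : nat) : pred (cylinder G) := fun x => (m%:Z <= `|x.2|).

Definition outside : pred (cylinder G) := fun x => x.1 \notin A.

Hypothesis hp0 : (0 < hp)%N.
Hypothesis v_hp : (v <= hp./2)%N.
Hypothesis hp_h : (hp <= h)%N.

Local Notation C := (slab V v).
Local Notation hit := (hit_prob R n).

Lemma cyl_adj_height (x y : cylinder G) : lf_adj x y -> `|(`|x.2| - `|y.2|)| <= 1.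
Proof.
case: x y => [g z] [g' z'] /=; rewrite /cyl_adj /=.
move=> /orP[/andP[_ /eqP e]|/andP[/eqP -> _]]; last by rewrite subrr normr0.
by rewrite -e; apply: ler_dist_dist.
Qed.

Let sphere (m : nat) : pred (cylinder G) := fun x => `|x.2| == m%:Z.

(** A step changes the height by at most one, so from beyond height m the slab is reached only
    through the sphere of height m. *)
Let from_sphere D (B : R) (m : nat) x : (v < m)%N -> 0 <= B -> beyond m x ->
  (forall y, sphere m y -> hit C D y <= B) -> hit C D x <= B * hit (sphere m) D x.
Proof.
move=> vm B0 xm HB; apply: le_trans (hit_prob_strong _ B0 HB) _.
rewrite (@hit_prob_eq0 _ _ _ _ _ (beyond m)) ?add0r//.
  move=> [g z]; rewrite /beyond /slab /= => mz; apply/negP => /andP[_ zv]; lia.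
move=> [g z] [g' z']; rewrite /beyond /sphere /= negb_or => mz /andP[_ zm].
move=> /cyl_adj_height /=; move/eqP: zm; lia.
Qed.

Let from_sphere_le D (B : R) (m : nat) x : (v < m)%N -> 0 <= B -> beyond m x ->
  (forall y, sphere m y -> hit C D y <= B) -> hit C D x <= B.
Proof.
move=> vm B0 xm HB; apply: le_trans (from_sphere vm B0 xm HB) _.
by rewrite ler_piMr// hit_prob_le1.
Qed.

Variables (sigma alpha phi : R).
Hypothesis sigma0 : 0 <= sigma.
Hypothesis alpha0 : 0 <= alpha.
Hypothesis phi0 : 0 <= phi.
Hypothesis hit_sigma : forall x, outside x -> hit C (beyond hp.*2) x <= sigma.
Hypothesis hit_alpha : (hp < h)%N -> forall x, sphere hp x -> hit C outside x <= alpha.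
Hypothesis hit_phi : forall x, beyond h.*2 x -> hit C pred0 x <= phi.

Let v_lt m : (hp <= m)%N -> (v < m)%N.
Proof. by move: v_hp hp0; rewrite -divn2; lia. Qed.

Let hit_outside (B : R) x : 0 <= B ->
  (forall y, sphere hp.*2 y -> hit C (beyond h.*2) y <= B) ->
  outside x -> hit C (beyond h.*2) x <= sigma + B.
Proof.
move=> B0 HB xA.
have HB' y : beyond hp.*2 y -> hit C (beyond h.*2) y <= B.
  by move=> yb; apply: from_sphere_le yb HB => //; apply: v_lt; rewrite -addnn leq_addr.
apply: le_trans (hit_prob_strong_le _ B0 HB') _; rewrite lerD2r.
apply: le_trans (hit_sigma xA); apply: hit_prob_sub => // y yb; by rewrite yb orbT.
Qed.

(** Gambler's ruin: the function that is linear between the heights hp and 2 h, and constant below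
    hp, is superharmonic. At 2 hp its value is 1 - hp / (2 h - hp). *)
Let ruin g z : (hp < h)%N -> `|z| = (hp.*2)%:Z ->
  hit (sphere hp) (beyond h.*2) (g, z) <= 1 - hp%:R / (h.*2)%:R.
Proof.
move=> hph zE; pose d : R := (h.*2)%:R - hp%:R.
have d0 : 0 < d by rewrite subr_gt0 ltr_nat -addnn ltn_addl.
pose c (k : nat) : R := if (k <= hp)%N then 1 else if (h.*2 <= k)%N then 0
  else ((h.*2)%:R - k%:R) / d.
have lin k : (hp <= k <= h.*2)%N -> c k = ((h.*2)%:R - k%:R) / d.
  move=> /andP[k1 k2]; rewrite /c; case: leqP => k3.
    by have -> : k = hp; [apply/anti_leq; rewrite k1 k3 | rewrite mulfV// gt_eqF].
  case: leqP => k4 //; have -> : k = h.*2 by apply/anti_leq; rewrite k2 k4.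
  by rewrite subrr mul0r.
have c0 k : 0 <= c k.
  rewrite /c; case: leqP => // k1; case: leqP => // k2.
  by rewrite divr_ge0 ?(ltW d0)// subr_ge0 ler_nat ltnW.
have c1 k : c k <= 1.
  rewrite /c; case: leqP => // k1; case: leqP => // k2.
  by rewrite ler_pdivrMr// mul1r lerD2l lerN2 ler_nat ltnW.
have harm (g' : G) (z' : int) : ~~ beyond h.*2 (g', z') ->
    1 * walk_mean (fun x : cylinder G => c `|x.2|%N) (g', z') <= c `|z'|%N.
  move=> nD; rewrite mul1r cyl_meanE /=.
  have dg : 0 < #|fc_adj g'|%:R + 2 :> R by rewrite ltr_wpDl.
  rewrite sum_fc_cst ler_pdivrMl//.
  suff : c (absz (z' + 1)) + c (absz (z' - 1)) <= 2 * c `|z'|%N by lra.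
  have [zh|hz] := leqP `|z'|%N hp.
    have -> : c `|z'|%N = 1 by rewrite /c zh.
    by have := c1 (absz (z' + 1)); have := c1 (absz (z' - 1)); lra.
  have zb : (`|z'| < h.*2)%N by move: nD; rewrite /beyond /=; lia.
  rewrite !lin; [|lia..].
  rewrite -mulrDl mulrA ler_pM2r ?invr_gt0//.
  have e : (absz (z' + 1))%:R + (absz (z' - 1))%:R = 2 * (`|z'|%N)%:R :> R.
    by rewrite -natrD -natrM; congr (_%:R); lia.
  lra.
have one (g' : G) (z' : int) : sphere hp (g', z') -> 1 <= c `|z'|%N.
  by move=> /eqP/= zz; rewrite (_ : `|z'|%N = hp) /c ?leqnn//; lia.
have H := @hit_prob_supersolution R (cylinder G) 1 n (sphere hp) (beyond h.*2)
  (fun x => c `|x.2|%N) (g, z).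
rewrite expr1n mul1r in H; apply: le_trans (H _ _ _ _) _.
- by rewrite ler01 lexx.
- by move=> y; exact: c0.
- by move=> [g' z']; exact: one.
- by move=> [g' z'] _; exact: harm.
rewrite /= (_ : `|z|%N = hp.*2); last by lia.
rewrite lin; last by move: hph; lia.
have h0 : 0 < (h.*2)%:R :> R by rewrite ltr0n double_gt0; exact: leq_trans hph.
have -> : (h.*2)%:R - (hp.*2)%:R = d - hp%:R :> R by rewrite /d -[hp.*2]addnn natrD; ring.
rewrite mulrBl mulfV ?gt_eqF// lerD2l lerN2 ler_wpM2l//.
by rewrite lef_pV2 ?posrE// /d gerBl.
Qed.

(** Let b be the maximum on the sphere of height 2 hp and p = hp / (2 h). Reaching hp before 2 h has
    probability at most 1 - p. From there the walk hits before leaving A (alpha), or leaves A and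
    hits before height 2 hp (sigma), or is back beyond the sphere (b). So b <= (1 - p) (alpha +
    sigma + b), which is solved for b. *)
Lemma hit_near_sphere x : sphere hp.*2 x ->
  hit C (beyond h.*2) x <= (alpha + sigma) * ((h.*2)%:R / hp%:R).
Proof.
have hpR : 0 < hp%:R :> R by rewrite ltr0n.
have hR : 0 < (h.*2)%:R :> R by rewrite ltr0n double_gt0 (leq_trans hp0).
have as0 : 0 <= (alpha + sigma) * ((h.*2)%:R / hp%:R).
  by rewrite mulr_ge0 ?addr_ge0 ?divr_ge0.
have v2 : (v < hp.*2)%N by apply: v_lt; rewrite -addnn leq_addr.
(* If hp = h the walk is already killed on the sphere of height 2 hp. *)
have [hph|hhp] := ltnP hp h; last first.
  have hE : h = hp by apply/anti_leq; rewrite hp_h hhp.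
  have far (g : G) (z : int) : sphere hp.*2 (g, z) -> hit C (beyond h.*2) (g, z) = 0.
    move=> /eqP/= zE; apply: hit_prob_killed; last by rewrite /beyond /= zE hE.
    rewrite /slab /=; apply/negP => /andP[_ zv]; lia.
  by case: x => g z /far ->.
pose y0 (i : G * bool) : cylinder G := (i.1, if i.2 then (hp.*2)%:Z else - (hp.*2)%:Z).
have [i0 _ imax] := @arg_maxP _ R _ (fc_origin G, true) predT
  (fun i => hit C (beyond h.*2) (y0 i)) isT.
set b := hit C (beyond h.*2) (y0 i0) in imax.
have b0 : 0 <= b by exact: hit_prob_ge0.
have Hb y : sphere hp.*2 y -> hit C (beyond h.*2) y <= b.
  case: y => g z /eqP/= zE; have := imax (g, 0 <= z) isT; rewrite /y0 /=.
  by case: ifP => z0; rewrite -zE; [rewrite ger0_norm | rewrite ler0_norm ?opprK//; lia].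
have Hhp y : sphere hp y -> hit C (beyond h.*2) y <= alpha + (sigma + b).
  move=> ys; apply: le_trans (hit_prob_strong_le (M := outside) _ (addr_ge0 sigma0 b0) _) _.
    by move=> u uo; exact: hit_outside Hb uo.
  rewrite lerD2r; apply: le_trans (hit_alpha hph ys); apply: hit_prob_sub => // u uo.
  by rewrite uo orbT.
move=> xs; apply: le_trans (Hb _ xs) _.
have p1 : hp%:R / (h.*2)%:R <= 1 :> R.
  by rewrite ler_pdivrMr// mul1r ler_nat -addnn (leq_trans hp_h)// leq_addr.
have key : b <= (alpha + (sigma + b)) * (1 - hp%:R / (h.*2)%:R).
  have i0s : `|(y0 i0).2| = (hp.*2)%:Z by rewrite /y0 /=; case: ifP => _; rewrite ?normrN ger0_norm.
  have asb : 0 <= alpha + (sigma + b) by rewrite !addr_ge0.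
  apply: le_trans (from_sphere (v_lt (leqnn hp)) asb _ Hhp) _.
    by rewrite /beyond i0s lez_nat -addnn leq_addr.
  rewrite ler_wpM2l//; exact: ruin.
rewrite -invf_div ler_pdivlMr ?divr_gt0//.
have : 0 <= hp%:R / (h.*2)%:R * (alpha + sigma) by rewrite mulr_ge0 ?divr_ge0 ?addr_ge0.
move: key; move: (hp%:R / _) => p; lra.
Qed.

Lemma hit_from_outside x : outside x ->
  hit C pred0 x <= sigma + (alpha + sigma) * ((h.*2)%:R / hp%:R) + phi.
Proof.
move=> xo; apply: le_trans (hit_prob_strong_le _ phi0 hit_phi) _; rewrite lerD2r.
apply: le_trans (hit_outside _ hit_near_sphere xo).
  by apply: hit_prob_sub.
by rewrite mulr_ge0 ?addr_ge0 ?divr_ge0.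
Qed.

End three_scales.

(** * From windows to the disconnection time *)

Section disconnection_probability.
Variables (R : realType) (G : fcgraph).

Lemma visit_prob_sub (L : lfgraph) n j (W W' D : pred L) x :
  (forall y, W y -> W' y) -> visit_prob R n j W D x <= visit_prob R n j W' D x.
Proof.
move=> WW'; have WWx y : (W y <= W' y)%N by case: (W y) (WW' y) => // ->.
elim: n j x => [|n IH] j x /=; case: ifP => // _; case: ifP => // _.
  by rewrite ler_nat; case: (leqP j (W x)) => // h; rewrite (leq_trans h).
apply: walk_mean_le => y _; apply: le_trans (IH _ _) _.
by apply: visit_prob_anti; rewrite leq_sub2l.
Qed.

Lemma cyl_path_height (x y : cylinder G) s : path (@lf_adj (cylinder G)) x s ->
  y \in x :: s -> `|y.2 - x.2| <= (size s)%:Z.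
Proof.
elim: s x => [|a s IH] x.
  by rewrite inE => _ /eqP ->; rewrite subrr normr0.
move=> /= /andP[xa pth]; rewrite inE => /predU1P[->|]; first by rewrite subrr normr0.
move=> /(IH _ pth) h; apply: le_trans (ler_distD a.2 _ _) _.
rewrite -[(size s).+1]addn1 PoszD lerD// distrC; move: xa.
rewrite /cyl_adj => /orP[/andP[_ /eqP ->//]|/andP[/eqP -> _]].
by rewrite subrr normr0.
Qed.

(** In n steps the height changes by at most n, so a window that contains a visited point has one of
    2 (n + m) + 1 centres. The points of the window in the trace are distinct, hence as many
    visits. *)
Lemma disconnect_prob_le (A V : {set G}) n m l K (q e : R) (x : cylinder G) :
  Defs.connected_subset V -> #|V| = m -> (0 < m)%N -> (0 < l)%N ->
  (4 * (K.+1 * l) <= m)%N -> 0 <= q <= 2^-1 -> 0 <= e ->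
  (forall g z, g \notin A -> hit_prob R n (slab V m) pred0 (g, z) <= q) ->
  (forall y, visit_prob R n l (fun y : cylinder G => y.1 \in V) (outside A) y <= e) ->
  walk_prob R n (fun s => `[< exists k, disconnects [set y | y \in take k s] >]) x <=
  ((n + m).*2.+1)%:R * (2 * e + q ^+ K).
Proof.
move=> cV cardV m0 l0 Klm q01 e0 Hhit Hvis.
pose u (i : nat) : int := x.2 + (i%:Z - (n + m)%N%:Z).
pose Q s := has (fun i => (K.+1 * l <= count (window V m (u i)) s)%N) (iota 0 (n + m).*2.+1).
apply: (@le_trans _ _ (walk_prob R n Q x)).
  apply: walk_prob_le => s sn pth /asboolP[k dS].
  have [u0 [T [mT HT]]] := disconnects_window dS cV cardV m0.
  pose f (y : G * 'I_(m.*2.+1)) : cylinder G := (y.1, u0 - m%:Z + (y.2 : nat)%:Z).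
  have fT y : y \in T -> f y \in x :: s /\ window V m u0 (f y).
    move=> /HT[yV]; rewrite /= => /mem_take ys; split => //.
    by rewrite /window /= yV /=; move: (y.2 : nat) (ltn_ord y.2) => b; lia.
  have f_inj : injective f.
    move=> [g i] [g' j] [-> /addrI [ij]]; congr pair; exact/val_inj.
  have Tcount : (#|T| <= count (window V m u0) (x :: s))%N.
    rewrite cardE -(size_map f) -size_filter; apply: uniq_leq_size.
      by rewrite map_inj_uniq ?enum_uniq.
    move=> y /mapP[t]; rewrite mem_enum => /fT[ts tw] ->.
    by rewrite mem_filter tw.
  have /card_gt0P[t tT] : (0 < #|T|)%N by move: mT m0; case: (#|T|) => //; lia.
  have [ts tw] := fT _ tT; have := cyl_path_height pth ts; rewrite sn => tn.
  apply/hasP; exists (absz (u0 - x.2 + (n + m)%N%:Z)); first last.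
    have -> : u (absz (u0 - x.2 + (n + m)%N%:Z)) = u0.
      by rewrite /u; move: tw tn; rewrite /window /f /= => /andP[_]; lia.
    by apply: leq_trans Tcount; rewrite -(leq_pmul2l (isT : 0 < 4)%N) (leq_trans Klm).
  rewrite mem_iota; move: tw tn; rewrite /window /f /= => /andP[_]; lia.
apply: le_trans (walk_prob_has R (iota 0 (n + m).*2.+1) n
  (fun i s => (K.+1 * l <= count (window V m (u i)) s)%N) x) _.
rewrite mulr_natl -[(n + m).*2.+1 in leRHS]subn0 -sumr_const_nat.
rewrite /index_iota subn0; apply: ler_sum => i _; rewrite -visit_probE.
apply: (@visit_prob_ladder _ _ _ _ _ _ (outside A)) => //.
  move=> y; apply: le_trans (Hvis y); apply: visit_prob_sub => z.
  by rewrite /window => /andP[].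
move=> [g z] gA; have := Hhit g (z - u i) gA.
rewrite -(hit_prob_comp (cyl_mean_shift (- u i)) n (slab V m) pred0 (g, z)) /=.
move=> h; apply: le_trans h; apply: hit_prob_sub => // -[g' z'].
by rewrite /window /slab /= => /andP[-> /=] ; lia.
Qed.

End disconnection_probability.

Section disconnection_law.
Variables (R : realType) (G : fcgraph).

(** Quantifying over the prefixes makes the property monotone in time by definition. *)
Definition disconnecting (s : seq (cylinder G)) : bool :=
  `[< exists k, disconnects [set y | y \in take k s] >].

Lemma disconnection_law_le (t : R) (x : cylinder G) : 0 <= t ->
  (srw_law R x [set X | (disconnection_time R X <= t%:E)%E] <=
   (walk_prob R (Num.truncn t) disconnecting x)%:E)%E.
Proof.
move=> t0; set n := Num.truncn t.
pose Q (s : seq (cylinder G)) : bool :=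
  `[< exists2 k, (k <= n)%N & disconnects [set y | y \in take k.+1 s] >].
rewrite [X in srw_law R x X](_ : _ = [set X | Q (mkseq X n.+1)]); last first.
  have E (X : nat -> cylinder G) k : (k <= n)%N ->
      [set y | y \in take k.+1 (mkseq X n.+1)] = [set X i | i in [set i | (i <= k)%N]].
    move=> kn; rewrite /mkseq -map_take take_iota (minn_idPl _) ?ltnS//.
    apply/seteqP; split => y.
      by move=> /mapP[i]; rewrite mem_iota => /= ik ->; exists i.
    by move=> [i ik <-]; apply: map_f; rewrite mem_iota.
  have kE k : (k%:R <= t) = (k <= n)%N by rewrite /n truncn_ge_nat.
  apply/seteqP; split => X.
    move=> /first_time_le[k dk kt]; have kn : (k <= n)%N by rewrite -kE.
    by apply/asboolP; exists k => //; rewrite E.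
  move=> /asboolP[k kn dk]; apply/first_time_le; exists k; last by rewrite kE.
  by move: dk; rewrite E.
rewrite srw_law_path_event lee_fin; apply: walk_prob_le => s _ _ /asboolP[k _ dk].
by apply/asboolP; exists k.+1.
Qed.

Lemma disconnecting_prob_small_gap n (x : cylinder G) (e : R) : 0 < e ->
  walk_prob R n disconnecting x <= 2 * (n%:R * spectral_gap G R) + e.
Proof.
move=> e0; have n1 : 0 < 2 * n.+1%:R :> R by rewrite mulr_gt0.
have [g [g' H]] := @cover_two_fibres R G (e / (2 * n.+1%:R)) (divr_gt0 e0 n1).
apply: le_trans (le_trans _ (H n x)) _.
  apply: walk_prob_le => s _ _ /asboolP[k dk].
  have fib a : has (fibre a) (x :: s).
    have [z] := disconnects_fibre a dk; move=> /mem_take zs.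
    by apply/hasP; exists (a, z) => //; rewrite /fibre /= eqxx.
  by rewrite !fib.
rewrite mulrDr mulrDr lerD2l.
have -> : 2 * (n%:R * (e / (2 * n.+1%:R))) = e * (n%:R / n.+1%:R).
  by field; rewrite ?pnatr_eq0.
by rewrite ler_piMr ?(ltW e0)// ler_pdivrMr ?ltr0n// mul1r ler_nat.
Qed.

End disconnection_law.

(** * Estimates for large graphs *)

Section regime.
Variables (R : realType).

Lemma powR_eventually (C a : R) : 0 < a -> exists N0 : nat, forall N : nat,
  (N0 <= N)%N -> C <= N%:R `^ a.
Proof.
move=> a0; pose c := Num.max C 1.
have c0 : 0 < c by rewrite lt_max ltr01 orbT.
exists (Num.truncn (c `^ a^-1)).+1 => N hN.
have cN : c `^ a^-1 <= N%:R.
  apply: ltW; apply: lt_le_trans (truncnS_gt _) _; by rewrite ler_nat.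
apply: (@le_trans _ _ c); first by rewrite le_max lexx.
have -> : c = (c `^ a^-1) `^ a.
  by rewrite -powRrM mulVf ?gt_eqF// powRr1// ltW.
by apply: ge0_ler_powR; rewrite ?nnegrE ?powR_ge0 ?(ltW a0).
Qed.

Lemma ln_le_powR (x a : R) : 0 < x -> 0 < a -> ln x <= a^-1 * x `^ a.
Proof.
move=> x0 a0; rewrite ler_pdivlMl// -ln_powR.
have xa : 0 < x `^ a by rewrite powR_gt0.
apply: le_trans (_ : x `^ a - 1 <= _); last by rewrite gerBl.
have h : -1 < x `^ a - 1 by lra.
by have := le_ln1Dx h; rewrite addrC subrK.
Qed.

(* [N] is so large that constants and powers of [ln N] are absorbed by [N ^ e]. *)
Definition large (C e N : R) : Prop :=
  [/\ 1 < N, C <= ln N & C * ln N ^+ 8 <= N `^ e].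

Lemma large_eventually (C e : R) : 0 < e -> exists N0 : nat, forall N : nat,
  (N0 <= N)%N -> large C e N%:R.
Proof.
(* Eight logarithms, each bounded by a multiple of N^(e/16), use up half of the exponent; the other
   half absorbs the constants. *)
move=> e0; pose a := e / 16; have a0 : 0 < a by rewrite divr_gt0.
have e20 : 0 < e / 2 by rewrite divr_gt0.
pose c := Num.max C 1; have c1 : 1 <= c by rewrite le_max lexx orbT.
have c0 : 0 < c by exact: lt_le_trans c1.
have [N1 H1] := powR_eventually (c * a^-1 ^+ 8) e20.
exists (maxn N1 (maxn 2 (Num.truncn (expR C)).+1)) => N.
rewrite !geq_max => /and3P[hN1 hN2 hN3].
have N1' : 1 < N%:R :> R by rewrite ltr1n.
have N0 : 0 < N%:R :> R by exact: lt_trans N1'.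
split => //.
  rewrite -[C]expRK ler_ln ?posrE ?expR_gt0//; apply: ltW.
  by apply: lt_le_trans (truncnS_gt _) _; rewrite ler_nat.
have l0 : 0 <= ln (N%:R : R) by rewrite ln_ge0// ltW.
apply: (@le_trans _ _ (c * (a^-1 * N%:R `^ a) ^+ 8)).
  apply: (@le_trans _ _ (c * ln N%:R ^+ 8)).
    by rewrite ler_wpM2r ?exprn_ge0// le_max lexx.
  rewrite ler_wpM2l ?(ltW c0)// lerXn2r ?nnegrE ?mulr_ge0 ?powR_ge0 ?invr_ge0 ?(ltW a0)//.
  exact: ln_le_powR.
have -> : N%:R `^ e = N%:R `^ (e / 2) * N%:R `^ (e / 2) :> R.
  by rewrite -powRD ?(gt_eqF N0) ?implybT//; congr (_ `^ _); lra.
rewrite exprMn mulrA; apply: ler_pM; rewrite ?mulr_ge0 ?exprn_ge0 ?invr_ge0 ?powR_ge0 ?(ltW a0) ?(ltW c0)//.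
  exact: H1.
rewrite -powR_mulrn ?powR_ge0// -powRrM le_eqVlt; apply/orP; left; apply/eqP.
by congr (_ `^ _); rewrite /a; lra.
Qed.

End regime.

Section large_powers.
Variables (R : realType) (C eps N : R).
Hypothesis C1 : 1 <= C.
Hypothesis large_N : large C eps N.
Local Notation P x := (N `^ x).

Lemma large_gt0 : 0 < N. Proof. by case: large_N => N1 _ _; exact: lt_trans N1. Qed.

Lemma largeD (x y : R) : P x * P y = P (x + y).
Proof. by rewrite powRD// (gt_eqF large_gt0) implybT. Qed.

Lemma large_gt0P (x : R) : 0 < P x. Proof. by rewrite powR_gt0// large_gt0. Qed.

Lemma large_le (x y : R) : x <= y -> P x <= P y.
Proof. by case: large_N => N1 _ _ xy; rewrite ler_powR// ltW. Qed.

Lemma large_ln : 1 <= ln N. Proof. by case: large_N => _ CN _; exact: le_trans CN. Qed.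

Lemma large_expR (x : R) : P x = expR (x * ln N).
Proof. by rewrite /powR gt_eqF// large_gt0. Qed.

Lemma large_lnX (c : R) k : 0 <= c <= C -> (k <= 8)%N -> c * ln N ^+ k <= P eps.
Proof.
move=> /andP[c0 cC] k8; case: large_N => _ _; apply: le_trans.
have l1 := large_ln; apply: ler_pM => //; first by rewrite exprn_ge0// (le_trans ler01).
by rewrite ler_weXn2l.
Qed.

(** The way constants disappear from the estimates: each costs one factor N^eps. *)
Lemma large_const (c x : R) : c <= C -> c * P x <= P (x + eps).
Proof.
move=> cC; rewrite -largeD mulrC ler_wpM2l ?(ltW (large_gt0P _))//.
apply: le_trans cC _; have := @large_lnX C 0 _ isT; rewrite expr0 mulr1; apply.
by rewrite lexx (le_trans ler01).
Qed.

End large_powers.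

Lemma inv_pow_le_expR (R : realType) (s S X : R) (h : nat) : 0 <= s <= S ->
  X <= h%:R * s -> (1 + s) ^- h <= expR (- (X / (1 + S))).
Proof.
move=> /andP[s0 sS] Xh; have s1 : 0 < 1 + s by rewrite ltr_pwDl.
have S1 : 0 < 1 + S by rewrite ltr_pwDl// (le_trans s0).
have e1 : (1 + s)^-1 <= expR (- (s / (1 + s))).
  apply: le_trans (expR_ge1Dx _); rewrite -(ler_pM2r s1) mulVf ?gt_eqF//.
  by rewrite mulrDl mulNr divfK ?gt_eqF//; lra.
have e2 : (1 + s)^-1 <= expR (- (s / (1 + S))).
  apply: le_trans e1 _; rewrite ler_expR lerN2 ler_wpM2l// lef_pV2 ?posrE//; lra.
rewrite -exprVn; apply: (@le_trans _ _ (expR (- (s / (1 + S))) ^+ h)).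
  by rewrite lerXn2r ?nnegrE ?invr_ge0 ?expR_ge0 ?(ltW s1).
by rewrite -expRM_natl ler_expR mulrN lerN2 mulrA ler_wpM2r ?invr_ge0 ?(ltW S1)//.
Qed.

Lemma absz_beyond (h v : nat) (z w : int) : (v <= h)%N -> (h.*2)%:Z <= `|z| ->
  `|w| <= v%:Z -> (h <= absz (z + w)%R)%N.
Proof. lia. Qed.

(** * Exponents for returns from large and from moderate heights *)

Section far_estimate.
Variables (R : realType) (G : fcgraph) (d0 : nat) (C eps delta : R).
Local Notation N := (#|G|%:R : R).
Local Notation P x := (N `^ x).
Local Notation lambda := (spectral_gap G R).
Hypothesis large_N : large C eps N.
Hypothesis C_ge : 1000 * (d0.+1%:R) ^+ 2 <= C.
Hypothesis eps01 : 0 < eps <= 1.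
Hypothesis delta0 : 0 < delta < 1 / 2.
Hypothesis deg_le : (max_deg G <= d0)%N.
Variables (V : {set G}) (v h n : nat).
Hypothesis n_le : n%:R <= P (2 * (1 - delta)).
Hypothesis n_ge : P (2 * (1 - delta)) <= n.+1%:R.
Hypothesis V_le : #|V|%:R <= P (delta / 8).
Hypothesis V0 : (0 < #|V|)%N.
Hypothesis vV : (v <= #|V|)%N.
Hypothesis v_h : (v <= h)%N.
Hypothesis h_ge : 2 * ln N ^+ 2 <= h%:R * Num.sqrt lambda.

Let C1 : 1 <= C.
Proof.
apply: le_trans C_ge; have : 1 <= d0.+1%:R :> R by rewrite ler1n.
move: (d0.+1%:R) => x x1; nra.
Qed.

Let d1 : 1 <= d0.+1%:R :> R. Proof. by rewrite ler1n. Qed.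

Let PD := largeD large_N.
Let Ple := large_le large_N.
Let Pgt0 := large_gt0P large_N.
Let Pc := large_const C1 large_N.

Let cC (c : R) : c <= 1000 * d0.+1%:R -> c <= C.
Proof. by move=> h1; apply: le_trans h1 (le_trans _ C_ge); have := d1; nra. Qed.

Lemma sqrt_gap_le : 0 <= Num.sqrt lambda <= 2 * d0.+1%:R.
Proof.
rewrite sqrtr_ge0 /= -(@ler_pXn2r _ 2) ?nnegrE ?sqrtr_ge0 ?mulr_ge0//.
rewrite sqr_sqrtr ?spectral_gap_ge0//; apply: le_trans (spectral_gap_ub R G) _.
have : (max_deg G)%:R <= d0.+1%:R :> R by rewrite ler_nat (leq_trans deg_le).
have := d1; nra.
Qed.

(** The main term |V| / N times sqrt n has exponent delta/8 - 1 + (1 - delta) = - 7 delta/8, and the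
    2 v + 1 slices cost another delta/8. *)
Lemma hit_slab_far (g : G) (z : int) : beyond h.*2 (g, z) ->
  hit_prob R n (slab V v) pred0 (g, z) <= P (- (6 * delta / 8) + 3 * eps).
Proof.
move=> xh; have /andP[e0 e1] := eps01; have /andP[dl0 dl1] := delta0.
pose d : R := (max_deg G)%:R.
have dd0 : d <= d0.+1%:R by rewrite ler_nat (leq_trans deg_le).
have dge1 : 1 <= d by rewrite ler1n max_deg_gt0.
have n1 : 0 < n.+1%:R :> R by [].
set k := (2 * d + 2)^-1 / (2 * n.+1%:R).
have kV : k^-1 = (2 * d + 2) * (2 * n.+1%:R).
  by rewrite /k invfM !invrK mulrC.
have Vk : k <= P (- (2 * (1 - delta))).
  rewrite powRN -[k]invrK lef_pV2 ?posrE ?Pgt0 ?kV ?mulr_gt0//; last by lra.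
  apply: le_trans n_ge _; rewrite -[leLHS]mul1r; apply: ler_pM => //; lra.
have n2 : n.+1%:R <= 2 * P (2 * (1 - delta)).
  have : P 0 <= P (2 * (1 - delta)) by apply: Ple; lra.
  by rewrite powRr0 -natr1; move: n_le; lra.
have kV3 : k^-1 <= P 3.
  rewrite kV; apply: (@le_trans _ _ (16 * d0.+1%:R * P (2 * (1 - delta)))).
    have p0 := Pgt0 (2 * (1 - delta)); have h1 : 2 * d + 2 <= 4 * d0.+1%:R by lra.
    apply: (@le_trans _ _ (4 * d0.+1%:R * (4 * P (2 * (1 - delta))))).
      by apply: ler_pM => //; lra.
    lra.
  apply: le_trans (Pc _ _) (Ple _); first by apply: cC; have := d1; lra.
  lra.
pose T := (Num.truncn (k^-1 ^+ 3)).+1.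
have kT : k^-1 ^+ 3 <= T%:R by apply: ltW; exact: truncnS_gt.
have TP : T%:R <= P 10.
  have k0 : 0 <= k^-1 ^+ 3 by rewrite exprn_ge0// kV mulr_ge0 ?mulr_ge0//; lra.
  have : T%:R <= k^-1 ^+ 3 + 1.
    rewrite /T -natr1 lerD2r; by rewrite truncn_le.
  have k9 : k^-1 ^+ 3 <= P 9.
    apply: (@le_trans _ _ (P 3 ^+ 3)).
      rewrite lerXn2r ?nnegrE ?(ltW (Pgt0 _))// kV mulr_ge0 ?mulr_ge0//; lra.
    by rewrite -powR_mulrn ?(ltW (Pgt0 _))// -powRrM le_eqVlt (_ : 3 * 3%:R = 9) ?eqxx//; lra.
  have : P 0 <= P 9 by apply: Ple; lra.
  have : 2 * P 9 <= P 10.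
    apply: le_trans (Pc _ _) (Ple _); first by apply: cC; have := d1; lra.
    lra.
  rewrite powRr0; lra.
pose f : R := P (- 20).
have slice_le (w : int) : `|w| <= v%:Z ->
    hit_prob R n (slice V) pred0 (g, z + w) <= 6 * P (- (7 * delta / 8) + eps).
  move=> wv.
  (* As h sqrt lambda >= 2 (ln N)^2, the decay is exp (- c (ln N)^2), below N^(-41) once ln N
     exceeds a constant; f = N^(-20) is then small even after multiplication by T <= N^10. *)
  have fz : N * (1 + Num.sqrt lambda) ^- (absz (z + w)%R) <= f ^+ 2.
    have hz := absz_beyond v_h xh wv.
    have X : 2 * ln N ^+ 2 <= ((absz (z + w)%R))%:R * Num.sqrt lambda.
      by apply: le_trans h_ge _; rewrite ler_wpM2r ?sqrtr_ge0// ler_nat.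
    have := inv_pow_le_expR sqrt_gap_le X; move=> h1.
    rewrite -[N in N * _]powRr1 ?ler0n//.
    apply: le_trans (ler_wpM2l (ltW (Pgt0 _)) h1) _.
    have -> : f ^+ 2 = P 1 * P (- 41).
      by rewrite PD /f expr2 PD; congr (_ `^ _); lra.
    rewrite ler_pM2l ?Pgt0// (large_expR large_N) ler_expR.
    have l1 := large_ln C1 large_N; have [_ Cl _] := large_N.
    rewrite mulNr lerN2 ler_pdivlMr; last by have := d1; lra.
    have : 41 * (1 + 2 * d0.+1%:R) <= ln N by apply: le_trans Cl; apply: cC; have := d1; lra.
    nra.
  have := @hit_slice_far R G n T V f (g, z + w) (ltW (Pgt0 _)) fz kT.
  move=> H; apply: le_trans H _; rewrite -/d -/k.
  have t1 : #|V|%:R / N * ((2 * d + 2)^-1 * Num.sqrt k)^-1 <= P (- (7 * delta / 8) + eps).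
    have sq : (Num.sqrt k)^-1 <= 8 * d0.+1%:R * P (1 - delta).
      rewrite -sqrtrV ?invr_ge0; last first.
        by rewrite -[k]invrK invr_ge0 kV mulr_ge0 ?mulr_ge0//; lra.
      rewrite -(@ler_pXn2r _ 2) ?nnegrE ?sqrtr_ge0 ?mulr_ge0 ?(ltW (Pgt0 _))//.
      rewrite sqr_sqrtr ?kV; last by rewrite mulr_ge0 ?mulr_ge0//; lra.
      rewrite exprMn -[P _ ^+ 2]powR_mulrn ?(ltW (Pgt0 _))// -powRrM.
      have -> : (1 - delta) * 2%:R = 2 * (1 - delta) by lra.
      have p0 := Pgt0 (2 * (1 - delta)); have h1 : 2 * d + 2 <= 4 * d0.+1%:R by lra.
      apply: (@le_trans _ _ (4 * d0.+1%:R * (4 * P (2 * (1 - delta))))).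
        by apply: ler_pM => //; lra.
      have := d1; move: (P _) (d0.+1%:R) p0 => p y p0 y1.
      have q1 : 0 <= y * (y - 1) * p by rewrite mulr_ge0 ?mulr_ge0//; lra.
      have q2 : 0 <= y ^+ 2 * p by rewrite mulr_ge0 ?sqr_ge0//; lra.
      lra.
    rewrite invfM invrK mulrA; apply: (@le_trans _ _ (P (delta / 8) * P (- 1) * (4 * d0.+1%:R) *
        (8 * d0.+1%:R * P (1 - delta)))).
      have a1 : 0 <= (Num.sqrt k)^-1 by rewrite invr_ge0 sqrtr_ge0.
      have a2 : 0 <= #|V|%:R / N by rewrite mulr_ge0 ?invr_ge0.
      have a3 : 0 <= 2 * d + 2 by lra.
      have a4 : #|V|%:R / N <= P (delta / 8) * P (- 1).
        by rewrite powR_inv1 ?ler0n// ler_wpM2r ?invr_ge0.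
      have a5 : 2 * d + 2 <= 4 * d0.+1%:R by lra.
      exact: (ler_pM (mulr_ge0 a2 a3) a1 (ler_pM a2 a3 a4 a5) sq).
    have -> : P (delta / 8) * P (- 1) * (4 * d0.+1%:R) * (8 * d0.+1%:R * P (1 - delta)) =
        (32 * d0.+1%:R ^+ 2) * (P (delta / 8) * P (- 1) * P (1 - delta)) by ring.
    rewrite !PD; apply: le_trans (Pc _ _) (Ple _); last by lra.
    by apply: le_trans C_ge; rewrite ler_wpM2r ?exprn_ge0//; lra.
  have t2 : T%:R * f <= P (- (7 * delta / 8) + eps).
    apply: le_trans (ler_wpM2r (ltW (Pgt0 _)) TP) _; rewrite /f PD; apply: Ple; lra.
  have t3 : k <= P (- (7 * delta / 8) + eps) by apply: le_trans Vk (Ple _); lra.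
  lra.
have := @hit_slab_le R G n V v pred0 _ g z slice_le => h1; apply: le_trans h1 _.
have v3 : v.*2.+1%:R <= 3 * P (delta / 8).
  have : v.*2.+1%:R <= 3 * #|V|%:R :> R by rewrite -natrM ler_nat -addnn -addn1 !mulSn mul0n addn0 addnC leq_add// leq_add.
  by move: V_le; lra.
have p0 := Pgt0 (- (7 * delta / 8) + eps).
apply: (@le_trans _ _ (3 * P (delta / 8) * (6 * P (- (7 * delta / 8) + eps)))).
  by rewrite ler_wpM2r// mulr_ge0// ltW.
have -> : 3 * P (delta / 8) * (6 * P (- (7 * delta / 8) + eps)) =
  18 * (P (delta / 8) * P (- (7 * delta / 8) + eps)) by ring.
rewrite PD; apply: le_trans (Pc _ _) (Ple _); last by lra.
by apply: cC; have := d1; lra.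
Qed.

End far_estimate.

Section near_estimate.
Variables (R : realType) (G : fcgraph) (C eps delta gamma B : R).
Local Notation N := (#|G|%:R : R).
Local Notation P x := (N `^ x).
Hypothesis large_N : large C eps N.
Hypothesis C_ge : 50 * 50 <= C.
Hypothesis eps0 : 0 < eps.
Hypothesis gamma1 : 1 < gamma.
Variables (A V : {set G}) (hp n : nat).
Hypothesis n_ge : P (2 * (1 - delta)) <= n.+1%:R.
Hypothesis VA : V \subset A.
Hypothesis B0 : 0 <= B.
Hypothesis kernel : forall k x,
  @killed R (fin_graph G) k (fun y : G => y \notin A) (fun y => (y \in V)%:R) x <=
  B * k.+1%:R `^ (- gamma).
Hypothesis hp_ge : P (3 * eps) <= hp%:R.
Hypothesis hp_le : hp%:R <= P 2.

Let C1 : 1 <= C. Proof. by have := C_ge; lra. Qed.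
Let PD := largeD large_N.
Let Ple := large_le large_N.
Let Pgt0 := large_gt0P large_N.
Let ln1 := large_ln C1 large_N.

Let N2500 : 50 * 50 <= N.
Proof.
have [N1 CN _] := large_N; apply: le_trans C_ge (le_trans CN (ltW _)).
exact: ln_sublinear (lt_trans ltr01 N1).
Qed.

(** The split time is slightly subdiffusive, of order (hp / N^eps)^2. The tail of the kernel after
    it has order hp^(2 (1 - gamma)) up to N^eps factors, and division by the height gives hp^(1 - 2
    gamma). *)
Lemma hit_slice_near_large (g : G) (z : int) : (hp <= 2 * absz z)%N ->
  hit_prob R n (slice V) (outside A) (g, z) <=
  P (- 20) + P (- (2 * (1 - delta))) +
  40 * (B * ((gamma - 1)^-1 * (20 `^ (gamma - 1) * P (2 * eps * (gamma - 1))))) *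
  hp%:R `^ (1 - 2 * gamma).
Proof.
move=> hpz; have e0 := eps0; have g1 := gamma1; have Cge := C_ge; have l1 := ln1.
have q0 : 0 < gamma - 1 by rewrite subr_gt0.
have hp0 : 0 < hp%:R :> R := lt_le_trans (Pgt0 _) hp_ge.
have zR : hp%:R <= 2 * (absz z)%:R :> R by rewrite -natrM ler_nat.
have z0R : 0 < (absz z)%:R :> R by lra.
have zz : 0 < `|z| by rewrite normr_gt0; apply/eqP => z0; rewrite z0 ltxx in z0R.
have lnP (c : R) : 0 <= c <= C -> c * ln N <= P eps.
  by move=> cC; have := @large_lnX R C eps N C1 large_N c 1; rewrite expr1; apply.
have Pe1 : 50 <= P eps.
  have h1 : 50 * 1 <= 50 * ln N by rewrite ler_pM2l.
  have h2 : 50 * ln N <= P eps by apply: lnP; apply/andP; split; have := C_ge; lra.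
  lra.
have P2e : P eps <= P (2 * eps) by apply: Ple; lra.
have [s [r [sE rE s0 r0 sr]]] : exists s r : R, [/\ s = P eps / hp%:R,
    r = hp%:R / P eps, 0 < s, 0 < r & s * r = 1].
  exists (P eps / hp%:R), (hp%:R / P eps); split; rewrite ?divr_gt0//.
  by rewrite mulrA divfK ?mulfV// gt_eqF.
have rge : P (2 * eps) <= r.
  rewrite rE ler_pdivlMr// PD; apply: le_trans (_ : P (3 * eps) <= _) => //.
  by apply: Ple; lra.
have r1 : 1 <= r by apply: le_trans rge; lra.
have s1 : s <= 1 by rewrite -sr ler_peMr// ltW.
have sV2 : P eps <= r ^+ 2.
  by apply: le_trans P2e (le_trans rge _); rewrite expr2 ler_peMr// ltW.
(* Then 10 J s^2 <= 1, which bounds the growth factor by e, while |z| s >= N^eps / 2 makes (1 +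
   s)^(-|z|) smaller than the required power. *)
pose y : R := r ^+ 2 / 10; pose J := Num.truncn y.
have y1 : 1 <= y by rewrite /y; lra.
have y0 : 0 <= y by lra.
have J0 : (0 < J)%N by rewrite truncn_gt0.
have Jy : J%:R <= y by rewrite truncn_le.
have yJ : y <= 2 * J%:R.
  have : y < J%:R + 1 by rewrite natr1; exact: truncnS_gt.
  have : 1 <= J%:R :> R by rewrite ler1n.
  lra.
have ss : s ^+ 2 * r ^+ 2 = 1 by rewrite -exprMn sr expr1n.
have Js : (J * 10)%:R * s ^+ 2 <= 1.
  rewrite natrM; have : J%:R * 10 <= r ^+ 2 by move: Jy; rewrite /y; lra.
  by move=> h; rewrite -[leRHS]ss mulrC ler_wpM2l// sqr_ge0.
have JP : J%:R <= P 4.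
  apply: le_trans Jy _; have rP : r <= P 2.
    rewrite rE; apply: le_trans hp_le; rewrite ler_pdivrMr// ler_peMr ?(ltW hp0)//; lra.
  have -> : P 4 = P 2 * P 2 by rewrite PD; congr (_ `^ _); ring.
  have : r * r <= P 2 * P 2 by apply: ler_pM => //; exact: ltW.
  have : 0 <= r * r by rewrite mulr_ge0 ?ltW.
  by rewrite /y expr2; lra.
pose e : R := P (- 44).
have He : (1 + s ^+ 2) ^+ (J * 10) * (1 + s) ^- (absz z) <= e.
  have h1 : (1 + s ^+ 2) ^+ (J * 10) <= P 1.
    apply: (@le_trans _ _ (expR (s ^+ 2) ^+ (J * 10))).
      by rewrite lerXn2r ?nnegrE ?expR_ge0 ?addr_ge0 ?sqr_ge0// expR_ge1Dx.
    rewrite -expRM_natl (large_expR large_N) ler_expR mul1r.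
    exact: le_trans Js ln1.
  have X : P eps / 2 <= (absz z)%:R * s.
    have -> : P eps / 2 = s * (hp%:R / 2) by rewrite sE; field; rewrite gt_eqF.
    by rewrite [leRHS]mulrC ler_wpM2l ?(ltW s0)//; lra.
  have h2 : (1 + s) ^- (absz z) <= P (- 45).
    have s01 : 0 <= s <= 1 by rewrite (ltW s0).
    apply: le_trans (inv_pow_le_expR s01 X) _.
    rewrite (large_expR large_N (- 45)) ler_expR mulNr lerN2.
    have h : 180 * ln N <= P eps.
      by apply: lnP; rewrite ler0n (le_trans _ C_ge)// -natrM ler_nat.
    have -> : P eps / 2 / (1 + 1) = P eps / 4 by field.
    lra.
  have -> : e = P 1 * P (- 45) by rewrite PD /e; congr (_ `^ _); ring.
  apply: ler_pM => //; first by rewrite exprn_ge0// addr_ge0 ?sqr_ge0.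
  by rewrite invr_ge0 exprn_ge0// addr_ge0// ltW.
have J35 : (3 / 5 : R) ^+ J <= P (- 45).
  apply: (@le_trans _ _ (expR (- (2 / 5)) ^+ J)).
    have h1 : 1 + - (2 / 5) <= expR (- (2 / 5) : R) := expR_ge1Dx _.
    by rewrite lerXn2r ?nnegrE ?expR_ge0//; lra.
  rewrite -expRM_natl (large_expR large_N) ler_expR mulNr mulrN lerN2.
  have h : 50 * 45 * ln N <= P eps.
    by apply: lnP; rewrite mulr_ge0 ?ler0n// (le_trans _ C_ge)// ler_pM2l// ler_nat.
  by move: yJ sV2; rewrite /y; lra.
have DV x : x \notin A -> x \notin V by apply: contra; exact: (fintype.subsetP VA).
have := @hit_slice_near R G (fun x => x \notin A) V n B gamma s e J g z gamma1 B0 DV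
  kernel J0 zz (ltW s0) He.
move=> H; apply: le_trans H _.
have zi : `|z|%:~R = (absz z)%:R :> R by rewrite -natr_absz.
rewrite zi.
have Jg : J%:R `^ (1 - gamma) <= 20 `^ (gamma - 1) *
    (P (2 * eps * (gamma - 1)) * hp%:R `^ (- (2 * (gamma - 1)))).
  have -> : 1 - gamma = - (gamma - 1) by rewrite opprB.
  have y20 : 0 < r ^+ 2 / 20 by rewrite divr_gt0// exprn_gt0.
  apply: (@le_trans _ _ ((r ^+ 2 / 20) `^ (- (gamma - 1)))).
    rewrite !powRN lef_pV2 ?posrE ?powR_gt0 ?ltr0n//.
    rewrite ge0_ler_powR ?nnegrE ?(ltW q0) ?(ltW y20)//.
    by move: yJ; rewrite /y; lra.
  have -> : r ^+ 2 / 20 = (20 * (s ^+ 2))^-1.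
    have -> : r = s^-1 by rewrite -[s^-1]mulr1 -sr mulrA mulVf ?mul1r// gt_eqF.
    by rewrite invfM mulrC exprVn.
  have a0 : 0 <= 20 * s ^+ 2 by apply: mulr_ge0; rewrite ?sqr_ge0 ?ler0n.
  rewrite -(powR_inv1 a0) -powRrM mulN1r opprK.
  rewrite powRM ?sqr_ge0// ler_wpM2l ?powR_ge0//.
  rewrite -powR_mulrn ?(ltW s0)// -powRrM sE powRM ?(ltW (Pgt0 _)) ?invr_ge0//.
  rewrite -[(hp%:R)^-1]powR_inv1 ?ler0n// -!powRrM le_eqVlt; apply/orP; left; apply/eqP.
  by congr (_ `^ _ * _ `^ _); ring.
have zV : (absz z)%:R^-1 <= 2 * hp%:R^-1 :> R.
  have -> : 2 * hp%:R^-1 = (hp%:R / 2)^-1 :> R by rewrite invf_div.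
  rewrite lef_pV2 ?posrE ?divr_gt0//; lra.
have hpV : hp%:R^-1 <= 1 :> R.
  rewrite invf_le1//; have : P 0 <= P (3 * eps) by apply: Ple; rewrite mulr_ge0 ?(ltW e0).
  by rewrite powRr0 => h; exact: le_trans h hp_ge.
have hpV0 : 0 < hp%:R^-1 :> R by rewrite invr_gt0.
set main := B * _; set j35 := (3 / 5) ^+ J in J35 *.
have j0 : 0 <= j35 by rewrite exprn_ge0//; lra.
have main0 : 0 <= main by rewrite !mulr_ge0 ?powR_ge0// invr_ge0 ltW.
set X := 10 * (main + 5 / 2 * j35).
have X0 : 0 <= X.
  apply: mulr_ge0; first exact: ler0n.
  by apply: addr_ge0 main0 (mulr_ge0 _ j0); apply: divr_ge0; exact: ler0n.
have h1 : (absz z)%:R^-1 * X <= 20 * (hp%:R^-1 * main) + 50 * j35.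
  apply: le_trans (ler_wpM2r X0 zV) _.
  have : hp%:R^-1 * j35 <= j35 by rewrite ler_piMl.
  rewrite /X; lra.
have h2 : hp%:R^-1 * main <= (B * ((gamma - 1)^-1 * (20 `^ (gamma - 1) *
    P (2 * eps * (gamma - 1))))) * hp%:R `^ (1 - 2 * gamma).
  have -> : hp%:R `^ (1 - 2 * gamma) = hp%:R^-1 * hp%:R `^ (- (2 * (gamma - 1))) :> R.
    rewrite -powR_inv1 ?ler0n// -powRD ?(gt_eqF hp0) ?implybT//.
    by congr (_ `^ _); ring.
  rewrite /main [leRHS]mulrCA ler_pM2l//.
  rewrite [leRHS](_ : _ = B * ((gamma - 1)^-1 * (20 `^ (gamma - 1) *
    (P (2 * eps * (gamma - 1)) * hp%:R `^ (- (2 * (gamma - 1))))))); last by ring.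
  by rewrite ler_wpM2l// ler_wpM2l ?invr_ge0 ?(ltW q0).
have h3 : (8 * n.+1%:R)^-1 <= 2^-1 * P (- (2 * (1 - delta))).
  rewrite powRN -invfM lef_pV2 ?posrE ?mulr_gt0//.
  by apply: ler_pM n_ge; rewrite ?ler_nat ?(ltW (Pgt0 _)).
have h4 : J%:R * 10 * e <= 10 * P (- 40).
  have -> : P (- 40) = P 4 * P (- 44) by rewrite PD; congr (_ `^ _); ring.
  by rewrite [J%:R * 10]mulrC -mulrA ler_pM2l// ler_wpM2r ?(ltW (Pgt0 _)).
have h5 : 200 * P (- 40) <= P (- 20).
  have -> : P (- 20) = P 20 * P (- 40) by rewrite PD; congr (_ `^ _); ring.
  rewrite ler_wpM2r ?(ltW (Pgt0 _))//; apply: (@le_trans _ _ (P 1)).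
    by rewrite powRr1 ?ler0n// (le_trans _ N2500)// -natrM ler_nat.
  by apply: Ple; rewrite ler1n.
have h6 : P (- 45) <= P (- 40) by apply: Ple; rewrite lerN2 ler_nat.
have h7 := Pgt0 (- 40).
rewrite -(mulrA 40); move: (B * _ * _) h2 => rhs h2; move: ((8 * _)^-1) h3 => t8 h3.
move: (_ * X) h1 => zX h1; move: (_ * main) h1 h2 => hm h1 h2.
move: (J%:R * 10 * e) h4 => je h4.
move: (P (- 20)) (P (- 40)) (P (- 45)) (P (- _)) h3 h4 h5 h6 h7 J35 => p1 p2 p3 p4 h3 h4 h5 h6 h7 J35.
lra.
Qed.

End near_estimate.

Lemma height_slice (hp v : nat) (w z : int) : (v <= hp./2)%N -> `|z| = hp%:Z ->
  `|w| <= v%:Z -> (hp <= 2 * absz (z + w)%R)%N.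
Proof. rewrite -divn2; lia. Qed.

Lemma slab_height_le (v hp : nat) : (v <= hp./2)%N -> (0 < hp)%N -> (v.*2.+1 <= 2 * hp)%N.
Proof. rewrite -divn2; lia. Qed.

Lemma slab_size_le (v c : nat) : (v <= c)%N -> (0 < c)%N -> (v.*2.+1 <= 3 * c)%N.
Proof. lia. Qed.

(** * Exponents for returns from outside A *)

Section hitting_estimate.
Variables (R : realType) (G : fcgraph) (d0 : nat) (C eps delta gamma K c4 : R).
Local Notation N := (#|G|%:R : R).
Local Notation P x := (N `^ x).
Local Notation lambda := (spectral_gap G R).
Let c1 : R := K * ((gamma - 1)^-1 * 20 `^ (gamma - 1)) * c4.
Hypothesis large_N : large C eps N.
Hypothesis C_ge1 : 1000 * (d0.+1%:R) ^+ 2 <= C.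
Hypothesis C_ge2 : 50 * 50 <= C.
Hypothesis C_ge3 : 240 * c1 <= C.
Hypothesis eps0 : 0 < eps.
Hypothesis gamma1 : 1 < gamma.
Hypothesis K0 : 0 <= K.
Hypothesis delta0 : 0 < delta < 1 / 2.
Hypothesis eps_le : eps * (2 * gamma + 10) <= delta / 16.
Hypothesis deg_le : (max_deg G <= d0)%N.
Variables (A V : {set G}) (hp h n : nat).
Let v := minn #|V| hp./2.
Hypothesis n_le : n%:R <= P (2 * (1 - delta)).
Hypothesis n_ge : P (2 * (1 - delta)) <= n.+1%:R.
Hypothesis VA : V \subset A.
Hypothesis V_le : #|V|%:R <= P (delta / 8).
Hypothesis V0 : (0 < #|V|)%N.
Hypothesis hp0 : (0 < hp)%N.
Hypothesis hp_h : (hp <= h)%N.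
Hypothesis h_ge : 2 * ln N ^+ 2 <= h%:R * Num.sqrt lambda.
Hypothesis h_le : h%:R * Num.sqrt lambda <= P eps.
Hypothesis h_leP : h%:R <= P (1 - delta + 2 * eps).
Hypothesis A_ge : P (15 * delta / 16) <= #|A|%:R * Num.sqrt lambda.
Hypothesis hp_ge : (hp < h)%N -> P (3 * eps) <= hp%:R.
Hypothesis A_hp : (hp < h)%N -> #|A|%:R * P (- (delta / 4)) <= c4 * hp%:R `^ (2 * gamma).
Hypothesis kernel : forall k x,
  @killed R (fin_graph G) k (fun y : G => y \notin A) (fun y => (y \in V)%:R) x <=
  #|V|%:R * K * k.+1%:R `^ (- gamma).
Hypothesis hit_core : forall x, outside A x ->
  hit_prob R n (slab V v) (beyond hp.*2) x <= hp%:R * P (- (1 - delta / 8)).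

Let C1 : 1 <= C. Proof. by have := C_ge2; lra. Qed.
Let PD := largeD large_N.
Let Ple := large_le large_N.
Let Pgt0 := large_gt0P large_N.
Let Pc := large_const C1 large_N.

Let eps_small : eps * gamma * 2 + eps * 10 <= delta / 16.
Proof. by have := eps_le; lra. Qed.

Let eps_g : eps <= eps * gamma.
Proof. by rewrite ler_peMr ?(ltW eps0) ?(ltW gamma1). Qed.

Let M : R := #|V|%:R * K * ((gamma - 1)^-1 * (20 `^ (gamma - 1) * P (2 * eps * (gamma - 1)))).

Let M0 : 0 <= M.
Proof. by rewrite !mulr_ge0 ?powR_ge0// invr_ge0 subr_ge0 ltW. Qed.

Let hpR : 0 < hp%:R :> R. Proof. by rewrite ltr0n. Qed.

(** Here h <= |A| N^(eps - 15 delta/16) and hp^(-2 gamma) <= c4 N^(delta/4) / |A|, so |A| cancels;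
    |V|^2 costs N^(delta/4). The exponent is - 7 delta/16 up to multiples of eps, for which delta/16
    is left. *)
Let main_term (c : R) : 0 <= c -> c * c1 <= C -> (hp < h)%N ->
  h%:R * #|V|%:R * (M * hp%:R `^ (- (2 * gamma))) * c <= P (- (3 * delta / 8)).
Proof.
move=> c0 cC hph; have es := eps_small; have eg := eps_g; have e0 := eps0.
have s0 : 0 < Num.sqrt lambda.
  rewrite lt_neqAle sqrtr_ge0 andbT; apply/eqP => e.
  by have := A_ge; rewrite -e mulr0 leNgt Pgt0.
have A0 : 0 < #|A|%:R :> R.
  have := lt_le_trans (Pgt0 (15 * delta / 16)) A_ge.
  by rewrite pmulr_lgt0.
have hA : h%:R <= #|A|%:R * P (eps - 15 * delta / 16).
  rewrite -(ler_pM2r s0); apply: le_trans h_le _.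
  have -> : P eps = P (15 * delta / 16) * P (eps - 15 * delta / 16).
    by rewrite PD; congr (_ `^ _); lra.
  by rewrite [leRHS]mulrAC ler_wpM2r ?(ltW (Pgt0 _)).
have hpA : #|A|%:R * hp%:R `^ (- (2 * gamma)) <= c4 * P (delta / 4).
  have := A_hp hph; rewrite powRN => h1; rewrite powRN.
  have := h1; rewrite ler_pdivrMr ?Pgt0// => h2.
  by rewrite ler_pdivrMr ?powR_gt0// mulrAC.
have V2 : #|V|%:R * #|V|%:R <= P (delta / 4).
  have -> : P (delta / 4) = P (delta / 8) * P (delta / 8) by rewrite PD; congr (_ `^ _); lra.
  by apply: ler_pM.
have MV : #|V|%:R * M = #|V|%:R * #|V|%:R *
    (K * ((gamma - 1)^-1 * 20 `^ (gamma - 1)) * P (2 * eps * (gamma - 1))).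
  by rewrite /M; ring.
set g1 := (gamma - 1)^-1 * _ in MV.
have g10 : 0 <= K * g1 by rewrite !mulr_ge0 ?powR_ge0// invr_ge0 subr_ge0 ltW.
apply: (@le_trans _ _ ((#|A|%:R * P (eps - 15 * delta / 16)) *
   (P (delta / 4) * (K * g1 * P (2 * eps * (gamma - 1)))) * hp%:R `^ (- (2 * gamma)) * c)).
  rewrite ler_wpM2r// [leLHS](_ : _ = h%:R * (#|V|%:R * M) * hp%:R `^ (- (2 * gamma))); last by ring.
  rewrite MV ler_wpM2r ?powR_ge0//; apply: ler_pM => //.
    by apply: mulr_ge0; [rewrite mulr_ge0 | rewrite mulr_ge0// ltW].
  by rewrite ler_wpM2r// mulr_ge0// ltW.
rewrite [leLHS](_ : _ = (#|A|%:R * hp%:R `^ (- (2 * gamma))) *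
  (c * (K * g1) * (P (eps - 15 * delta / 16) * P (delta / 4) * P (2 * eps * (gamma - 1)))));
  last by ring.
apply: le_trans (ler_wpM2r _ hpA) _.
  by apply: mulr_ge0; [exact: mulr_ge0 | rewrite !mulr_ge0 ?(ltW (Pgt0 _))].
rewrite [leLHS](_ : _ = c * c1 * (P (delta / 4) * (P (eps - 15 * delta / 16) *
  P (delta / 4) * P (2 * eps * (gamma - 1))))); last by rewrite /c1 -/g1; ring.
rewrite !PD; apply: le_trans (Pc _ cC) (Ple _); lra.
Qed.

(** Each term of [hit_from_outside] is a multiple of Q = N^(-3 delta/8), in total 13 Q; the passage
    to the exponent - delta/4 absorbs the 13. *)
Lemma hit_outside_large x : outside A x ->
  hit_prob R n (slab V v) pred0 x <= P (- (delta / 4)).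
Proof.
have es := eps_small; have eg := eps_g; have e0 := eps0; have /andP[dl0 dl1] := delta0.
have Cge := C_ge2.
have v_hp : (v <= hp./2)%N by exact: geq_minr.
have v_h : (v <= h)%N.
  by apply: leq_trans v_hp (leq_trans _ hp_h); rewrite -divn2 leq_div.
have eps01 : 0 < eps <= 1 by rewrite e0/=; lra.
pose phi : R := P (- (6 * delta / 8) + 3 * eps).
have Hphi y : beyond h.*2 y -> hit_prob R n (slab V v) pred0 y <= phi.
  case: y => g z; exact: (hit_slab_far large_N C_ge1 eps01 delta0 deg_le n_le n_ge V_le V0
    (geq_minl _ _) v_h h_ge).
pose nu : R := P (- 20) + P (- (2 * (1 - delta))) + 40 * M * hp%:R `^ (1 - 2 * gamma).
have nu0 : 0 <= nu.
  have m1 : 0 <= 40 * M by apply: mulr_ge0; [exact: ler0n | exact: M0].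
  by apply: addr_ge0; [apply: addr_ge0; exact: powR_ge0 | apply: mulr_ge0 m1 (powR_ge0 _ _)].
(* For hp = h there is no intermediate scale, and the lower bounds on hp are available only for hp <
   h. *)
pose alpha : R := if (hp < h)%N then v.*2.+1%:R * nu else 0.
have alpha0 : 0 <= alpha by rewrite /alpha; case: ifP => // _; rewrite mulr_ge0.
have hP2 : h%:R <= P 2 by apply: le_trans h_leP (Ple _); lra.
have Halpha : (hp < h)%N -> forall y : cylinder G, `|y.2| == hp%:Z ->
    hit_prob R n (slab V v) (outside A) y <= alpha.
  move=> hph [g z] /eqP zE; rewrite /alpha hph.
  apply: (@hit_slab_le R G n V v (fun x => x \notin A)) => w wv.
  apply: (hit_slice_near_large large_N C_ge2 eps0 gamma1 n_ge VA _ kernel (hp_ge hph)).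
  - by rewrite mulr_ge0.
  - by apply: le_trans hP2; rewrite ler_nat.
  - exact: height_slice v_hp zE wv.
set sigma : R := hp%:R * P (- (1 - delta / 8)).
have sigma0 : 0 <= sigma by rewrite mulr_ge0 ?(ltW (Pgt0 _)).
have phi0 : 0 <= phi by exact: ltW (Pgt0 _).
move=> xo; apply: le_trans (hit_from_outside hp0 v_hp hp_h sigma0 alpha0 phi0 hit_core
  Halpha Hphi xo) _.
pose Q : R := P (- (3 * delta / 8)).
have Q0 : 0 < Q by exact: Pgt0.
have hh0 : 0 <= h%:R :> R by [].
have hphR : hp%:R <= h%:R :> R by rewrite ler_nat.
have b1 : h%:R * P (- (1 - delta / 8)) <= Q.
  apply: le_trans (ler_wpM2r (ltW (Pgt0 _)) h_leP) _; rewrite PD; apply: Ple; lra.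
have b2 : sigma <= Q by apply: le_trans b1; rewrite ler_wpM2r ?(ltW (Pgt0 _)).
have b3 : sigma * ((h.*2)%:R / hp%:R) <= 2 * Q.
  have -> : sigma * ((h.*2)%:R / hp%:R) = 2 * (h%:R * P (- (1 - delta / 8))).
    by rewrite /sigma -mul2n natrM; field; rewrite gt_eqF.
  by rewrite ler_pM2l.
have b4 : phi <= Q by apply: Ple; lra.
have b5 : alpha * ((h.*2)%:R / hp%:R) <= 9 * Q.
  rewrite /alpha; case: ifP => hph; last by rewrite mul0r mulr_ge0// ltW.
  have w1 : v.*2.+1%:R <= 2 * hp%:R :> R.
    by rewrite -natrM ler_nat; exact: slab_height_le.
  have w2 : v.*2.+1%:R <= 3 * #|V|%:R :> R.
    by rewrite -natrM ler_nat; apply: slab_size_le => //; exact: geq_minl.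
  have r0 : 0 <= (h.*2)%:R / hp%:R :> R by rewrite divr_ge0.
  rewrite /nu mulrDr mulrDl.
  have t1 : v.*2.+1%:R * (P (- 20) + P (- (2 * (1 - delta)))) * ((h.*2)%:R / hp%:R) <= 8 * Q.
    have p0 : 0 <= P (- 20) + P (- (2 * (1 - delta))) by rewrite addr_ge0 ?powR_ge0.
    apply: le_trans (ler_wpM2r r0 (ler_wpM2r p0 w1)) _.
    have -> : 2 * hp%:R * (P (- 20) + P (- (2 * (1 - delta)))) * ((h.*2)%:R / hp%:R) =
        4 * (h%:R * P (- 20) + h%:R * P (- (2 * (1 - delta)))).
      by rewrite -mul2n natrM; field; rewrite gt_eqF.
    have u1 : h%:R * P (- 20) <= Q.
      apply: le_trans (ler_wpM2r (ltW (Pgt0 _)) hP2) _; rewrite PD; apply: Ple; lra.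
    have u2 : h%:R * P (- (2 * (1 - delta))) <= Q.
      apply: le_trans (ler_wpM2r (ltW (Pgt0 _)) h_leP) _; rewrite PD; apply: Ple; lra.
    move: u1 u2; move: (h%:R * P (- 20)) (h%:R * _) => a b; lra.
  have t2 : v.*2.+1%:R * (40 * M * hp%:R `^ (1 - 2 * gamma)) * ((h.*2)%:R / hp%:R) <= Q.
    have p0 : 0 <= 40 * M * hp%:R `^ (1 - 2 * gamma).
      by apply: mulr_ge0 (powR_ge0 _ _); apply: mulr_ge0; [exact: ler0n | exact: M0].
    apply: le_trans (ler_wpM2r r0 (ler_wpM2r p0 w2)) _.
    apply: le_trans (main_term (ler0n R 240) C_ge3 hph); rewrite le_eqVlt; apply/orP; left; apply/eqP.
    have -> : hp%:R `^ (1 - 2 * gamma) = hp%:R * hp%:R `^ (- (2 * gamma)) :> R.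
      by rewrite -{2}[hp%:R]powRr1 ?ler0n// -powRD ?(gt_eqF hpR) ?implybT.
    by rewrite -mul2n natrM; field; rewrite gt_eqF.
  apply: le_trans (lerD t1 t2) _; rewrite -[X in _ + X]mul1r -mulrDl ler_wpM2r ?(ltW Q0)//; lra.
have -> : sigma + (alpha + sigma) * ((h.*2)%:R / hp%:R) + phi =
  sigma + alpha * ((h.*2)%:R / hp%:R) + sigma * ((h.*2)%:R / hp%:R) + phi by ring.
apply: (@le_trans _ _ (13 * Q)).
  apply: le_trans (lerD (lerD (lerD b2 b5) b3) b4) _.
  by rewrite le_eqVlt; apply/orP; left; apply/eqP; ring.
rewrite /Q; apply: le_trans (Pc _ _) (Ple _); lra.
Qed.

End hitting_estimate.

(** * Size of the heights h and h' *)

Section heights.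
Variables (R : realType) (G : fcgraph) (d0 : nat) (C eps delta gamma : R).
Local Notation N := (#|G|%:R : R).
Local Notation P x := (N `^ x).
Local Notation lambda := (spectral_gap G R).
Hypothesis large_N : large C eps N.
Hypothesis C_ge : 1000 * (d0.+1%:R) ^+ 2 <= C.
Hypothesis eps0 : 0 < eps.
Hypothesis deg_le : (max_deg G <= d0)%N.
Hypothesis gap : ~ @small_gap R delta G.

Let d1 : 1 <= d0.+1%:R :> R. Proof. by rewrite ler1n. Qed.

Let C1 : 1 <= C.
Proof. by have := C_ge; have := d1; move: (d0.+1%:R) => x *; nra. Qed.

Let cC (c : R) : c <= 1000 * d0.+1%:R -> c <= C.
Proof. by move=> h1; apply: le_trans h1 (le_trans _ C_ge); have := d1; nra. Qed.

Let PD := largeD large_N.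
Let Ple := large_le large_N.
Let Pgt0 := large_gt0P large_N.
Let L1 := large_ln C1 large_N.
Let N0 := large_gt0 large_N.

(** The failure of (1) enters here: it bounds the relaxation time, and with it h. *)
Let sqrt_gap_ge : P (- (1 - delta) - eps) <= Num.sqrt lambda.
Proof.
have gp : P (- (2 * (1 - delta))) * (ln N)^-1 < lambda by rewrite ltNge; exact/negP.
have l1 := L1; have l0 : 0 < ln N by lra.
rewrite -(@ler_pXn2r _ 2) ?nnegrE ?sqrtr_ge0 ?powR_ge0//.
rewrite sqr_sqrtr ?spectral_gap_ge0//; apply: le_trans (ltW gp).
rewrite expr2 PD ler_pdivlMr//.
have lP : ln N <= P eps.
  by have := @large_lnX R C eps N C1 large_N 1 1; rewrite expr1 mul1r; apply; rewrite ?ler01.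
apply: le_trans (ler_wpM2l (ltW (Pgt0 _)) lP) _; rewrite PD; apply: Ple.
by have := eps0; lra.
Qed.

Lemma sqrt_gap_gt0 : 0 < Num.sqrt lambda.
Proof. exact: lt_le_trans (Pgt0 _) sqrt_gap_ge. Qed.

Let y := Num.sqrt (relax_time G R) * ln N ^+ 2.
Let ys : y * Num.sqrt lambda = Num.sqrt (ln (2 * N)) * ln N ^+ 2.
Proof.
rewrite /y /relax_time sqrtrM ?invr_ge0 ?spectral_gap_ge0//.
have -> : Num.sqrt lambda^-1 = (Num.sqrt lambda)^-1 by rewrite sqrtrV// spectral_gap_ge0.
by field; rewrite gt_eqF// sqrt_gap_gt0.
Qed.

Let y0 : 0 <= y. Proof. by rewrite mulr_ge0 ?sqrtr_ge0 ?sqr_ge0. Qed.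

Let lnN2 : 1 <= ln (2 * N) <= 2 * ln N.
Proof.
have l1 := L1; rewrite lnM ?posrE//.
have : 0 <= ln 2 :> R by rewrite ln_ge0// ler1n.
have : ln 2 <= 1 :> R.
  by apply: le_trans (le_ln1Dx _) _; rewrite ?ltrN10//; lra.
by move=> *; lra.
Qed.

Let sqrtln : 1 <= Num.sqrt (ln (2 * N)) <= 2 * ln N.
Proof.
have /andP[a b] := lnN2; apply/andP; split.
  by rewrite -{1}(sqrtr1 R) ler_sqrt//; lra.
apply: le_trans b; rewrite -[leRHS]ger0_norm; last by lra.
rewrite -sqrtr_sqr ler_sqrt ?sqr_ge0// expr2 ler_peMr//; lra.
Qed.

Lemma height_sqrt_ge : 2 * ln N ^+ 2 <= (height G R)%:R * Num.sqrt lambda.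
Proof.
have /andP[a _] := sqrtln.
have yle : y <= (Num.truncn y + 1)%:R by rewrite addn1 ltW// truncnS_gt.
rewrite /height natrM -/y -mulrA ler_pM2l//.
apply: le_trans (ler_wpM2r (sqrtr_ge0 _) yle); rewrite ys.
by rewrite ler_peMl ?sqr_ge0.
Qed.

Lemma height_sqrt_le : (height G R)%:R * Num.sqrt lambda <= P eps.
Proof.
have /andP[_ b] := sqrtln; have l1 := L1.
have yge : (Num.truncn y)%:R <= y by rewrite truncn_le.
have /andP[_ sl] := sqrt_gap_le R deg_le.
have l3 : 1 <= ln N ^+ 3 by rewrite exprn_ege1.
have lX : (8 * d0.+1%:R) * ln N ^+ 3 <= P eps.
  apply: (large_lnX C1 large_N) => //; rewrite mulr_ge0//= cC//.
  by rewrite ler_wpM2r// ler_nat.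
apply: le_trans lX; rewrite /height natrM -/y natrD -mulrA mulrDl mul1r.
have h1 : (Num.truncn y)%:R * Num.sqrt lambda <= 2 * ln N ^+ 3.
  apply: le_trans (ler_wpM2r (sqrtr_ge0 _) yge) _; rewrite ys.
  apply: le_trans (ler_wpM2r (sqr_ge0 _) b) _; rewrite -mulrA -exprS//.
have := d1; move: h1 sl l3; move: ((Num.truncn y)%:R * Num.sqrt lambda) (Num.sqrt lambda) (ln N ^+ 3) (d0.+1%:R : R).
move=> u s t d h1 hs t1 dd1.
have e1 : t <= d * t by rewrite ler_peMl//; lra.
have e2 : d <= d * t by rewrite ler_peMr//; lra.
by rewrite -mulrA; move: (d * t) e1 e2 => w e1 e2; lra.
Qed.

Lemma height_le : (height G R)%:R <= P (1 - delta + 2 * eps).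
Proof.
rewrite -(ler_pM2r (Pgt0 (- (1 - delta) - eps))) PD.
apply: le_trans (ler_wpM2l (ler0n _ _) sqrt_gap_ge) (le_trans height_sqrt_le (Ple _)).
by have := eps0; lra.
Qed.

Variable A : {set G}.
Hypothesis gamma1 : 1 < gamma.
Hypothesis eps_le : eps * (2 * gamma + 10) <= delta / 16.
Hypothesis A_size : lambda `^ (- (1 / 2)) * P (15 * delta / 16) <= #|A|%:R.
Hypothesis hp0 : (0 < height' delta gamma A)%N.
Local Notation hp := (height' delta gamma A).
Let z := (Num.sqrt #|A|%:R * P (- (delta / 8))) `^ gamma^-1.

Lemma base_card_ge : P (15 * delta / 16) <= #|A|%:R * Num.sqrt lambda.
Proof.
have s0 := sqrt_gap_gt0.
have : lambda `^ (- (1 / 2)) = (Num.sqrt lambda)^-1.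
  by rewrite powRN mul1r powR12_sqrt ?spectral_gap_ge0.
move=> e; have := A_size; rewrite e mulrC ler_pdivrMr//.
Qed.

Lemma height'_le : (hp <= height G R)%N. Proof. exact: geq_minr. Qed.

Hypothesis hp_lt : (hp < height G R)%N.

(** When hp < h, the minimum in the definition of h' is its first entry, so hp is comparable to z,
    and z^(2 gamma) = |A| N^(-delta/4). *)
Let hpE : hp = Num.truncn z.
Proof.
apply: minn_idPl; move: hp_lt; rewrite /height' -/z => h1.
by have := h1; rewrite gtn_min ltnn orbF => /ltnW.
Qed.

Let z_le : z <= 2 * hp%:R.
Proof.
have h1 : z < hp.+1%:R by rewrite hpE truncnS_gt.
have : hp.+1%:R <= 2 * hp%:R :> R by rewrite -natrM ler_nat mul2n -addnn -addn1 leq_add2l.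
by move=> h2; exact: le_trans (ltW h1) h2.
Qed.

Let z0 : 0 <= z. Proof. exact: powR_ge0. Qed.

Let zg : z `^ (2 * gamma) = #|A|%:R * P (- (delta / 4)).
Proof.
have g1 := gamma1; rewrite /z -powRrM.
have -> : gamma^-1 * (2 * gamma) = 2 by field; rewrite gt_eqF//; lra.
rewrite powRM ?sqrtr_ge0 ?powR_ge0// powR_mulrn ?sqrtr_ge0// sqr_sqrtr//.
by rewrite -powRrM; congr (_ * _ `^ _); lra.
Qed.

Lemma height'_card : #|A|%:R * P (- (delta / 4)) <= 2 `^ (2 * gamma) * hp%:R `^ (2 * gamma).
Proof.
have g1 := gamma1; rewrite -powRM// -zg ge0_ler_powR ?nnegrE//.
by rewrite mulr_ge0//; lra.
Qed.

(** As sqrt lambda is bounded in terms of d0, (2) makes |A| at least of order N^(15 delta/16). Then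
    z^(2 gamma) >= N^(8 eps gamma), that is z >= N^(4 eps); one factor N^eps pays for the
    rounding. *)
Lemma height'_ge : P (3 * eps) <= hp%:R.
Proof.
have g1 := gamma1; have e0 := eps0; have el := eps_le.
have eg : eps <= eps * gamma by rewrite ler_peMr ?(ltW eps0) ?(ltW gamma1).
have g0 : 0 < 2 * gamma by lra.
have hA : P (4 * eps * (2 * gamma)) <= z `^ (2 * gamma).
  rewrite zg.
  have -> : P (4 * eps * (2 * gamma)) = P (4 * eps * (2 * gamma) + delta / 4) * P (- (delta / 4)).
    by rewrite PD; congr (_ `^ _); lra.
  rewrite ler_wpM2r ?powR_ge0//.
  have /andP[_ sl] := sqrt_gap_le R deg_le.
  have := base_card_ge; have := ler_wpM2l (ler0n R #|A|) sl.
  move=> h1 /le_trans /(_ h1) h2.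
  have dd : 0 < 2 * d0.+1%:R :> R by rewrite mulr_gt0.
  rewrite -(ler_pM2r dd); apply: le_trans h2; rewrite mulrC.
  apply: le_trans (large_const C1 large_N _ _) (Ple _).
    by apply: cC; rewrite ler_wpM2r// ler_nat.
  by lra.
have zge : P (4 * eps) <= z.
  rewrite -(@ler_pXn2r _ 1)// ?nnegrE ?powR_ge0// !expr1.
  rewrite leNgt; apply/negP => zl.
  have := hA; rewrite leNgt; apply/negP; rewrite negbK.
  apply: lt_le_trans (_ : z `^ (2 * gamma) < P (4 * eps) `^ (2 * gamma)) _.
    by rewrite gt0_ltr_powR ?nnegrE ?powR_ge0.
  by rewrite -powRrM.
have h2 : 2 * P (3 * eps) <= z.
  apply: le_trans zge; apply: le_trans (large_const C1 large_N _ _) (Ple _); last by lra.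
  by apply: cC; have := d1; lra.
by have := z_le; move: h2; move: (P (3 * eps)) => u; lra.
Qed.
End heights.

Lemma return_kernel (R : realType) (G : fcgraph) (d0 : nat) (a gamma : R) (A V : {set G})
    k (x : fin_graph G) :
  0 < a -> 0 < gamma -> (max_deg G <= d0)%N -> return_cond gamma a A ->
  killed k (fun y : fin_graph G => y \notin A) (fun y => (y \in V)%:R) x <=
  #|V|%:R * ((d0.+1%:R * a + 1) * 2 `^ gamma) * k.+1%:R `^ (- gamma) :> R.
Proof.
move=> a0 g0 dle ret; rewrite -mulrA; apply: killed_set_le => y.
apply: (@le_trans _ _ (((max_deg G)%:R * a + 1) * 2 `^ gamma * k.+1%:R `^ (- gamma))).
  apply: (@killed_heat_kernel R G (fun y => y \notin A) a gamma k x y a0 g0) => m z zA m1.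
  rewrite negbK in zA; have := ret z m zA m1.
  rewrite (_ : [set z : G | z \in A] = [set z : fin_graph G | ~~ (z \notin A)]).
    by rewrite killed_law lee_fin.
  by apply/seteqP; split => u /=; rewrite negbK.
rewrite !ler_wpM2r ?powR_ge0// lerD2r ler_wpM2r ?(ltW a0)// ler_nat.
exact: leq_trans dle _.
Qed.

Lemma slab_not_beyond (h v : nat) (z : int) : (v <= h./2)%N -> (0 < h)%N ->
  - v%:Z <= z <= v%:Z -> ~~ ((h.*2)%:Z <= `|z|).
Proof. rewrite -divn2; lia. Qed.

Lemma box_itv (h : nat) (z : int) :
  (- (2 * h%:Z) + 1 <= z <= 2 * h%:Z - 1) = ~~ ((h.*2)%:Z <= `|z|).
Proof. lia. Qed.

Lemma hitting_cond_le (R : realType) (G : fcgraph) (delta gamma : R) (A V : {set G}) n x :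
  let hp := height' delta gamma A in
  hitting_cond delta gamma A V -> outside A x ->
  hit_prob R n (slab V (minn #|V| hp./2)) (beyond hp.*2) x <=
  hp%:R * #|G|%:R `^ (- (1 - delta / 8)).
Proof.
move=> hp [hp0 hc] xA.
have N0 : 0 < #|G|%:R :> R by rewrite ltr0n (ltnW (fc_card_gt1 G)).
have hpR : 0 < hp%:R :> R by rewrite ltr0n.
have P0 := powR_gt0 (1 - delta / 8) N0.
set u := hit_prob _ _ _ _ _.
suff : ((#|G|%:R `^ (1 - delta / 8) / hp%:R)%:E * u%:E <= 1)%E.
  rewrite -EFinM lee_fin => h1; rewrite powRN ler_pdivlMr//.
  by move: h1; rewrite mulrAC ler_pdivrMr// mul1r mulrC.
apply: le_trans hc; apply: lee_wpmul2l; first by rewrite lee_fin divr_ge0 ?ltW.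
have := @hit_prob_le_law R (cylinder G) n (slab V (minn #|V| hp./2)) (beyond hp.*2) x.
move=> /(_ _)/le_trans; apply.
  by move=> [g z] /andP[_]; apply: slab_not_beyond => //; exact: geq_minr.
apply: ereal_sup_ubound; exists x => //=.
have -> : core delta gamma A V = [set y | slab V (minn #|V| hp./2) y].
  by apply/seteqP; split => y /=; rewrite /slab => /andP.
have -> // : box' delta gamma A = [set y | ~~ beyond hp.*2 y].
by apply/seteqP; split => y; rewrite /box' /= /beyond box_itv.
Qed.

(** * Visits to a window and conclusion *)

Section few_visits.
Variables (R : realType) (G : fcgraph) (A V : {set G}) (K gamma : R).
Hypothesis gamma1 : 1 < gamma.
Hypothesis K0 : 0 <= K.
Hypothesis V0 : (0 < #|V|)%N.
Hypothesis kernel : forall k x,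
  @killed R (fin_graph G) k (fun y : G => y \notin A) (fun y => (y \in V)%:R) x <=
  #|V|%:R * K * k.+1%:R `^ (- gamma).

(* Splitting the sum of the killed heat kernel at time [#|V| ^ (1 / gamma)]. *)
Lemma visit_mean_card n (y : cylinder G) :
  visit_mean R n (fun y : cylinder G => y.1 \in V) (outside A) y <=
  3 * (2 + K * (gamma - 1)^-1) * #|V|%:R `^ gamma^-1.
Proof.
have g1 := gamma1; have g0 : 0 < gamma by lra.
have gg : 0 < gamma - 1 by lra.
set m : R := #|V|%:R; have m1 : 1 <= m by rewrite ler1n.
have m0 : 0 < m by lra.
set u := m `^ gamma^-1.
have u1 : 1 <= u by rewrite -(powRr0 m) ler_powR// invr_ge0 ltW.
have u0 : 0 < u := lt_le_trans ltr01 u1.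
pose k1 := (Num.truncn u).+1.
have k1l : u <= k1%:R by rewrite ltW// truncnS_gt.
have k1u : k1%:R <= 2 * u.
  have : (Num.truncn u)%:R <= u by rewrite truncn_le; lra.
  by rewrite /k1 -natr1; lra.
have c0 : 0 <= m * K by rewrite mulr_ge0//; lra.
have := @visit_mean_le R G (fun x => x \notin A) V n y => /le_trans; apply.
rewrite -mulrA ler_pM2l//.
have k10 : (0 < k1)%N by [].
pose F k := @killed R (fin_graph G) k (fun z : G => z \notin A) (fun z => (z \in V)%:R) y.1.
have F1 k : F k <= 1.
  by apply: killed_le_cst => // z; rewrite ?ler01 // lern1 leq_b1.
have F0 k : 0 <= F k by apply: killed_ge0 => z.
have Fk k : F k <= m * K * k.+1%:R `^ (- gamma) by exact: kernel.
apply: le_trans (sum_min_powR n.+1 g1 c0 k10 F1 F0 Fk) _.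
have k1g : k1%:R `^ (1 - gamma) <= m^-1 * u.
  have -> : m^-1 * u = u `^ (1 - gamma).
    rewrite /u -powRrM -[X in _ * X]/(m `^ gamma^-1) -[X in X^-1]powRr1 ?(ltW m0)// -powRN.
    rewrite -powRD ?(gt_eqF m0) ?implybT//; congr (_ `^ _).
    by rewrite mulrBr mulr1 mulVf ?gt_eqF// addrC.
  rewrite -[1 - gamma]opprB !powRN lef_pV2 ?posrE ?powR_gt0//.
  by rewrite ge0_ler_powR ?nnegrE// ltW.
rewrite mulrDl; apply: lerD => //.
rewrite (_ : m * K * _ = K * (gamma - 1)^-1 * (m * k1%:R `^ (1 - gamma))); last by ring.
rewrite ler_wpM2l ?mulr_ge0 ?invr_ge0 ?(ltW gg)//.
apply: le_trans (ler_wpM2l (ltW m0) k1g) _.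
by rewrite mulrA mulfV ?mul1r// gt_eqF.
Qed.

End few_visits.

Lemma half_pow_le (R : realType) (k : nat) (x : R) : 2 * x <= k%:R ->
  2^-1 ^+ k <= expR (- x).
Proof.
move=> xk; have h : 2^-1 <= expR (- 2^-1) :> R.
  by apply: le_trans (expR_ge1Dx _); lra.
apply: (@le_trans _ _ (expR (- 2^-1) ^+ k)).
  by rewrite lerXn2r ?nnegrE ?expR_ge0 ?invr_ge0.
by rewrite -expRM_natl ler_expR; lra.
Qed.

Section large_gap.
Variables (R : realType) (G : fcgraph) (C eps delta gamma K e2 : R) (q : nat).
Local Notation N := (#|G|%:R : R).
Local Notation P x := (N `^ x).
Let cM : R := 3 * (2 + K * (gamma - 1)^-1).
Let theta := 1 - gamma^-1.
Hypothesis large_N : large C eps N.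
Hypothesis C_ge1 : 50 * 50 <= C.
Hypothesis C_ge2 : 12 * q.+1%:R * cM <= C.
Hypothesis eps0 : 0 < eps.
Hypothesis gamma1 : 1 < gamma.
Hypothesis K0 : 0 <= K.
Hypothesis delta0 : 0 < delta < 1 / 2.
Hypothesis eps_le : 4 * eps <= e2 * theta.
Hypothesis e2_le : e2 + eps <= delta / 8.
Hypothesis q_ge : 32 <= q%:R * delta.
Variables (A V W : {set G}) (v n : nat).
Hypothesis n_le : n%:R <= P (2 * (1 - delta)).
Hypothesis W_connected : Defs.connected_subset W.
Hypothesis WV : W \subset V.
Hypothesis W_card : #|W| = Num.truncn (P e2).
Hypothesis kernel : forall k x,
  @killed R (fin_graph G) k (fun y : G => y \notin A) (fun y => (y \in W)%:R) x <=
  #|W|%:R * K * k.+1%:R `^ (- gamma).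
Hypothesis hit_V : forall x, outside A x -> hit_prob R n (slab V v) pred0 x <= P (- (delta / 4)).

Let C1 : 1 <= C. Proof. by have := C_ge1; lra. Qed.
Let PD := largeD large_N.
Let Ple := large_le large_N.
Let Pgt0 := large_gt0P large_N.
Let Pc := large_const C1 large_N.
Let L1 := large_ln C1 large_N.
Let g0 : 0 < gamma. Proof. by have := gamma1; lra. Qed.

Let theta01 : 0 < theta < 1.
Proof.
have := gamma1; rewrite -(invf_lt1 g0) => h; have : 0 < gamma^-1 by rewrite invr_gt0.
by rewrite /theta; lra.
Qed.

Let e20 : 4 * eps <= e2.
Proof.
have /andP[t0 t1] := theta01; have := eps_le; have := eps0; move=> e0 h.
have : 0 < e2 by rewrite -(pmulr_lgt0 _ t0); lra.
move=> e2p; apply: le_trans h _; rewrite ler_piMr// ltW//.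
Qed.

Let P0 : P 0 = 1. Proof. exact: powRr0. Qed.

Let Pge1 x : 0 <= x -> 1 <= P x.
Proof. by move=> x0; rewrite -[leLHS]P0; apply: Ple. Qed.

Let Pe_ge c : c <= C -> c <= P eps.
Proof. by move=> cC; have := Pc 0 cC; rewrite add0r P0 mulr1. Qed.

Let m : R := #|W|%:R.

Let m_le : m <= P e2. Proof. by rewrite /m W_card truncn_le ltW. Qed.

Let m_ge : P (e2 - eps) <= m.
Proof.
have h : P e2 < #|W|.+1%:R by rewrite W_card truncnS_gt.
have h2 : 4 * P (e2 - eps) <= P e2.
  apply: le_trans (Pc _ _) (Ple _); last by lra.
  by have := C_ge1; lra.
have h3 : 1 <= P (e2 - eps) by apply: Pge1; have := e20; have := eps0; lra.
by move: h; rewrite -natr1 -/m; lra.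
Qed.

Let m1 : 1 <= m.
Proof. by apply: le_trans m_ge; apply: Pge1; have := e20; have := eps0; lra. Qed.

(** Half of what the heat kernel gains over |W|: |W|^(1/gamma) r^2 = |W|. One factor r counts the
    rounds of visits, the other absorbs the constants. *)
Let r := m `^ (theta / 2).

Let r_ge : P eps <= r.
Proof.
have /andP[t0 t1] := theta01; have e0 := eps0; have el := eps_le.
apply: (@le_trans _ _ (P (e2 - eps) `^ (theta / 2))).
  rewrite -powRrM; apply: Ple.
  have : eps * theta <= eps by rewrite ler_piMr ?ltW.
  by lra.
by rewrite ge0_ler_powR ?nnegrE ?powR_ge0 ?m_ge//; have := m1; lra.
Qed.

Let mE : m `^ gamma^-1 * (r * r) = m.
Proof.
have m0 : 0 < m by have := m1; lra.
rewrite -powRD ?(gt_eqF m0) ?implybT// -powRD ?(gt_eqF m0) ?implybT//.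
rewrite -[RHS](powRr1 (ltW m0)); congr (_ `^ _); rewrite /theta; move: (gamma^-1) => t; lra.
Qed.

Let M : R := cM * m `^ gamma^-1.

Let M1 : 1 <= M.
Proof.
have : 1 <= m `^ gamma^-1.
  by rewrite -(powRr0 m) ler_powR// invr_ge0 ltW.
have : 1 <= cM.
  have : 0 <= K * (gamma - 1)^-1 by rewrite mulr_ge0// invr_ge0 subr_ge0 ltW.
  by rewrite /cM; lra.
by move=> a b; rewrite /M -[1]mulr1 ler_pM.
Qed.

Let W0 : (0 < #|W|)%N. Proof. by rewrite -(ltr0n R) (lt_le_trans _ m1). Qed.

Let l0 := (Num.truncn (2 * M)).+1.
Let k := Num.truncn r.

Let r1 : 50 <= r. Proof. by apply: le_trans (Pe_ge _) r_ge; have := C_ge1; lra. Qed.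

Let k_ge : r / 2 <= k%:R.
Proof.
have h : r < k.+1%:R by rewrite truncnS_gt.
by have := r1; move: h; rewrite -natr1; lra.
Qed.

Let l_le : (4 * (q.+1 * (k * l0)) <= #|W|)%N.
Proof.
rewrite -(ler_nat R) -/m !natrM.
have kr : k%:R <= r by rewrite truncn_le; have := r1; lra.
have l0M : l0%:R <= 3 * M.
  have : (Num.truncn (2 * M))%:R <= 2 * M by rewrite truncn_le; have := M1; lra.
  have -> : l0%:R = (Num.truncn (2 * M))%:R + 1 :> R by rewrite natr1.
  have := M1; move: M (Num.truncn (2 * M))%:R => M' t *; lra.
have r0 : 0 <= r by have := r1; lra.
apply: (@le_trans _ _ (4 * (q.+1%:R * (r * (3 * M))))).
  by rewrite ler_pM2l// ler_pM2l// ler_pM.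
rewrite -[leRHS]mE (_ : 4 * _ = m `^ gamma^-1 * (r * (12 * q.+1%:R * cM))); last first.
  by rewrite /M; ring.
rewrite ler_wpM2l ?powR_ge0// ler_wpM2l//.
by apply: le_trans (Pe_ge C_ge2) r_ge.
Qed.

(** Each of the k rounds has probability at most 1/2, and k >= r / 2 >= 8 ln N because r >=
    N^eps. *)
Let few_visits_large y :
  visit_prob R n (k * l0) (fun y : cylinder G => y.1 \in W) (outside A) y <= P (- 4).
Proof.
have l1 := L1; have M0 : 0 <= M by have := M1; lra.
have Ml : 2 * M <= l0%:R by rewrite ltW// truncnS_gt.
have Hv z := visit_mean_card gamma1 K0 W0 kernel n z.
apply: le_trans (visit_prob_exp k y M0 Ml Hv (ltn0Sn _)) _.
rewrite (large_expR large_N) mulNr; apply: half_pow_le.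
apply: le_trans k_ge; have : 16 * ln N <= r.
  apply: le_trans r_ge; have := @large_lnX R C eps N C1 large_N 16 1.
  by rewrite expr1; apply => //; rewrite ler0n/=; have := C_ge1; lra.
by lra.
Qed.

(** The window over [W] may be taller than the slab over [V]. So only the slice at height 0 is taken
    from [hit_V], and the sum over its 2 |W| + 1 translates costs a factor of order N^e2. *)
Let hit_W (g : G) (z : int) : g \notin A ->
  hit_prob R n (slab W #|W|) pred0 (g, z) <= P (- (delta / 8)).
Proof.
move=> gA; have /andP[dl0 dl1] := delta0; have e0 := eps0; have el := e2_le.
have H : forall w : int, `|w| <= #|W|%:Z ->
    hit_prob R n (slice W) (fun x => pred0 x.1) (g, z + w) <= P (- (delta / 4)).
  move=> w _; apply: le_trans (hit_V (x := (g, z + w)) gA).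
  apply: hit_prob_sub => [[a b] /andP[/= aW /eqP b0]|//].
  by rewrite /slab (fintype.subsetP WV _ aW)/= b0 oppr_le0 lez_nat.
apply: le_trans (@hit_slab_le R G n W #|W| pred0 _ g z H) _.
have s3 : (#|W|.*2.+1)%:R <= 3 * P e2.
  have : (#|W|.*2.+1)%:R <= 3 * m by rewrite -natrM ler_nat; apply: slab_size_le.
  by have := m_le; lra.
apply: le_trans (ler_wpM2r (ltW (Pgt0 _)) s3) _; rewrite -mulrA PD.
apply: le_trans (Pc _ _) (Ple _); last by lra.
by have := C_ge1; lra.
Qed.

(** At most 5 N^2 windows, each with probability at most 3 N^(-4), where q delta >= 32 makes q
    returns of probability N^(-delta/8) cost N^(-4). *)
Lemma disconnecting_prob_large_gap x : walk_prob R n (@disconnecting G) x <= P (- 1).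
Proof.
have /andP[dl0 dl1] := delta0; have e0 := eps0; have el := e2_le; have e2p := e20.
have Cg := C_ge1.
have q01 : 0 <= P (- (delta / 8)) <= 2^-1.
  rewrite (ltW (Pgt0 _))/=; have : 2 * P (- (delta / 8)) <= 1.
    by rewrite -[leRHS]P0; apply: le_trans (Pc _ _) (Ple _); lra.
  by lra.
have l0q : (0 < k * l0)%N.
  rewrite muln_gt0 andbT -(ltr0n R); apply: lt_le_trans k_ge; have := r1; lra.
have := @disconnect_prob_le R G A W n #|W| (k * l0) q _ _ x W_connected erefl W0 l0q l_le
  q01 (ltW (Pgt0 _)) hit_W few_visits_large.
move=> /le_trans; apply.
have qq : P (- (delta / 8)) ^+ q <= P (- 4).
  rewrite -powR_mulrn ?(ltW (Pgt0 _))// -powRrM; apply: Ple.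
  by have := q_ge; lra.
have s5 : ((n + #|W|).*2.+1)%:R <= 5 * P 2.
  have a1 : n%:R <= P 2 by apply: le_trans n_le (Ple _); lra.
  have a2 : m <= P 2 by apply: le_trans m_le (Ple _); lra.
  have a3 : 1 <= P 2 by apply: Pge1.
  by rewrite -natr1 -mul2n natrM natrD -/m; lra.
have s3 : 2 * P (- 4) + P (- (delta / 8)) ^+ q <= 3 * P (- 4) by lra.
have s0 : 0 <= 2 * P (- 4) + P (- (delta / 8)) ^+ q.
  by apply: addr_ge0; [rewrite mulr_ge0 ?powR_ge0 | rewrite exprn_ge0 ?powR_ge0].
apply: le_trans (ler_pM (ler0n _ _) s0 s5 s3) _.
rewrite (_ : 5 * P 2 * _ = 15 * (P 2 * P (- 4))); last by ring.
rewrite PD; apply: le_trans (Pc _ _) (Ple _); lra.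
Qed.

End large_gap.

Section class_member.
Variables (R : realType) (d0 : nat) (delta delta' gamma a C eps : R) (q : nat) (G : fcgraph).
Local Notation N := (#|G|%:R : R).
Local Notation P x := (N `^ x).
Let K : R := (d0.+1%:R * a + 1) * 2 `^ gamma.
Let c4 : R := 2 `^ (2 * gamma).
Hypothesis large_N : large C eps N.
Hypothesis C_ge1 : 1000 * (d0.+1%:R) ^+ 2 <= C.
Hypothesis C_ge2 : 50 * 50 <= C.
Hypothesis C_ge3 : 240 * (K * ((gamma - 1)^-1 * 20 `^ (gamma - 1)) * c4) <= C.
Hypothesis C_ge4 : 12 * q.+1%:R * (3 * (2 + K * (gamma - 1)^-1)) <= C.
Hypothesis d0_gt0 : (0 < d0)%N.
Hypothesis eps0 : 0 < eps.
Hypothesis gamma1 : 1 < gamma.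
Hypothesis a0 : 0 < a.
Hypothesis delta0 : 0 < delta < 1 / 2.
Hypothesis delta'0 : 0 < delta' < delta / 8.
Hypothesis eps_le1 : eps * (2 * gamma + 10) <= delta / 16.
Hypothesis eps_le2 : 4 * eps <= delta' / 2 * (1 - gamma^-1).
Hypothesis q_ge : 32 <= q%:R * delta.
Hypothesis deg_le : (max_deg G <= d0)%N.
Hypothesis gap : ~ @small_gap R delta G.
Local Notation n := (Num.truncn (P (2 * (1 - delta)))).

Lemma disconnecting_prob_class (A V : {set G}) x :
  V \subset A -> Defs.connected_subset V -> size_cond d0 delta delta' A V ->
  return_cond gamma a A -> hitting_cond delta gamma A V ->
  walk_prob R n (@disconnecting G) x <= P (- 1).
Proof.
move=> VA Vc [As V_le V_ge] ret hit.
have Cg := C_ge2; have e0 := eps0; have /andP[dl0 dl1] := delta0.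
have /andP[dp0 dp1] := delta'0; have g1 := gamma1; have e2 := eps_le2.
have C1 : 1 <= C by lra.
have P0 := large_gt0P large_N.
have g0 : 0 < gamma by lra.
have gi : 0 < gamma^-1 by rewrite invr_gt0.
have et : 4 * eps <= delta' / 2.
  apply: le_trans e2 _; rewrite ler_piMr//; lra.
have es : eps * 10 <= delta / 16.
  apply: le_trans eps_le1; rewrite ler_wpM2l//; lra.
have K0 : 0 <= K by rewrite mulr_ge0 ?powR_ge0// addr_ge0// mulr_ge0// ltW.
have n_le : n%:R <= P (2 * (1 - delta)) by rewrite truncn_le ltW.
have n_ge : P (2 * (1 - delta)) <= n.+1%:R by rewrite ltW// truncnS_gt.
have m_V : P (delta' / 2) <= #|V|%:R.
  apply: le_trans V_ge; rewrite ler_pdivlMl ?ltr0n//.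
  apply: le_trans (large_const C1 large_N _ _) (large_le large_N _); last by lra.
  apply: le_trans C_ge1; apply: (@le_trans _ _ d0.+1%:R); first by rewrite ler_nat.
  have : 1 <= d0.+1%:R :> R by rewrite ler1n.
  by move: (d0.+1%:R : R) => t t1; nra.
(* The exponent delta'/2 in place of delta' absorbs the factor 1 / d0 in (2) and keeps m well below
   N^(delta/8). *)
pose m := Num.truncn (P (delta' / 2)).
have P1 : 1 <= P (delta' / 2).
  by rewrite -[leLHS](powRr0 N); apply: (large_le large_N); lra.
have mV : (0 < m <= #|V|)%N.
  rewrite truncn_gt0 P1/= -(ler_nat R); apply: le_trans m_V.
  by rewrite truncn_le ltW.
have V0 : (0 < #|V|)%N by case/andP: mV; exact: leq_trans.
have [W [WV Wc Wm]] := connected_subset_sub Vc mV.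
have hp0 := hit.1.
have hitV := hit_outside_large large_N C_ge1 C_ge2 C_ge3 eps0 gamma1 K0 delta0 eps_le1
  deg_le n_le n_ge VA V_le V0 hp0 (height'_le _ _ _)
  (height_sqrt_ge large_N C_ge1 eps0 gap) (height_sqrt_le large_N C_ge1 eps0 deg_le gap)
  (height_le large_N C_ge1 eps0 deg_le gap) (base_card_ge large_N C_ge1 eps0 gap As)
  (height'_ge large_N C_ge1 eps0 deg_le gap gamma1 eps_le1 As hp0)
  (height'_card gamma1 hp0)
  (fun k y => return_kernel V k y a0 g0 deg_le ret)
  (fun y => hitting_cond_le n hit (x := y)).
apply: (disconnecting_prob_large_gap large_N C_ge2 C_ge4 eps0 gamma1 K0 delta0 e2 _ q_ge
  n_le Wc WV Wm (fun k y => return_kernel W k y a0 g0 deg_le ret) hitV).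
lra.
Qed.

End class_member.

Theorem theorem4p1 (R : realType) (d0 : nat) (delta delta' gamma a : R)
    (hd0 : (2 <= d0)%N) (hdelta : 0 < delta < 1 / 2)
    (hdelta' : 0 < delta' < delta / 8) (ha : 0 < a) (hgamma : 1 < gamma) :
  forall eps : R, 0 < eps ->
  exists N : nat, forall G : fcgraph,
    class_G0 d0 delta delta' gamma a G -> (N <= #|G|)%N ->
    (ereal_sup
       [set srw_law R x
              [set X | disconnection_time R X
                         <= (#|G|%:R `^ (2 * (1 - delta)))%:E]
       | x in [set: cylinder G]] <= eps%:E)%E.
Proof.
move=> eps eps0; have /andP[dl0 dl1] := hdelta; have /andP[dp0 dp1] := hdelta'.
have g0 : 0 < gamma by lra.
have gi : 0 < 1 - gamma^-1 by rewrite subr_gt0 invf_lt1.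
have gi1 : 0 <= (gamma - 1)^-1 by rewrite invr_ge0 subr_ge0 ltW.
(* The first entry keeps N^e below the gain r in the count of visits to a window of N^(delta'/2)
   vertices; the second fits all multiples of e into the spare delta/16. *)
pose e := Num.min (delta' / 2 * (1 - gamma^-1) / 4) (delta / 16 / (2 * gamma + 10)).
have gp : 0 < 2 * gamma + 10 by lra.
have e0 : 0 < e by rewrite lt_min !divr_gt0// mulr_gt0// divr_gt0.
have e1 : e * (2 * gamma + 10) <= delta / 16.
  by rewrite -ler_pdivlMr// ge_min lexx orbT.
have e2 : 4 * e <= delta' / 2 * (1 - gamma^-1).
  by rewrite mulrC -ler_pdivlMr// ge_min lexx.
pose q := (Num.truncn (32 / delta)).+1.
have q_ge : 32 <= q%:R * delta by rewrite -ler_pdivrMr// ltW// truncnS_gt.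
pose K : R := (d0.+1%:R * a + 1) * 2 `^ gamma.
have K0 : 0 <= K by rewrite mulr_ge0 ?powR_ge0// addr_ge0// mulr_ge0// ltW.
pose c1 : R := 1000 * (d0.+1%:R) ^+ 2.
pose c2 : R := 50 * 50.
pose c3 : R := 240 * (K * ((gamma - 1)^-1 * 20 `^ (gamma - 1)) * 2 `^ (2 * gamma)).
pose c4 : R := 12 * q.+1%:R * (3 * (2 + K * (gamma - 1)^-1)).
have c10 : 0 <= c1 by apply: mulr_ge0; [exact: ler0n | rewrite exprn_ge0].
have c20 : 0 <= c2 by apply: mulr_ge0; exact: ler0n.
have c30 : 0 <= c3.
  apply: mulr_ge0; first exact: ler0n.
  by apply: mulr_ge0 (powR_ge0 _ _); apply: mulr_ge0 => //; apply: mulr_ge0 gi1 (powR_ge0 _ _).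
have c40 : 0 <= c4.
  apply: mulr_ge0; first by apply: mulr_ge0; exact: ler0n.
  by rewrite mulr_ge0// addr_ge0// mulr_ge0.
have c50 : 0 < 4 / eps by rewrite divr_gt0.
(* All terms are nonnegative, so C dominates each of them; the last one makes 1 / ln N at most eps /
   4. *)
pose C := c1 + c2 + c3 + c4 + 4 / eps.
have [N0 HN] := large_eventually C e0.
exists N0 => G [deg_le cls] NG; have lN := HN _ NG.
have [N1 CN _] := lN.
have C_eps : 4 / eps <= ln (#|G|%:R : R) by apply: le_trans CN; rewrite /C; lra.
have Nge0 : 0 < #|G|%:R :> R by apply: lt_trans N1.
have l0 : 0 < ln (#|G|%:R : R) by lra.
apply: ge_ereal_sup => _ [x _ <-].
apply: le_trans (disconnection_law_le _ (powR_ge0 _ _)) _; rewrite lee_fin.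
have inv_ln : (ln (#|G|%:R : R))^-1 <= eps / 4.
  by rewrite -[leRHS]invrK lef_pV2 ?posrE ?invr_gt0 ?divr_gt0// invf_div.
case: cls => [gap|[gap [A [V [VA Vc sz ret hit]]]]].
  have h0 : 0 < eps / 2 by rewrite divr_gt0.
  apply: le_trans (disconnecting_prob_small_gap _ x h0) _.
  set n := Num.truncn _.
  (* The powers of |G| in (1) and in the time horizon cancel; the total is then at most 2 eps / 4 +
     eps / 2. *)
  have : n%:R * spectral_gap G R <= (ln (#|G|%:R : R))^-1.
    apply: le_trans (ler_wpM2r (spectral_gap_ge0 _ _) (_ : _ <= #|G|%:R `^ (2 * (1 - delta)))) _.
      by rewrite truncn_le powR_ge0.
    apply: le_trans (ler_wpM2l (powR_ge0 _ _) gap) _.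
    by rewrite mulrA -powRD ?(gt_eqF Nge0) ?implybT// subrr powRr0 mul1r.
  by lra.
have C1 : c1 <= C by rewrite /C; lra.
have C2 : c2 <= C by rewrite /C; lra.
have C3 : c3 <= C by rewrite /C; lra.
have C4 : c4 <= C by rewrite /C; lra.
have d00 : (0 < d0)%N by exact: leq_trans hd0.
apply: le_trans (disconnecting_prob_class lN C1 C2 C3 C4 d00 e0 hgamma ha hdelta hdelta'
  e1 e2 q_ge deg_le gap x VA Vc sz ret hit) _.
rewrite powR_inv1 ?(ltW Nge0)//.
apply: le_trans (_ : (ln (#|G|%:R : R))^-1 <= eps); last by lra.
rewrite lef_pV2 ?posrE//; apply: ltW; exact: ln_sublinear.
Qed.
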